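(* (i) Every Cayley graph of a finite abelian group with degree at least $3$ has girth at most $4$: if $s,t$ are elements of the connection set with $t\notin\{s,s^{-1}\}$, then $(e,\,s,\,s+t,\,t)$ is a $4$-cycle (the group being written additively, with identity $e$). (ii) For every finite abelian group $A$, no Cayley graph of the generalized dihedral group $\mathrm{Dih}(A)$ has both girth $\ge 6$ and chromatic number $\ge 4$: a connection set containing an element $a\in A$ (a ''rotation'') and an element $\rho\in \mathrm{Dih}(A)\setminus A$ (a ''reflection'') yields the $4$-cycle $(e,\,\rho,\,\rho a,\,a^{-1})$, and a connection set consisting only of reflections gives a bipartite graph. (iii) For every group of order $n$ with $54\le n\le 63$ that is neither abelian nor generalized dihedral, there is no Cayley graph of degree $4$, $5$, $6$ or $7$ of that group with girth $\ge 6$ and chromatic number $\ge 4$. Consequently no $4$-chromatic Cayley graph of girth $\ge 6$ exists on $n$ vertices for any $54\le n\le 63$. For $n=59$ and $n=61$ there is no vertex-transitive graph on $n$ vertices with girth $\ge 6$ and chromatic number $\ge 4$ at all.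
   Context: Graphs are finite, simple and undirected. For a finite group $\Gamma$ with identity $e$ and a connection set $S\subseteq\Gamma\setminus\{e\}$ with $S=S^{-1}$ (not necessarily generating $\Gamma$), the Cayley graph $\mathrm{Cay}(\Gamma,S)$ has vertex set $\Gamma$ and edges $\{g,gs\}$ for $g\in\Gamma$, $s\in S$; its degree is $|S|$. For an abelian group $A$, the generalized dihedral group is $\mathrm{Dih}(A)=A\rtimes\mathbb{Z}_2$ with the nontrivial element of $\mathbb{Z}_2$ acting on $A$ by inversion; elements of $A$ are called rotations and elements outside $A$ reflections. A group is called generalized dihedral if it is isomorphic to $\mathrm{Dih}(A)$ for some abelian $A$. The girth is the length of a shortest cycle (infinite if there is none). *)

(* Defs.v *)
From mathcomp Require Import all_boot all_fingroup.
From mathcomp Require Import zmodp.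
Set Implicit Arguments.
Unset Strict Implicit.
Unset Printing Implicit Defensive.
Import GroupScope.

Record sgraph := SGraph {
  vertex :> finType;
  adj : rel vertex;
  adj_sym : symmetric adj;
  adj_irr : irreflexive adj }.

Section GraphParameters.
Variable G : sgraph.

Definition is_cycle (c : seq G) : bool :=
  [&& 2 < size c, uniq c & path.cycle (@adj G) c].

Definition has_cycle_of_length (k : nat) : bool :=
  [exists c : k.-tuple G, is_cycle c].

(* Cycles have length between 3 and #|G|; None stands for infinite girth. *)
Definition girth : option nat :=
  ohead [seq k <- iota 3 #|G| | has_cycle_of_length k].

Definition girth_at_least (k : nat) : bool :=
  if girth is Some g then k <= g else true.

Definition girth_at_most (k : nat) : bool :=
  if girth is Some g then g <= k else false.

Definition colorable (k : nat) : bool :=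
  [exists f : {ffun G -> 'I_k},
     [forall x, forall y, adj x y ==> (f x != f y)]].

Lemma colorable_exists : exists k, colorable k.
Proof.
exists #|G|; apply/existsP; exists [ffun x => enum_rank x].
apply/forallP=> x; apply/forallP=> y; apply/implyP=> xy.
rewrite !ffunE (inj_eq enum_rank_inj).
by apply: contraTneq xy => ->; rewrite adj_irr.
Qed.

Definition chromatic_number : nat := ex_minn colorable_exists.

Definition bipartite : Prop :=
  exists B : {set G}, forall x y : G, adj x y -> (x \in B) != (y \in B).

Definition is_automorphism (f : {perm G}) : Prop :=
  forall x y : G, adj (f x) (f y) = adj x y.

Definition vertex_transitive : Prop :=
  forall x y : G, exists2 f : {perm G}, is_automorphism f & f x = y.

Lemma girth_spec :
  match girth with
  | Some g => has_cycle_of_length g /\ forall c, is_cycle c -> g <= size c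
  | None => forall c, ~~ is_cycle c
  end.
Proof.
have inr c : is_cycle c ->
  size c \in [seq k <- iota 3 #|G| | has_cycle_of_length k].
  move=> cc; rewrite mem_filter mem_iota; case/and3P: (cc) => c2 cu _.
  rewrite c2 (leq_ltn_trans (uniq_leq_size cu (s2 := enum G) _)) /=.
  - by rewrite andbT; apply/existsP; exists (in_tuple c).
  - by move=> x _; rewrite mem_enum.
  by rewrite -cardE add3n ltnS; do 2 apply: leqW.
rewrite /girth; have := sorted_filter leq_trans has_cycle_of_length
  (iota_sorted 3 #|G|).
case E: [seq k <- _ | _] inr => [|g s] /= inr srt.
  by move=> c; apply/negP => /inr.
split.
  by have: g \in g :: s by [rewrite inE eqxx]; rewrite -E mem_filter => /andP[].
move=> c /inr; rewrite inE => /predU1P[->//|].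
by have /allP := order_path_min leq_trans srt; apply.
Qed.

End GraphParameters.

Record connection_set (gT : finGroupType) := ConnectionSet {
  cset :> {set gT};
  cset_not1 : 1 \notin cset;
  cset_inv : cset^-1 = cset }.

Section CayleyGraph.
Variables (gT : finGroupType) (S : connection_set gT).

(* {x, y} = {g, g * s} for some vertex g and some s \in S. *)
Definition cayley_adj : rel gT :=
  fun x y => [exists s in S, (y == x * s) || (x == y * s)].

Lemma cayley_adj_sym : symmetric cayley_adj.
Proof. by move=> x y; apply: eq_existsb => s; rewrite orbC. Qed.

Lemma cayley_adj_irr : irreflexive cayley_adj.
Proof.
move=> x; apply/existsP => -[s /andP[sS]]; rewrite orbb => /eqP xs.
have s1 : s = 1 by apply: (mulgI x); rewrite -xs mulg1.
by move: sS; rewrite s1 (negPf (cset_not1 S)).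
Qed.

Definition Cay : sgraph := SGraph cayley_adj_sym cayley_adj_irr.

Lemma cayley_adjE (x y : gT) : cayley_adj x y = (x^-1 * y \in S).
Proof.
apply/existsP/idP => [[s /andP[sS /orP[]/eqP->]]|xyS].
- by rewrite mulKg.
- by rewrite invMg mulgKV -mem_invg cset_inv.
by exists (x^-1 * y); rewrite xyS mulKVg eqxx.
Qed.

End CayleyGraph.

Section GeneralizedDihedral.
Variables (A : finGroupType) (abelA : abelian [set: A]).

(* The group law of 'Z_2 is addition, so its neutral element 1%g is 0. *)
Definition inversion (a : A) (z : 'Z_2) : A := if z == 1 then a else a^-1.

Lemma inversion1 : inversion^~ 1 =1 id.
Proof. by move=> a; rewrite /inversion eqxx. Qed.

Lemma inversionM (a : A) : act_morph inversion a.
Proof.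
by case=> [[|[|//]] i] [[|[|//]] j]; rewrite /inversion //= invgK.
Qed.

Definition inversion_action := TotalAction inversion1 inversionM.

Lemma inversion_is_groupAction :
  is_groupAction [set: A] (inversion_action : action [set: 'Z_2] A).
Proof.
move=> z _; rewrite inE; apply/andP; split.
  by apply/subsetP=> x; rewrite inE.
apply/morphicP=> a b _ _; rewrite !actpermE /= /inversion.
by case: eqP => // _; rewrite invMg; apply: (centsP abelA); rewrite inE.
Qed.

Definition inversion_groupAction : groupAction [set: 'Z_2] [set: A] :=
  GroupAction inversion_is_groupAction.

Definition Dih : finGroupType := sdprod_by inversion_groupAction.

Definition rotations : {set Dih} := sdpair1 inversion_groupAction @* [set: A].

Definition reflections : {set Dih} := ~: rotations.

End GeneralizedDihedral.

Definition generalized_dihedral (gT : finGroupType) : Prop :=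
  exists (A : finGroupType) (abelA : abelian [set: A]),
    [set: gT] \isog [set: Dih abelA].

(* Main.v *)
Require Import Defs.
From mathcomp Require Import all_boot all_fingroup.
From mathcomp Require Import commutator cyclic center pgroup nilpotent sylow.
From mathcomp Require Import abelian maximal extremal.
Set Implicit Arguments.
Unset Strict Implicit.
Unset Printing Implicit Defensive.
Import GroupScope.

(** Every Cayley graph of girth at least 6 of a group of order 54 to 63 is
    3-colourable ([chromatic54_63]); both claims on Cayley graphs of such orders
    are instances.  The 4-cycles in abelian and generalized dihedral groups are
    direct computations.

    Girth 6 says that distinct reduced words in the connection set S of total
    length at most 5 have distinct products ([short_words_inj]).  Hence two
    elements of S commute, or one inverts the other, only if they are equal or
    mutually inverse, and an element of S has order 2 or at least 6.  If S lies
    in an abelian subgroup the graph has degree at most 2 and is 3-colourable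
    ([abelian_support_chromatic]).  If an abelian subgroup A of index 2 is
    centralised or inverted elementwise by the elements outside A, then S lies
    in A or misses A, and in the latter case the graph is bipartite
    ([inverting_index2_chromatic]).  The first fact covers the prime orders 59
    and 61 and, as elements of order 3 and 5 are excluded, the orders 55 and 57;
    the second covers generalized dihedral groups and the orders 58 and 62.

    For the orders 54, 56, 60 and 63, Sylow theory reduces the group to a short
    list of multiplication tables.  For each table there is a small family F of
    maps to three colours such that every S of girth at least 6 is compatible
    with one of them.  A map fails to be a proper colouring only through steps s
    in S that join two points of equal colour, so this is checked by a branching
    search: pick a map of F, branch over its bad steps as possible elements of S,
    and abandon a branch as soon as the elements chosen so far produce a short
    relation, that is, a cycle of length less than 6 ([search_sound]).  The
    colourings are a certificate; only the search itself is computed.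

    Most tables come from polycyclic presentations ([polycyclic_chromatic]); a
    group of order 56 with eight Sylow 7-subgroups is the affine group of the
    field with 8 elements, the product of A4 and a group of order 5 has a similar
    description ([affine_chromatic]), and a group of order 60 with six Sylow
    5-subgroups acts faithfully by even permutations on five points
    ([chromatic60_five_points]).

    A vertex-transitive graph on a prime number of vertices is a Cayley graph of
    a cyclic group, as an automorphism of that order acts regularly
    ([vertex_transitive_prime_chromatic]). *)

(** * Girth and short words *)

Lemma girth_at_leastP (G : sgraph) k :
  reflect (forall c : seq G, is_cycle c -> k <= size c) (girth_at_least G k).
Proof.
have spec := girth_spec G; apply: (iffP idP); rewrite /girth_at_least.
  case: girth spec => [g [_ g_min] le_kg c /g_min | acyc _ c cc].
    exact: leq_trans.
  by have := acyc c; rewrite cc.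
case: girth spec => // g [/existsP[c cc] _] /(_ _ cc).
by rewrite size_tuple.
Qed.

Lemma chromatic_number_le (G : sgraph) k : colorable G k -> chromatic_number G <= k.
Proof. by rewrite /chromatic_number; case: ex_minnP => m _ min_m /min_m. Qed.

Definition proper3 (G : sgraph) (f : G -> 'I_3) :=
  forall x y : G, adj x y -> f x != f y.

Lemma proper3_chromatic (G : sgraph) (f : G -> 'I_3) :
  proper3 f -> chromatic_number G <= 3.
Proof.
move=> fP; apply: chromatic_number_le; apply/existsP; exists [ffun x => f x].
apply/forallP=> x; apply/forallP=> y; apply/implyP => /fP.
by rewrite !ffunE.
Qed.

Lemma bipartite_chromatic (G : sgraph) : bipartite G -> chromatic_number G <= 3.
Proof.
case=> B BP; apply: (@proper3_chromatic _ (fun x => inord (x \in B))) => x y /BP.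
apply: contraNneq => /(congr1 val) /=; rewrite !inordK; try by case: (_ \in B).
by case: (x \in B); case: (y \in B).
Qed.

Section ShortWords.
Variables (gT : finGroupType) (S : connection_set gT).
Implicit Types (s t x y : gT) (w : seq gT).

Definition reduced w :=
  all (mem (S : {set gT})) w && sorted (fun x y => y != x^-1) w.

Definition wprod w := \prod_(x <- w) x.

Lemma wprod_cat w1 w2 : wprod (w1 ++ w2) = wprod w1 * wprod w2.
Proof. by rewrite /wprod big_cat. Qed.

Lemma wprod1 x : wprod [:: x] = x.
Proof. by rewrite /wprod big_seq1. Qed.

Lemma wprod_cons x w : wprod (x :: w) = x * wprod w.
Proof. by rewrite /wprod big_cons. Qed.

Lemma wprod_inv w : wprod (rev [seq x^-1 | x <- w]) = (wprod w)^-1.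
Proof.
elim: w => [|x w IHw]; first by rewrite /wprod big_nil invg1.
by rewrite map_cons rev_cons -cats1 wprod_cat IHw wprod1 wprod_cons invMg.
Qed.

Lemma reduced_sub w i k : reduced w -> reduced (take k (drop i w)).
Proof.
case/andP=> /allP wS ws; apply/andP; split.
  by apply/allP=> x /mem_take/mem_drop/wS.
by rewrite take_sorted // drop_sorted.
Qed.

Lemma mem_setV s : (s^-1 \in (S : {set gT})) = (s \in (S : {set gT})).
Proof. by rewrite -mem_invg cset_inv. Qed.

Lemma reduced_inv w : reduced w -> reduced (rev [seq x^-1 | x <- w]).
Proof.
case/andP=> /allP wS ws; apply/andP; split.
  by apply/allP=> x; rewrite mem_rev => /mapP[y /wS yS ->]; rewrite /= mem_setV.
rewrite rev_sorted sorted_map; apply: sub_sorted ws => x y /=.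
by rewrite invgK eq_sym.
Qed.

Lemma path_map_iota (T : Type) (e : rel T) (P : nat -> T) i k :
  (forall j, i <= j < i + k -> e (P j) (P j.+1)) ->
  path e (P i) [seq P j | j <- iota i.+1 k].
Proof.
elim: k i => //= k IHk i eP; rewrite eP ?leqnn ?addnS ?ltnS ?leq_addr //=.
apply: IHk => j /andP[lt_ij lt_jk]; apply: eP.
by rewrite (ltnW lt_ij) addnS -addSn.
Qed.

Hypothesis girth6 : girth_at_least (Cay S) 6.

(** The partial products of a shortest counterexample are distinct, as two equal
    ones would cut out a shorter reduced word of product 1; so they trace a
    cycle of length less than 6. *)
Lemma short_word_neq1 w : reduced w -> 0 < size w < 6 -> wprod w != 1.
Proof.
have [n] := ubnP (size w); elim: n w => // n IHn w le_wn wR /andP[w_gt0 w_lt6].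
apply/eqP=> w1; pose P i := wprod (take i w); set k := size w in w_gt0 w_lt6.
have PD i j : i <= j -> P j = P i * wprod (take (j - i) (drop i w)).
  by move=> le_ij; rewrite /P -wprod_cat take_drop subnK // -{1}(cat_take_drop i (take j w)) take_takel.
have PS i : i < k -> P i.+1 = P i * nth 1 w i.
  by move=> lt_ik; rewrite /P (take_nth 1) // -cats1 wprod_cat wprod1.
have nthS i : i < k -> nth 1 w i \in (S : {set gT}).
  by move=> lt_ik; case/andP: wR => /allP wS _; apply: wS (mem_nth 1 lt_ik).
have P_inj : {in gtn k &, injective P}.
  suffices P_inj i j : i < j -> j < k -> P i != P j.
    move=> i j lt_ik lt_jk eqP; case: (ltngtP i j) => // [lt_ij|lt_ji].
      by have := P_inj i j lt_ij lt_jk; rewrite eqP eqxx.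
    by have := P_inj j i lt_ji lt_ik; rewrite eqP eqxx.
  move=> lt_ij lt_jk; rewrite (PD i j (ltnW lt_ij)) -{1}[P i]mulg1.
  rewrite (inj_eq (mulgI _)) eq_sym.
  have sz : size (take (j - i) (drop i w)) = j - i.
    by rewrite size_takel // size_drop leq_sub2r // ltnW.
  apply: IHn; rewrite ?reduced_sub ?sz //.
    by rewrite -ltnS (leq_trans _ le_wn) // !ltnS (leq_ltn_trans (leq_subr _ _)).
  by rewrite subn_gt0 lt_ij (leq_ltn_trans (leq_subr _ _)) // (ltn_trans lt_jk).
have Pk : P k = P 0 by rewrite /P take_size w1 take0 /wprod big_nil.
have cP : @is_cycle (Cay S) [seq P i | i <- iota 0 k] -> False.
  by move/(girth_at_leastP _ _ girth6); rewrite size_map size_iota leqNgt w_lt6.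
apply: cP; apply/and3P; rewrite size_map size_iota; split.
- have [k1|k_ge2] := leqP k 1.
    have{k1} k1 : k = 1%N by apply/eqP; rewrite eqn_leq k1.
    case/negP: (cset_not1 S); move: (PS 0 w_gt0); rewrite -k1 Pk.
    by rewrite /P take0 /wprod big_nil mul1g => ->; apply: nthS.
  rewrite ltn_neqAle k_ge2 andbT; apply/eqP=> k2.
  case/andP: wR => _; move: (PS 0 w_gt0) (PS 1%N k_ge2); rewrite k2 Pk => ->.
  rewrite /P take0 {1 2}/wprod big_nil mul1g.
  case: w {le_wn w_gt0 w_lt6 w1 P PD PS nthS P_inj Pk} @k k_ge2 k2 => [|x [|y [|z w]]] //= _ _ /eqP.
  by rewrite eq_sym -eq_invg_mul eq_sym => ->.
- rewrite map_inj_in_uniq ?iota_uniq // => i j; rewrite !mem_iota !add0n /=.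
  exact: P_inj.
have -> : iota 0 k = 0 :: iota 1 k.-1 by case: (k) w_gt0.
rewrite /= -{2}Pk -{2}(prednK w_gt0) -add1n -map_rcons.
have -> : rcons (iota 1 k.-1) (1 + k.-1) = iota 1 k.
  by rewrite -[k in RHS](prednK w_gt0) -[k.-1.+1]addn1 iotaD cats1.
apply: (path_map_iota (e := cayley_adj S)) => i /=; rewrite add0n => lt_ik.
by rewrite cayley_adjE PS // mulKg nthS.
Qed.

(** Cancelling a common last letter until the last letters differ makes the
    quotient of the two products a reduced word of length at most 5. *)
Lemma short_words_inj w1 w2 : reduced w1 -> reduced w2 ->
  size w1 + size w2 < 6 -> wprod w1 = wprod w2 -> w1 = w2.
Proof.
have nil_word w : reduced w -> size w < 6 -> wprod w = 1 -> w = [::].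
  case: w => // x w wR lt_w6 eq1.
  by have := short_word_neq1 wR; rewrite eq1 eqxx => /(_ lt_w6).
elim/last_ind: w1 w2 => [|w1 x IHw] w2.
  move=> _ w2R lt6 eqw; apply/esym/nil_word => //.
  by rewrite -eqw /wprod big_nil.
elim/last_ind: w2 => [|w2 y _] w1R w2R lt6 eqw.
  apply: nil_word; rewrite ?eqw ?/wprod ?big_nil //.
  by rewrite addn0 in lt6.
have [eqxy | neqxy] := eqVneq x y.
  rewrite eqxy (IHw w2) //.
  - by have := @reduced_sub _ 0 (size w1) w1R; rewrite drop0 -cats1 take_size_cat.
  - by have := @reduced_sub _ 0 (size w2) w2R; rewrite drop0 -cats1 take_size_cat.
  - by apply: leq_trans lt6; rewrite ltnS !size_rcons leq_add.
  by move: eqw; rewrite -!cats1 !wprod_cat !wprod1 eqxy => /mulIg.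
have /negP[] : wprod (rcons w1 x ++ rev [seq x^-1 | x <- rcons w2 y]) != 1.
  apply: short_word_neq1; last first.
    by rewrite size_cat size_rev size_map lt6 size_rcons addSn.
  have /andP[aS sS] := reduced_inv w2R; have /andP[aS1 sS1] := w1R.
  rewrite /reduced all_cat aS aS1 /=; move: sS sS1.
  rewrite map_rcons rev_rcons -cats1 -catA /=.
  have Nxy : y^-1 != x^-1 by rewrite (inj_eq invg_inj) eq_sym.
  case: (w1) => [|z w] /= sS; first by rewrite sS andbT.
  by rewrite !cat_path /= => /andP[-> /andP[-> _]] /=; rewrite sS andbT.
by rewrite wprod_cat wprod_inv eqw mulgV.
Qed.

End ShortWords.

(** * Search for a colouring compatible with the connection set *)

(** Under call by value, [has] evaluates both arguments of its disjunction and so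
    never stops early; the searches below use [some] and [memn] instead. *)
Section LazySearch.
Variables (T : Type) (a : T -> bool).

Fixpoint some (s : seq T) : bool :=
  if s is x :: s' then if a x then true else some s' else false.

Lemma someE s : some s = has a s.
Proof. by elim: s => //= x s ->; case: (a x). Qed.

End LazySearch.

Fixpoint memn (x : nat) (s : seq nat) : bool :=
  if s is y :: s' then if eqn x y then true else memn x s' else false.

Lemma memnE x s : memn x s = (x \in s).
Proof. by elim: s => //= y s ->; rewrite inE -eqnE; case: (eqn x y). Qed.

(** A group of order n is coded by the numbers below n, 0 being the neutral
    element; its multiplication table [tab] and its list of inverses [invs] are
    computed once.  A set T of codes stands for known elements of S. *)
Section ColoringSearch.
Variables (n : nat) (tab : seq (seq nat)) (invs : seq nat).

Definition mulc a b := nth 0 (nth [::] tab a) b.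
Definition invc a := nth 0 invs a.

(** Tests whether a word s b or s b c over T equals one of length at most 2 that
    does not begin with s.  For reduced words this contradicts girth 6; only
    words beginning with s are tried because s is the element just added to T. *)
Definition clash (s : nat) (T : seq nat) : bool :=
  let low := 0 :: T ++ flatten
    [seq (let row := nth [::] tab d in let d' := invc d in
         [seq nth 0 row e | e <- T & ~~ eqn e d']) | d <- T & ~~ eqn d s] in
  let row := nth [::] tab s in let s' := invc s in
  some (fun b => if eqn b s' then false else
    let sb := nth 0 row b in if memn sb low then true else
    let row' := nth [::] tab sb in let b' := invc b in
    some (fun c => if eqn c b' then false else memn (nth 0 row' c) low) T) T.

(** The codes s, up to inversion, for which f colours some x and x s alike: f is
    a proper colouring if and only if S contains none of them. *)
Definition bad_steps (f : seq nat) : seq nat :=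
  [seq s <- iota 1 n.-1 | if s <= invc s then
     some (fun x => eqn (nth 0 f x) (nth 0 f (mulc x s))) (iota 0 n) else false].

(** Some list of bad steps disjoint from T is refuted: each of its members s
    either clashes with T, or leads to a search that succeeds with s and its
    inverse added to T. *)
Fixpoint search (bads : seq (seq nat)) (fuel : nat) (T : seq nat) : bool :=
  if fuel is k.+1 then
    if [seq B <- bads | ~~ some (memn^~ T) B] is B :: _ then
      ~~ some (fun s => let T' := s :: invc s :: T in
                 if clash s T' then false else ~~ search bads k T') B
    else false
  else false.

End ColoringSearch.

Definition table n (mul : nat -> nat -> nat) :=
  [seq [seq mul a b | b <- iota 0 n] | a <- iota 0 n].

Definition inverses (tab : seq (seq nat)) := [seq index 0 r | r <- tab].

(** Each level of the search adds an element of S, and in all cases below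
    clashes stop it before seven levels. *)
Definition colorings_suffice n (mul : nat -> nat -> nat) (F : seq (seq nat)) (T : seq nat) :=
  let tab := table n mul in let invs := inverses tab in
  let bads := [seq bad_steps n tab invs f | f <- F] in
  all (all (gtn 3)) F && search tab invs bads 7 T.

Section SearchSound.
Variables (gT : finGroupType) (n : nat) (mul : nat -> nat -> nat) (phi : nat -> gT).
Hypotheses (card_gT : #|gT| = n) (phi0 : phi 0 = 1)
  (phi_onto : forall g, exists2 a, a < n & phi a = g)
  (mul_lt : forall a b, a < n -> b < n -> mul a b < n)
  (phiM : forall a b, a < n -> b < n -> phi (mul a b) = phi a * phi b).

Let tab := table n mul.
Let invs := inverses tab.

Let codes := [seq phi a | a <- iota 0 n].
Let code g := index g codes.

Let mem_codes g : g \in codes.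
Proof.
by have [a lt_an <-] := phi_onto g; apply: map_f; rewrite mem_iota add0n.
Qed.

Let size_codes : size codes = n. Proof. by rewrite size_map size_iota. Qed.

Let code_lt g : code g < n.
Proof. by rewrite -size_codes index_mem. Qed.

Let codeK g : phi (code g) = g.
Proof.
by rewrite -[RHS](nth_index 1 (mem_codes g)) (nth_map 0) ?size_iota ?nth_iota ?add0n ?code_lt.
Qed.

Let uniq_codes : uniq codes.
Proof.
have eqc : codes =i enum gT by move=> g; rewrite mem_codes mem_enum.
by rewrite (uniq_size_uniq (enum_uniq gT) (fun g => esym (eqc g))) size_codes -cardE card_gT.
Qed.

Let phiK a : a < n -> code (phi a) = a.
Proof.
move=> lt_an; rewrite /code -[phi a](_ : nth 1 codes a = _) ?index_uniq ?size_codes //.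
by rewrite (nth_map 0) ?size_iota // nth_iota.
Qed.

Let phi_inj a b : a < n -> b < n -> phi a = phi b -> a = b.
Proof. by move=> /phiK{2}<- /phiK{2}<- ->. Qed.

Let rowE a : a < n -> nth [::] tab a = [seq mul a b | b <- iota 0 n].
Proof. by move=> lt_an; rewrite (nth_map 0) ?size_iota // nth_iota. Qed.

Let mulcE a b : a < n -> b < n -> mulc tab a b = mul a b.
Proof.
by move=> lt_an lt_bn; rewrite /mulc rowE // (nth_map 0) ?size_iota // nth_iota.
Qed.

Let invcP a : a < n -> invc invs a < n /\ phi (invc invs a) = (phi a)^-1.
Proof.
move=> lt_an; set b := code (phi a)^-1.
have lt_bn : b < n by apply: code_lt.
have n_gt0 : 0 < n by apply: leq_ltn_trans lt_an.
have ab0 : mul a b = 0.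
  by apply: phi_inj; rewrite ?mul_lt // phiM // codeK mulgV phi0.
have -> : invc invs a = index 0 [seq mul a b | b <- iota 0 n].
  by rewrite /invc (nth_map [::]) ?size_map ?size_iota // rowE.
set r := map _ _; have r0 : 0 \in r by rewrite -ab0 map_f // mem_iota.
have lt_in : index 0 r < n by move: r0; rewrite -index_mem size_map size_iota.
split=> //; apply/esym/eqP; rewrite eq_invg_mul -phiM //.
have := nth_index 0 r0; rewrite (nth_map 0) ?size_iota // nth_iota // add0n => ->.
by rewrite phi0.
Qed.

Variable S : connection_set gT.
Hypothesis girth6 : girth_at_least (Cay S) 6.

Let inS (T : seq nat) := forall t, t \in T -> t < n /\ phi t \in (S : {set gT}).

Let clash_sound s T : inS T -> s \in T -> ~~ clash tab invs s T.
Proof.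
move=> TS sT; have [lt_sn sS] := TS s sT.
have neqV t u : t < n -> u < n -> ~~ eqn u (invc invs t) -> phi u != (phi t)^-1.
  move=> lt_tn lt_un; have [lt_in <-] := invcP lt_tn.
  by apply: contraNneq => /phi_inj->; rewrite ?eqnE.
have rd1 t : t \in T -> reduced S [:: phi t].
  by case/TS=> _ tS; rewrite /reduced /= tS.
have rd2 t u : t \in T -> u \in T -> ~~ eqn u (invc invs t) -> reduced S [:: phi t; phi u].
  case/TS=> lt_t tS; case/TS=> lt_u uS neq.
  by rewrite /reduced /= tS uS neqV.
pose low w := [\/ w = [::], exists2 t, t \in T & w = [:: phi t]
  | exists d e, [/\ d \in T, d != s, e \in T, ~~ eqn e (invc invs d) & w = [:: phi d; phi e]]].
have lowP x : memn x (0 :: T ++ flatten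
    [seq [seq nth 0 (nth [::] tab d) e | e <- T & ~~ eqn e (invc invs d)] | d <- T & ~~ eqn d s]) ->
  x < n -> exists2 w, low w & phi x = wprod w.
  rewrite memnE inE mem_cat => xlow lt_xn; case/or3P: xlow => [/eqP->|xT|/flatten_mapP[d]].
  - by exists [::]; [apply: Or31 | rewrite /wprod big_nil phi0].
  - by exists [:: phi x]; [apply: Or32; exists x | rewrite wprod1].
  rewrite mem_filter => /andP[neq_ds dT] /mapP[e]; rewrite mem_filter => /andP[neq_ed eT] xE.
  have [lt_d dS] := TS _ dT; have [lt_e eS] := TS _ eT.
  exists [:: phi d; phi e]; first by apply: Or33; exists d, e; split.
  by rewrite xE -/(mulc _ _ _) mulcE // phiM // wprod_cons wprod1.
have low_red w : low w -> reduced S w /\ size w <= 2.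
  by case=> [->|[t tT ->]|[d [e [dT _ eT ned ->]]]]; split=> //; auto.
(* Words beginning with s differ from low words, so their products do too. *)
have clashF w w' : reduced S w -> 1 < size w <= 3 -> head 1 w = phi s -> low w' ->
    wprod w = wprod w' -> False.
  move=> wR /andP[w_gt1 w_le3] hw w'L eqw; have [w'R w'_le2] := low_red _ w'L.
  have eqww' : w = w'.
    by apply: (short_words_inj girth6) => //; rewrite ltnS (leq_add w_le3 w'_le2).
  move: w_gt1 hw; rewrite {}eqww'; case: w'L => [->|[t tT ->]|[d [e [dT nds eT _ ->]]]] //= _.
  by have [lt_d _] := TS _ dT; move/phi_inj=> eqds; rewrite eqds ?eqxx in nds.
rewrite /clash /= someE; apply/hasPn => b bT; have [lt_bn bS] := TS b bT.
case: ifP => // /negbT neq_bs; have rsb := rd2 _ _ sT bT neq_bs.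
have lt_sb : mul s b < n by apply: mul_lt.
rewrite -/(mulc tab s b) mulcE //.
case: ifP => [/lowP-/(_ lt_sb)[w wL]|_].
  rewrite phiM // => eqw; exfalso; apply: (clashF [:: phi s; phi b] w) => //.
  by rewrite wprod_cons wprod1.
rewrite someE; apply/hasPn => c cT; have [lt_cn cS] := TS c cT.
case: ifP => // /negbT neq_cb.
rewrite -/(mulc tab (mul s b) c) mulcE //; apply/negP=> /lowP-/(_ (mul_lt lt_sb lt_cn))[w wL].
rewrite !phiM // => eqw; apply: (clashF [:: phi s; phi b; phi c] w) => //.
  by rewrite /reduced /= sS bS cS !neqV.
by rewrite 2!wprod_cons wprod1 mulgA.
Qed.

(** If S meets the bad steps of f in s, then s does not clash with the known part
    of S, hence the search continues below s; otherwise f is proper. *)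
Lemma search_sound F k T : all (all (gtn 3)) F -> inS T ->
  search tab invs [seq bad_steps n tab invs f | f <- F] k T ->
  exists f : Cay S -> 'I_3, proper3 f.
Proof.
move=> F3; elim: k T => // k IHk T TS /=.
case defB: [seq B <- _ | _] => [//|B Bs].
have : B \in B :: Bs by rewrite inE eqxx.
rewrite -defB mem_filter => /andP[_ /mapP[f fF {Bs defB} ->]].
rewrite someE; set B' := bad_steps _ _ _ _ => /hasPn BP.
have [/hasP[s sB sS] | /hasPn noB] := boolP (has (fun s => phi s \in (S : {set gT})) B').
  have lt_sn : s < n.
    move: sB; rewrite mem_filter mem_iota => /and3P[_ _].
    by rewrite add1n; case: (n) card_gT => // /eqP; rewrite -leqn0 leqNgt (cardD1 1).
  have [lt_in phiV] := invcP lt_sn.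
  have TS' : inS [:: s, invc invs s & T].
    by move=> t; rewrite !inE => /or3P[/eqP->|/eqP->|/TS] //; rewrite phiV mem_setV.
  have := BP s sB; rewrite (negbTE (clash_sound TS' (mem_head _ _))) negbK.
  exact: IHk TS'.
exists (fun g => inord (nth 0 f (code g))) => x y /= xy.
have lt3 a : nth 0 f a < 3.
  have [lt_a|le_a] := ltnP a (size f); last by rewrite nth_default.
  by have /allP := allP F3 f fF; apply; apply: mem_nth.
apply: contraTneq xy => /(congr1 val); rewrite /= !inordK // => eq_xy.
rewrite cayley_adjE; apply/negP; set s := _ * _ => sS.
have s1 : s != 1 by apply: contraTneq sS => ->; apply: cset_not1.
have bad g h : g^-1 * h \in (S : {set gT}) -> nth 0 f (code g) = nth 0 f (code h) ->
    code (g^-1 * h) <= invc invs (code (g^-1 * h)) -> False.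
  move=> ghS eq_gh le_gh.
  suffices /noB : code (g^-1 * h) \in B' by rewrite codeK ghS.
  rewrite mem_filter le_gh someE mem_iota; apply/andP; split.
    apply/hasP; exists (code g); first by rewrite mem_iota code_lt.
    rewrite mulcE ?code_lt // eqnE eq_gh; apply/eqP; congr nth.
    by apply: phi_inj; rewrite ?mul_lt ?code_lt // phiM ?code_lt // !codeK mulKVg.
  rewrite lt0n add1n; apply/andP; split.
    apply: contraTneq ghS => gh0.
    by rewrite -[_ * _]codeK gh0 phi0 cset_not1.
  by apply: leq_trans (code_lt _) _; case: (n).
(* Bad steps are listed up to inversion, so the edge may have to be reversed. *)
have [le_s|lt_s] := leqP (code s) (invc invs (code s)); first exact: (bad x y).
have [lt_in phiV] := invcP (code_lt s); rewrite codeK in phiV.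
have eqV : code s^-1 = invc invs (code s) by rewrite -phiV phiK.
have sV : y^-1 * x = s^-1 by rewrite /s invMg invgK.
apply: (bad y x); rewrite ?sV ?mem_setV // eqV.
suff -> : invc invs (invc invs (code s)) = code s by apply: ltnW.
have [lt_in' phiV'] := invcP lt_in; apply: phi_inj => //; rewrite ?code_lt //.
by rewrite phiV' phiV invgK codeK.
Qed.

Lemma model_chromatic F T : colorings_suffice n mul F T -> inS T ->
  chromatic_number (Cay S) <= 3.
Proof.
by case/andP=> F3 sch TS; have [f /proper3_chromatic] := search_sound F3 TS sch.
Qed.

End SearchSound.

(** * Extensions of a cyclic normal subgroup *)

(** Let <[c]> be normal of order m with coset representatives rho x, x < r.  The
    code x m + i, i < m, stands for c^i rho x; rho x acts on <[c]> by the power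
    u x, and op x y = (e, o) when rho x rho y = c^e rho o. *)
Definition ext_mul m (u : nat -> nat) (op : nat -> nat -> nat * nat) a b :=
  let: (e, o) := op (a %/ m) (b %/ m) in
  o * m + (a %% m + u (a %/ m) * (b %% m) + e) %% m.

(** For q dividing m, a colouring of the quotient by <[c^q]>, in the code with q
    in place of m; most colourings needed are pulled back from a quotient. *)
Definition lift_coloring m r (qf : nat * seq nat) :=
  [seq nth 0 qf.2 ((a %/ m) * qf.1 + (a %% m) %% qf.1) | a <- iota 0 (m * r)].

Definition ext_colorings_suffice m r u op F :=
  colorings_suffice (m * r) (ext_mul m u op) [seq lift_coloring m r qf | qf <- F] [::].

Section CyclicExtension.
Variables (gT : finGroupType) (m r : nat) (c : gT) (rho : nat -> gT).
Variables (u : nat -> nat) (op : nat -> nat -> nat * nat).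
Hypotheses (card_gT : #|gT| = (m * r)%N) (cm1 : c ^+ m = 1) (rho0 : rho 0 = 1).
Hypothesis op_lt : forall x y, x < r -> y < r -> (op x y).2 < r.
Hypothesis rho_c : forall x, x < r -> rho x * c = c ^+ u x * rho x.
Hypothesis rhoM : forall x y, x < r -> y < r ->
  rho x * rho y = c ^+ (op x y).1 * rho (op x y).2.
Hypothesis rho_onto : forall g, exists2 x, x < r & exists i, g = c ^+ i * rho x.

Lemma cyclic_extension_chromatic F (S : connection_set gT) :
  ext_colorings_suffice m r u op F -> girth_at_least (Cay S) 6 ->
  chromatic_number (Cay S) <= 3.
Proof.
move=> suffF girth6; have gT_gt0 : 0 < m * r by rewrite -card_gT (cardD1 1).
have /andP[m_gt0 r_gt0] : (0 < m) && (0 < r) by rewrite -muln_gt0.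
pose phi a := c ^+ (a %% m) * rho (a %/ m).
have cmod i : c ^+ (i %% m) = c ^+ i by rewrite (expg_mod _ cm1).
have phiE x i : phi (x * m + i %% m) = c ^+ i * rho x.
  by rewrite /phi modnMDl modn_mod cmod divnMDl // (divn_small (ltn_pmod _ _)) ?addn0.
have code_lt x i : x < r -> x * m + i %% m < m * r.
  move=> lt_xr; apply: (@leq_trans (x.+1 * m)%N); last by rewrite mulnC leq_mul2l lt_xr orbT.
  by rewrite mulSn addnC ltn_add2r ltn_pmod.
have div_lt a : a < m * r -> a %/ m < r by rewrite ltn_divLR // mulnC.
apply: (model_chromatic (phi := phi) card_gT _ _ _ _ girth6 suffF) => //.
- by rewrite /phi mod0n div0n rho0 mulg1.
- move=> g; have [x lt_xr [i ->]] := rho_onto g.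
  by exists (x * m + i %% m); rewrite ?code_lt ?phiE.
- move=> a b /div_lt lt_a /div_lt lt_b; rewrite /ext_mul.
  by case: (op _ _) (op_lt lt_a lt_b) => e o /= lt_or; apply: code_lt.
- move=> a b /div_lt lt_a /div_lt lt_b; rewrite /ext_mul.
  case: (op _ _) (rhoM lt_a lt_b) => e o /= eM; rewrite phiE /phi.
  have rho_ci i : rho (a %/ m) * c ^+ i = c ^+ (u (a %/ m) * i) * rho (a %/ m).
    elim: i => [|i IHi]; first by rewrite muln0 mulg1 mul1g.
    by rewrite expgSr mulgA IHi -mulgA rho_c // mulgA -expgD mulnS addnC.
  by rewrite !mulgA -(mulgA (c ^+ _) (rho _)) rho_ci !expgD -!mulgA eM cmod.
Qed.

End CyclicExtension.

(** * Connection sets and abelian subgroups *)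
Lemma degree2_chromatic (G : sgraph) :
  (forall x : G, #|[set y | adj x y]| <= 2) -> chromatic_number G <= 3.
Proof.
move=> deg2.
suffices [f fP] : exists f : {ffun G -> 'I_3},
    {in [set: G] &, forall x y, adj x y -> f x != f y}.
  by apply: (@proper3_chromatic _ f) => x y; apply: fP; rewrite inE.
have [k] := ubnP #|[set: G]|; elim: k [set: G] => // k IHk D le_Dk.
have [->|[x xD]] := set_0Vmem D.
  by exists [ffun=> ord0] => x; rewrite inE.
have [f fP] : exists f : {ffun G -> 'I_3},
    {in D :\ x &, forall x y, adj x y -> f x != f y}.
  by apply: IHk; rewrite -ltnS (leq_trans _ le_Dk) // [#|D|](cardsD1 x) xD.
have [c cP] : exists c, c \notin f @: [set y | adj x y].
  apply/existsP; apply: contraT; rewrite negb_exists => /forallP fall.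
  have: #|[set: 'I_3]| <= 2.
    apply: leq_trans (deg2 x); apply: leq_trans (leq_imset_card f _).
    by apply/subset_leq_card/subsetP => c _; have := fall c; rewrite negbK.
  by rewrite cardsT card_ord.
have cx y : adj x y -> c != f y.
  by move=> xy; apply: contraNneq cP => ->; apply: imset_f; rewrite inE.
exists [ffun y => if y == x then c else f y] => y z yD zD yz; rewrite !ffunE.
case: (eqVneq y x) yz => [->|neq_yx]; case: (eqVneq z x) => [->|neq_zx] yz.
- by rewrite adj_irr in yz.
- exact: cx.
- by rewrite eq_sym cx // adj_sym.
by apply: fP; rewrite // !inE ?neq_yx ?neq_zx.
Qed.

Section AbelianSubgroups.
Variables (gT : finGroupType) (S : connection_set gT).

Lemma bipartite_index2 (A : {group gT}) :
  #|[set: gT] : A| = 2 -> [disjoint S & A] -> bipartite (Cay S).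
Proof.
move=> iA2 /pred0P SA; exists A => x y; rewrite /= cayley_adjE => xyS.
have {SA} xyA : x^-1 * y \notin A by have := SA (x^-1 * y); rewrite /= xyS => /= ->.
have outer z : z \notin A -> ~: (A : {set gT}) = A :* z.
  move=> zA; apply/esym/eqP; rewrite eqEcard; apply/andP; split.
    apply/subsetP=> _ /rcosetP[a aA ->]; rewrite inE.
    by apply: contra zA; rewrite groupMl.
  rewrite card_rcoset -(leq_add2l #|A|) cardsC -[#|gT|]cardsT.
  by rewrite -(Lagrange (subsetT A)) iA2 muln2 addnn.
have [xA|xA] := boolP (x \in A); have [yA|yA] := boolP (y \in A) => //.
  by rewrite groupM ?groupV in xyA.
have yAx : y \in A :* x by rewrite -outer // inE.
have xyAx : y^-1 * x \in A :* x.
  by rewrite -outer // inE -groupV invMg invgK.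
case/negP: yA; rewrite -groupV; case/rcosetP: xyAx => a aA.
by move/mulIg->.
Qed.

Hypothesis girth6 : girth_at_least (Cay S) 6.

(** Otherwise s t = t s is an equality between distinct reduced words. *)
Lemma girth6_commute s t : s \in S -> t \in S -> commute s t -> t \in [set s; s^-1].
Proof.
move=> sS tS cst; rewrite !inE; apply: contraT; rewrite negb_or => /andP[nts ntsV].
case/negP: (nts); suffices [->] : [:: s; t] = [:: t; s] by [].
apply: (short_words_inj girth6); rewrite /reduced /= ?sS ?tS //= ?andbT //.
  by apply: contra ntsV => /eqP->; rewrite invgK.
by rewrite /wprod !big_cons big_nil !mulg1.
Qed.

(** Otherwise s t = t s^-1 is an equality between distinct reduced words. *)
Lemma girth6_invert s t : s \in S -> t \in S -> s ^ t = s^-1 -> t \in [set s; s^-1].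
Proof.
move=> sS tS ist; rewrite !inE; apply: contraT; rewrite negb_or => /andP[nts ntsV].
case/negP: (nts); suffices [->] : [:: s; t] = [:: t; s^-1] by [].
apply: (short_words_inj girth6); rewrite /reduced /= ?sS ?tS ?mem_setV ?sS //= ?andbT //.
  by rewrite (inj_eq invg_inj) eq_sym.
by rewrite /wprod !big_cons big_nil !mulg1 -ist conjgE !mulgA mulgV mul1g.
Qed.

(** Elements of S commute, so S contains at most one element and its inverse. *)
Lemma abelian_support_chromatic (A : {group gT}) :
  abelian A -> S \subset A -> chromatic_number (Cay S) <= 3.
Proof.
move=> abA /subsetP SA; apply: degree2_chromatic => x.
have -> : [set y | @adj (Cay S) x y] = x *: S.
  by apply/setP=> y; rewrite inE /= cayley_adjE mem_lcoset.
rewrite card_lcoset; have [->|[s sS]] := set_0Vmem S; first by rewrite cards0.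
apply: (@leq_trans #|[set s; s^-1]|); last by rewrite cards2; case: eqP.
apply/subset_leq_card/subsetP=> t tS; apply: girth6_commute => //.
by apply: (centsP abA); apply: SA.
Qed.

(** An element of S in A and one outside A would commute or invert. *)
Lemma inverting_index2_chromatic (A : {group gT}) :
  #|[set: gT] : A| = 2 -> abelian A ->
  (forall a x, a \in A -> x \notin A -> a ^ x \in [set a; a^-1]) ->
  chromatic_number (Cay S) <= 3.
Proof.
move=> iA2 abA actA.
have [SA|] := boolP (S \subset A); first exact: abelian_support_chromatic abA SA.
case/subsetPn=> x xS xA.
have [SA|] := boolP [disjoint S & A].
  exact: bipartite_chromatic (bipartite_index2 iA2 SA).
case/pred0Pn=> a /andP[/= aS aA]; case/negP: (xA).
suffices : x \in [set a; a^-1] by rewrite !inE => /orP[] /eqP->; rewrite ?groupV.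
case/set2P: (actA a x aA xA) => ax.
  by apply: girth6_commute => //; apply/commgP; apply/conjg_fixP.
exact: (girth6_invert aS xS ax).
Qed.

End AbelianSubgroups.

(** * Abelian and generalized dihedral groups *)
Section FourCycles.
Variables (gT : finGroupType) (S : connection_set gT).

Lemma commuting_square s t : s \in S -> t \in S -> commute s t ->
  t \notin [set s; s^-1] -> is_cycle (G := Cay S) [:: 1; s; s * t; t].
Proof.
move=> sS tS cst; rewrite !inE negb_or => /andP[nts ntsV].
have N1 x : x \in S -> x != 1 by apply: contraTneq => ->; apply: cset_not1.
have [s1 t1] := (N1 _ sS, N1 _ tS).
have st1 : s * t != 1 by rewrite -eq_invg_mul eq_sym.
apply/and3P; split=> //=.
  have sst : s != s * t by rewrite -{1}[s]mulg1 (inj_eq (mulgI s)) eq_sym.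
  have stt : s * t != t by rewrite -{2}[t]mul1g (inj_eq (mulIg t)).
  have st : s != t by rewrite eq_sym.
  by rewrite !inE !negb_or ![1 == _]eq_sym s1 st1 t1 sst st stt.
rewrite !cayley_adjE invg1 mul1g sS mulKg tS mulg1 mem_setV tS.
by rewrite cst invMg -mulgA mulVg mulg1 mem_setV sS.
Qed.

Lemma girth_at_most_cycle (G : sgraph) (c : seq G) k :
  is_cycle c -> size c <= k -> girth_at_most G k.
Proof.
move=> cc le_ck; rewrite /girth_at_most; have := girth_spec G.
case: girth => [g [_ /(_ c cc) le_gc] | /(_ c)]; first exact: leq_trans le_ck.
by rewrite cc.
Qed.

End FourCycles.

Lemma abelian_girth4 (gT : finGroupType) (S : connection_set gT) :
  abelian [set: gT] -> 3 <= #|S| -> girth_at_most (Cay S) 4.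
Proof.
move=> abT S3; have [s sS] : exists s, s \in (S : {set gT}).
  by apply/set0Pn; rewrite -card_gt0; apply: leq_trans S3.
have /subsetPn[t tS ts] : ~~ (S \subset [set s; s^-1]).
  apply: contraL S3 => /subset_leq_card le_S; rewrite -ltnNge ltnS.
  by apply: leq_trans le_S _; rewrite cards2; case: eqP.
have cst : commute s t by apply: (centsP abT); rewrite inE.
exact: girth_at_most_cycle (commuting_square sS tS cst ts) _.
Qed.

Section DihedralCayley.
Variables (A : finGroupType) (abelA : abelian [set: A]).
Let to := inversion_groupAction abelA.

Lemma rotation_conj (a x : Dih abelA) : a \in rotations abelA ->
  x \in reflections abelA -> a ^ x = a^-1.
Proof.
case/morphimP=> b _ _ ->{a}; rewrite inE => xR.
have : x \in [set: Dih abelA] by rewrite inE.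
rewrite -(im_sdpair to) => /mulsgP[_ _ /morphimP[d _ _ ->] /morphimP[z _ _ ->] xE].
have z1 : z != 1.
  apply: contraNneq xR => z1; rewrite xE z1 morph1 mulg1.
  by rewrite /rotations mem_morphim ?inE.
have bd : sdpair1 to b ^ sdpair1 to d = sdpair1 to b.
  rewrite -morphJ ?inE // conjgE (centsP abelA b _ d) ?inE //.
  by rewrite mulKg.
rewrite xE conjgM [_ ^ sdpair1 _ _]bd -sdpair_act ?inE //= /inversion (negbTE z1).
by rewrite morphV ?inE.
Qed.

Lemma rotations_index2 : #|[set: Dih abelA] : rotations abelA| = 2.
Proof.
have := sdprod_card (sdprod_sdpair to).
rewrite (card_injm (injm_sdpair2 to)) ?subxx // [in X in (_ * X)%N = _]cardsT card_ord => cR.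
apply/eqP; rewrite -(eqn_pmul2l (cardG_gt0 [group of rotations abelA])).
by rewrite Lagrange ?subsetT // cR.
Qed.

Lemma rotation_reflection_square (S : connection_set (Dih abelA)) a rho :
  a \in S -> a \in rotations abelA -> rho \in S -> rho \in reflections abelA ->
  is_cycle (G := Cay S) [:: 1; rho; rho * a; a^-1].
Proof.
move=> aS aA rS rA; have rotG : group_set (rotations abelA) by apply: groupP.
have rN : rho \notin [group of rotations abelA] by rewrite inE in rA.
have aG : a \in [group of rotations abelA] by [].
have a1 : a != 1 by apply: contraTneq aS => ->; apply: cset_not1.
have r1 : rho != 1 by apply: contraNneq rN => ->; apply: group1.
have ra1 : rho * a != 1 by apply: contraNneq rN => ra1; rewrite -(groupMr _ aG) ra1 group1.
apply/and3P; split=> //=.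
  have rra : rho != rho * a by rewrite -{1}[rho]mulg1 (inj_eq (mulgI rho)) eq_sym.
  have raV : rho != a^-1 by apply: contraNneq rN => ->; rewrite groupV.
  have raaV : rho * a != a^-1.
    by apply: contraNneq rN => raaV; rewrite -(groupMr _ aG) raaV groupV.
  by rewrite !inE !negb_or ![1 == _]eq_sym r1 ra1 invg_eq1 a1 rra raV raaV.
rewrite !cayley_adjE invg1 mul1g rS mulKg aS mulg1 invgK aS !andbT /=.
rewrite -mem_setV !invMg !invgK; have := rotation_conj aA rA.
by rewrite conjgE => /(canRL (mulKVg _)) arE; rewrite mulgA arE mulgKV rS.
Qed.

Lemma reflections_bipartite (S : connection_set (Dih abelA)) :
  S \subset reflections abelA -> bipartite (Cay S).
Proof.
move=> SR; apply: (bipartite_index2 (A := [group of rotations abelA])).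
  exact: rotations_index2.
by rewrite disjoints_subset.
Qed.

Lemma dihedral_chromatic (S : connection_set (Dih abelA)) :
  girth_at_least (Cay S) 6 -> chromatic_number (Cay S) <= 3.
Proof.
move=> girth6; apply: (inverting_index2_chromatic girth6 (A := [group of rotations abelA])).
- exact: rotations_index2.
- exact: morphim_abelian.
by move=> a x aA xA; rewrite rotation_conj ?inE ?eqxx ?orbT.
Qed.

End DihedralCayley.

(** * Orders with few prime factors *)
Section CyclicIndex2.
Variables (gT : finGroupType) (S : connection_set gT).
Hypothesis girth6 : girth_at_least (Cay S) 6.

(** The powers of an element of order 3, 4 or 5 would form a short cycle. *)
Lemma girth6_order s : s \in S -> #[s] = 2 \/ 5 < #[s].
Proof.
move=> sS; have [s2|s2] := eqVneq #[s] 2; [by left | right].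
rewrite ltnNge; apply/negP=> le5.
have s_gt1 : 1 < #[s].
  by rewrite order_gt1; apply: contraTneq sS => ->; apply: cset_not1.
have s_nV : s != s^-1.
  apply: contraNneq s2 => sV; rewrite eqn_leq s_gt1 dvdn_leq // order_dvdn.
  by rewrite expgS expg1 {1}sV mulVg.
have red : reduced S (nseq #[s] s).
  rewrite /reduced; apply/andP; split; first by apply/allP=> x /nseqP[->].
  by case: #[s] => // k; elim: k => //= k ->; rewrite s_nV.
have := short_word_neq1 girth6 red; rewrite size_nseq order_gt0 ltnS le5.
have -> : wprod (nseq #[s] s) = s ^+ #[s].
  by elim: #[s] => [|k IHk]; rewrite /wprod ?big_nil // big_cons expgS -IHk.
by rewrite expg_order eqxx => /(_ isT).
Qed.

(** The square of an element outside A lies in A, so it acts on A by a power whose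
    square is 1 modulo m; when 1 and -1 are the only square roots of 1, it
    centralises or inverts A. *)
Lemma cyclic_index2_chromatic m (A : {group gT}) :
  all (fun k => (k * k == 1 %[mod m]) ==> ((k == 1) || (k == m.-1)))%N (iota 0 m) ->
  #|A| = m -> cyclic A -> #|[set: gT] : A| = 2 -> chromatic_number (Cay S) <= 3.
Proof.
move=> /allP sqrt1 oA cycA iA2.
apply: (inverting_index2_chromatic girth6 iA2 (cyclic_abelian cycA)) => a x aA xA.
have x2A : x * x \in A.
  apply: contraT => x2A; have: x * x \in A :* x.
    by rewrite (rcoset_index2 (subsetT A) iA2) !inE ?xA ?x2A.
  by case/rcosetP=> b bA /mulIg xb; rewrite xb bA in xA.
case/cyclicP: cycA => c defA; have oc : #[c] = m by rewrite -oA defA.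
have cA : c \in A by rewrite defA cycle_id.
have /cyclePmin[k lt_km ck] : c ^ x \in <[c]>.
  by rewrite -defA memJ_norm // (subsetP (normal_norm (index2_normal (subsetT A) iA2))) ?inE.
have ckk : c ^+ (k * k)%N == c ^+ 1.
  rewrite expgM -ck -conjXg -ck -conjgM expg1; apply/eqP/conjg_fixP/commgP.
  by apply: (centsP (cyclic_abelian (_ : cyclic A))); rewrite // defA cycle_cyclic.
move: aA; rewrite defA => /cycleP[i ->].
have: (k == 1%N) || (k == m.-1).
  have := sqrt1 k; rewrite mem_iota add0n -oc lt_km => /(_ isT)/implyP; apply.
  by rewrite -eq_expg_mod_order.
rewrite conjXg ck => /orP[/eqP->|/eqP->]; first by rewrite expg1 !inE eqxx.
have -> : c ^+ m.-1 = c^-1.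
  by apply/eqP; rewrite eq_sym eq_invg_mul -expgS prednK -oc ?order_gt0 // expg_order.
by rewrite expgVn !inE eqxx orbT.
Qed.

End CyclicIndex2.

(** Stated as membership in a list that computes once the order is known. *)
Lemma Syl_dvd_mod (gT : finGroupType) (G : {group gT}) p : prime p ->
  #|'Syl_p(G)| \in [seq d <- divisors #|G| | d %% p == 1%N].
Proof.
by move=> p_pr; rewrite mem_filter card_Syl_mod // eqxx -dvdn_divisors ?cardG_gt0 ?card_Syl_dvd.
Qed.

Lemma unique_Sylow_normal (gT : finGroupType) (G : {group gT}) p : prime p ->
  [seq d <- divisors #|G| | d %% p == 1%N] = [:: 1%N] ->
  exists2 P : {group gT}, p.-Sylow(G) P & P <| G.
Proof.
move=> p_pr Syl1; apply/normal_sylowP.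
by have := Syl_dvd_mod G p_pr; rewrite Syl1 inE.
Qed.

Section PrimeOrders.
Variables (gT : finGroupType) (S : connection_set gT).
Hypothesis girth6 : girth_at_least (Cay S) 6.

Lemma prime_order_chromatic : prime #|gT| -> chromatic_number (Cay S) <= 3.
Proof.
move=> pT; apply: (abelian_support_chromatic girth6 (A := [set: gT])); last exact: subsetT.
by apply/cyclic_abelian/prime_cyclic; rewrite cardsT.
Qed.

(** An element of order p q makes the group cyclic; elements of order q are
    excluded from S by the girth; all others lie in the normal Sylow
    p-subgroup. *)
Lemma pq_order_chromatic p q : prime p -> prime q -> 2 < q <= 5 -> p != q ->
  #|gT| = (p * q)%N -> [seq d <- divisors #|gT| | d %% p == 1%N] = [:: 1%N] ->
  chromatic_number (Cay S) <= 3.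
Proof.
move=> p_pr q_pr /andP[q_gt2 q_le5] npq oT; rewrite -cardsT => /unique_Sylow_normal[] // P sylP nP.
have oP : #|P| = p.
  rewrite (card_Hall sylP) cardsT oT p_part lognM ?prime_gt0 // (logn_prime p p_pr) eqxx.
  by rewrite logn_prime // (negbTE npq) addn0 expn1.
have [/existsP[s /andP[sS /eqP os]] | noS] := boolP [exists s in S, #[s] == #|gT|].
  apply: (abelian_support_chromatic girth6 (A := [set: gT])); last exact: subsetT.
  apply: abelianS (cycle_abelian s); rewrite /= -(_ : <[s]> = [set: gT]) //.
  by apply/eqP; rewrite eqEcard subsetT cardsT -os leqnn.
apply: (abelian_support_chromatic girth6 (A := P)).
  by apply/cyclic_abelian/prime_cyclic; rewrite oP.
apply/subsetP=> s sS; rewrite (mem_normal_Hall sylP nP) ?inE // /p_elt.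
have s_pq : #[s] %| p * q by rewrite -oT -cardsT order_dvdG ?inE.
have [q_s|q_s] := boolP (q %| #[s]); last first.
  rewrite Gauss_dvdl in s_pq; last by rewrite coprime_sym prime_coprime.
  by apply: pnat_dvd s_pq _; apply: pnat_id.
case/dvdnP: q_s (s_pq) => d os; rewrite os dvdn_pmul2r ?prime_gt0 //.
case/primeP: p_pr => _ d_p /d_p /orP[/eqP d1|/eqP dp].
  have := girth6_order girth6 sS; rewrite os d1 mul1n => -[q2|].
    by rewrite q2 in q_gt2.
  by rewrite ltnNge q_le5.
case/negP: noS; apply/existsP; exists s.
by rewrite sS os dp oT eqxx.
Qed.

End PrimeOrders.

(** * Vertex-transitive graphs of prime order *)
Lemma chromatic_proper3 (G : sgraph) :
  chromatic_number G <= 3 -> exists f : G -> 'I_3, proper3 f.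
Proof.
rewrite /chromatic_number; case: ex_minnP => m /existsP[f /forallP fP] _ le_m3.
exists (fun x => widen_ord le_m3 (f x)) => x y xy.
have /forallP/(_ y)/implyP/(_ xy) := fP x.
by apply: contra_neq => /(congr1 val) eq_f; apply: val_inj.
Qed.

Section VertexTransitive.
Variable G : sgraph.

Definition automorphisms := [set f : {perm G} | [forall x, forall y, adj (f x) (f y) == adj x y]].

Lemma automorphismsP f : reflect (is_automorphism f) (f \in automorphisms).
Proof.
rewrite inE; apply: (iffP forallP) => [fP x y | fP x].
  by have /forallP/(_ y)/eqP := fP x.
by apply/forallP=> y; apply/eqP.
Qed.

Lemma automorphisms_group_set : group_set automorphisms.
Proof.
apply/group_setP; split; first by apply/automorphismsP=> x y; rewrite !perm1.
move=> f g /automorphismsP fP /automorphismsP gP; apply/automorphismsP=> x y.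
by rewrite !permM gP fP.
Qed.
Canonical automorphisms_group := Group automorphisms_group_set.

(** By transitivity the prime number of vertices divides the number of
    automorphisms.  An automorphism of that order permutes the vertices in one
    cycle, so its powers act regularly and the graph is a Cayley graph of the
    cyclic group that they form. *)
Lemma vertex_transitive_prime_chromatic : prime #|G| -> vertex_transitive G ->
  girth_at_least G 6 -> chromatic_number G <= 3.
Proof.
move=> p_pr vtG girth6; have [x0 _] : exists x : G, x \in [set: G].
  by apply/set0Pn; rewrite -card_gt0 cardsT prime_gt0.
have orbT : orbit 'P automorphisms_group x0 = [set: G].
  apply/setP=> y; rewrite inE; have [f fA <-] := vtG x0 y.
  by apply/orbitP; exists f => //; apply/automorphismsP.
have: #|G| %| #|automorphisms_group| by rewrite -cardsT -orbT dvdn_orbit.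
case/(Cauchy p_pr)=> s sA os.
have [x sx] : exists x, s x != x.
  apply/existsP; apply: contraT; rewrite negb_exists => /forallP s1.
  have s_1 : s = 1 by apply/permP=> x; rewrite perm1; apply/eqP; rewrite -[_ == _]negbK s1.
  by move: p_pr; rewrite -os s_1 order1.
have porbT : porbit s x = [set: G].
  apply/eqP; rewrite eqEcard subsetT cardsT /=.
  have: #|porbit s x| %| #|G| by rewrite -os porbitE /order dvdn_orbit.
  case/primeP: p_pr => _ d_p /d_p /orP[/eqP orb1 | /eqP-> //].
  have /cards1P[z zE] : #|porbit s x| == 1%N by rewrite orb1.
  have xz : x = z by apply/set1P; rewrite -zE porbit_id.
  have sxz : s x = z by apply/set1P; rewrite -zE (mem_porbit s 1 x).
  by rewrite sxz xz eqxx in sx.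
(* The regular group identifies t with the image of x under t. *)
pose gT := subg_of <[s]>; pose h (t : gT) : G := val t x.
have tA (t : gT) : is_automorphism (val t).
  by apply/automorphismsP; apply: subsetP (subgP t); rewrite cycle_subG.
have hK y : exists t, h t = y.
  have : y \in porbit s x by rewrite porbT inE.
  case/porbitP=> i ->; have si : s ^+ i \in <[s]> by apply: mem_cycle.
  by exists (subg _ (s ^+ i)); rewrite /h /= subgK.
have comm (t u : gT) y : val t (val u y) = val u (val t y).
  have ctu : commute (val u) (val t).
    by apply: (centsP (cycle_abelian s)); apply: subgP.
  by rewrite -!permM ctu.
have h_inj : injective h.
  move=> t u tu; apply: val_inj; apply/permP=> y.
  by have [v <-] := hK y; rewrite /h comm [val t x]tu comm.
pose C : {set gT} := [set t | adj x (h t)].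
have C1 : 1 \notin C by rewrite inE /h /= perm1 adj_irr.
have CV : C^-1 = C.
  by apply/setP=> t; rewrite !inE /h /= -(tA t x) permKV adj_sym.
pose S := ConnectionSet C1 CV.
have adjE (t u : Cay S) : adj t u = adj (h t) (h u).
  by rewrite /= cayley_adjE inE /h /= permM -(tA t) comm permKV.
have S6 : girth_at_least (Cay S) 6.
  apply/girth_at_leastP=> c /and3P[c_gt2 c_uniq c_cyc].
  rewrite -(size_map h); apply: (girth_at_leastP G 6 girth6); apply/and3P; split.
  - by rewrite size_map.
  - by rewrite map_inj_uniq.
  rewrite cycle_map; apply: sub_cycle c_cyc => t u.
  by rewrite adjE.
have cardE : #|gT| = #|G|.
  by rewrite -(card_codom h_inj); apply: eq_card => y; have [t <-] := hK y; rewrite codom_f.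
have [|f fP] := @chromatic_proper3 (Cay S).
  by apply: prime_order_chromatic S6 _; rewrite cardE.
have [g _ ghK] := inj_card_bij h_inj (eq_leq (esym cardE)).
apply: (@proper3_chromatic _ (f \o g)) => y z yz; apply: fP.
by rewrite adjE !ghK.
Qed.

End VertexTransitive.

(** * Polycyclic presentations *)

(** The power u^k modulo m, reduced at every step as the numbers are unary. *)
Definition powmod m u k := iter k (fun t => (t * u) %% m) 1%N.

Section PowerAction.
Variable gT : finGroupType.
Implicit Types c x : gT.

Lemma shift_power x c i u : x * c = c ^+ u * x -> x * c ^+ i = c ^+ (u * i) * x.
Proof.
move=> xc; elim: i => [|i IHi]; first by rewrite muln0 mulg1 mul1g.
by rewrite expgS mulgA xc -mulgA IHi mulgA -expgD mulnS.
Qed.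

Lemma action_power c x u k : x * c = c ^+ u * x -> x ^+ k * c = c ^+ (u ^ k) * x ^+ k.
Proof.
move=> xc; elim: k => [|k IHk]; first by rewrite mul1g mulg1.
by rewrite expgS -mulgA IHk mulgA (shift_power _ xc) -mulgA expnS.
Qed.

Lemma action_powmod m c x u k : c ^+ m = 1 -> x * c = c ^+ u * x ->
  x ^+ k * c = c ^+ powmod m u k * x ^+ k.
Proof.
move=> cm /(action_power k) ->; congr (_ * _).
by elim: k => //= k IHk; rewrite expnSr expgM IHk -expgM expg_mod.
Qed.

Lemma normal_cycle_action c x : <[c]> <| [set: gT] -> exists2 u, u < #[c] & x * c = c ^+ u * x.
Proof.
case/andP=> _ /subsetP/(_ x^-1 (in_setT _)) nc.
have : c ^ x^-1 \in <[c]> by rewrite memJ_norm // cycle_id.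
case/cyclePmin=> u lt_u cx; exists u => //.
by rewrite -cx conjgE invgK -!mulgA mulVg mulg1.
Qed.

End PowerAction.

(** The data of [ext_mul] for a group generated by c, y and z with c^m = 1,
    y^p = c^a, z^q = c^b, y c = c^u y, z c = c^v z and z y = c^d y^w z.  The code
    j + p k, j < p, stands for the representative y^j z^k.  As q <= 2, the
    exponent k of z in a product z^k y^j is 0 or 1, so that no iterated powers
    of w occur. *)
Definition pc_act m p u v x := (powmod m u (x %% p) * powmod m v (x %/ p))%N.

Definition pc_op p q w a b d x x' :=
  let j := x %% p in let k := x %/ p in
  let k' := x' %/ p in let l := if k == 0 then x' %% p else (w * (x' %% p))%N in
  (d * (k * (x' %% p)) + (a * ((j + l) %/ p) + b * ((k + k') %/ q)),
   (j + l) %% p + p * ((k + k') %% q))%N.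

Definition pc_colorings_suffice m p q u v w a b d F :=
  ext_colorings_suffice m (p * q) (pc_act m p u v) (pc_op p q w a b d) F.

Section Polycyclic.
Variables (gT : finGroupType) (m p q u v w a b d : nat) (c y z : gT).
Hypotheses (card_gT : #|gT| = (m * (p * q))%N) (p_gt0 : 0 < p) (q_gt0 : 0 < q) (q_le2 : q <= 2).
Hypotheses (cm : c ^+ m = 1) (yp : y ^+ p = c ^+ a) (zq : z ^+ q = c ^+ b).
Hypotheses (yc : y * c = c ^+ u * y) (zc : z * c = c ^+ v * z) (zy : z * y = c ^+ d * y ^+ w * z).
Hypotheses (cdy : commute (c ^+ d) y) (cby : commute (c ^+ b) y).
Hypothesis gen : [set: gT] = <[c]> * <[y]> * <[z]>.

Let rho x := y ^+ (x %% p) * z ^+ (x %/ p).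

Let fold_y j : y ^+ j = c ^+ (a * (j %/ p)) * y ^+ (j %% p).
Proof. by rewrite {1}(divn_eq j p) expgD mulnC expgM yp -expgM. Qed.

Let fold_z k : z ^+ k = c ^+ (b * (k %/ q)) * z ^+ (k %% q).
Proof. by rewrite {1}(divn_eq k q) expgD mulnC expgM zq -expgM. Qed.

Let fold_yz j k : y ^+ j * z ^+ k =
  c ^+ (a * (j %/ p) + b * (k %/ q)) * (y ^+ (j %% p) * z ^+ (k %% q)).
Proof.
rewrite {1}fold_y {1}fold_z expgD !mulgA; congr (_ * _); rewrite -!mulgA; congr (_ * _).
rewrite expgM; apply: commuteX2.
exact/commute_sym.
Qed.

Let rho_code j k : j < p -> k < q -> rho (j + p * k) = y ^+ j * z ^+ k.
Proof.
by move=> lt_j lt_k; rewrite /rho mulnC addnC modnMDl divnMDl // modn_small // divn_small // addn0.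
Qed.

(** Collecting a product of representatives leaves powers of c^d, from z y, and of
    c^b, from z^q, to the right of a power of y; the commutation hypotheses bring
    them back to the left. *)
Lemma polycyclic_chromatic F (S : connection_set gT) :
  pc_colorings_suffice m p q u v w a b d F -> girth_at_least (Cay S) 6 ->
  chromatic_number (Cay S) <= 3.
Proof.
have div_lt x : x < p * q -> x %/ p < q by rewrite ltn_divLR // mulnC.
have code_lt j k : j %% p + p * (k %% q) < p * q.
  apply: (@leq_trans (p * (k %% q).+1)%N); last by rewrite leq_mul2l ltn_pmod ?orbT.
  by rewrite mulnS ltn_add2r ltn_pmod.
apply: (cyclic_extension_chromatic (c := c) (rho := rho)) => //.
- by rewrite /rho mod0n div0n mulg1.
- by move=> x x' _ _; apply: code_lt.
- move=> x _; rewrite /rho -mulgA (action_powmod _ cm zc) mulgA.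
  rewrite (shift_power _ (action_powmod _ cm yc)) -!mulgA.
  by rewrite /pc_act.
- move=> x x' /div_lt lt_x /div_lt lt_x'; rewrite /pc_op /=.
  set j := x %% p; set j' := x' %% p; set k := x %/ p; set k' := x' %/ p.
  set l := if k == 0 then j' else _.
  rewrite rho_code ?ltn_pmod // expgD -[RHS]mulgA -fold_yz.
  have zky : z ^+ k * y ^+ j' = c ^+ (d * (k * j')) * y ^+ l * z ^+ k.
    rewrite /l; have [-> | k1] : k = 0 \/ k = 1%N.
    - by have := leq_trans lt_x q_le2; rewrite -/k; case: (k) => [|[|i]]; auto.
    - by rewrite muln0 !mul1g mulg1.
    have cdw : commute (c ^+ d) (y ^+ w) by apply: commuteX.
    rewrite k1 /= mul1n expg1 !expgM -expgMn //.
    elim: (j') => [|i IHi]; first by rewrite mulg1 mul1g.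
    by rewrite !(expgSr _ i) mulgA IHi -mulgA zy !mulgA.
  rewrite /rho -/j -/j' -/k -/k' !mulgA -(mulgA _ _ (y ^+ j')) zky !mulgA.
  rewrite (expgM c d) (commuteX2 j _ (commute_sym cdy)) -!mulgA; congr (_ * _).
  by rewrite !expgD !mulgA.
move=> g; have : g \in [set: gT] by rewrite inE.
rewrite gen => /mulsgP[_ _ /mulsgP[_ _ /cycleP[i ->] /cycleP[j ->] ->] /cycleP[k ->] ->].
exists (j %% p + p * (k %% q))%N => //; rewrite rho_code ?ltn_pmod //.
exists (i + (a * (j %/ p) + b * (k %/ q)))%N.
by rewrite [in RHS]expgD -!mulgA; congr (_ * _); apply: fold_yz.
Qed.

End Polycyclic.

(** * Elementary abelian normal subgroups with a cyclic complement *)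

(** Vectors over the field with two elements are coded by their bits; [vec_act]
    is the linear map that sends the three basis vectors to e0, e1 and e2. *)
Definition vec (b0 b1 b2 : nat) := (b0 %% 2 + 2 * (b1 %% 2) + 4 * (b2 %% 2))%N.

Definition vec_add v v' :=
  vec (v %% 2 + v' %% 2) (v %/ 2 %% 2 + v' %/ 2 %% 2) (v %/ 4 %% 2 + v' %/ 4 %% 2).

Definition vec_act (e0 e1 e2 : nat) v :=
  vec_add (v %% 2 * e0) (vec_add (v %/ 2 %% 2 * e1) (v %/ 4 %% 2 * e2)).

(** The code v + N i stands for the vector v times the i-th power of c, where N
    is 4 or 8 and c acts on vectors by [vec_act]. *)
Definition affine_mul N r (e0 e1 e2 : nat) a a' :=
  (vec_add (a %% N) (iter (a %/ N) (vec_act e0 e1 e2) (a' %% N)) +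
   N * ((a %/ N + a' %/ N) %% r))%N.

Section ElementaryByCyclic.
Variables (gT : finGroupType) (N r e0 e1 e2 : nat) (w0 w1 w2 c : gT).
Hypotheses (card_gT : #|gT| = (N * r)%N) (N48 : N \in [:: 4; 8]).
Hypotheses (w02 : w0 ^+ 2 = 1) (w12 : w1 ^+ 2 = 1) (w22 : w2 ^+ 2 = 1) (cr : c ^+ r = 1).
Hypotheses (c01 : commute w0 w1) (c02 : commute w0 w2) (c12 : commute w1 w2).

Definition vec_elt v := w0 ^+ (v %% 2) * w1 ^+ (v %/ 2 %% 2) * w2 ^+ (v %/ 4 %% 2).

Hypothesis (lt_e0 : e0 < N) (lt_e1 : e1 < N) (lt_e2 : e2 < N).
Hypotheses (cw0 : c * w0 = vec_elt e0 * c) (cw1 : c * w1 = vec_elt e1 * c).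
Hypothesis (cw2 : c * w2 = vec_elt e2 * c).
Hypothesis gen : forall g, exists2 v, v < N & exists i, g = vec_elt v * c ^+ i.

Lemma vec_bits b0 b1 b2 :
  [/\ (vec b0 b1 b2 %% 2 = b0 %% 2)%N, (vec b0 b1 b2 %/ 2 %% 2 = b1 %% 2)%N
    & (vec b0 b1 b2 %/ 4 %% 2 = b2 %% 2)%N].
Proof.
rewrite /vec; have lt2 b : b %% 2 < 2 by rewrite ltn_pmod.
by case: (b0 %% 2) (lt2 b0) => [|[|//]] _; case: (b1 %% 2) (lt2 b1) => [|[|//]] _;
   case: (b2 %% 2) (lt2 b2) => [|[|//]] _; split.
Qed.

Lemma vec_elt_vec b0 b1 b2 : vec_elt (vec b0 b1 b2) = w0 ^+ b0 * w1 ^+ b1 * w2 ^+ b2.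
Proof. by rewrite /vec_elt; case: (vec_bits b0 b1 b2) => -> -> ->; rewrite !expg_mod. Qed.

Let vec_eltM v v' : vec_elt (vec_add v v') = vec_elt v * vec_elt v'.
Proof.
have shuffle (A A' B B' C C' : gT) : commute A' B -> commute A' C -> commute B' C ->
    A * A' * (B * B') * (C * C') = A * B * C * (A' * B' * C').
  move=> cab cac cbc; rewrite -!mulgA (mulgA C A') -cac -(mulgA A') (mulgA C B') -cbc -(mulgA B').
  by rewrite (mulgA B A') -cab -(mulgA A').
by rewrite vec_elt_vec !expgD shuffle //; apply: commuteX2.
Qed.

Let vec_elt_small : vec_elt 0 = 1. Proof. by rewrite /vec_elt !mulg1. Qed.

Let vec_elt_mul b e : b < 2 -> vec_elt (b * e) = vec_elt e ^+ b.
Proof. by case: b => [|[|//]] _; rewrite ?mul0n ?mul1n ?vec_elt_small. Qed.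

Let vec_add_lt v v' : v < N -> v' < N -> vec_add v v' < N.
Proof.
have : all (fun N => all (fun v => all (fun v' => vec_add v v' < N) (iota 0 N)) (iota 0 N)) [:: 4; 8].
  by vm_compute.
move/allP/(_ _ N48)/allP=> addP lt_v lt_v'.
have /addP/allP-> // : v \in iota 0 N by rewrite mem_iota.
by rewrite mem_iota.
Qed.

Let mul_bit_lt b e : b < 2 -> e < N -> (b * e < N)%N.
Proof. by case: b => [|[|//]] _ lt_eN; rewrite ?mul1n // mul0n (leq_ltn_trans _ lt_eN). Qed.

Let c_vec v : v < N -> c * vec_elt v = vec_elt (vec_act e0 e1 e2 v) * c.
Proof.
move=> lt_v; have lt2 b : b %% 2 < 2 by rewrite ltn_pmod.
rewrite /vec_act !vec_eltM !vec_elt_mul // {1}/vec_elt.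
have shift (w e : gT) b : c * w = e * c -> c * w ^+ b = e ^+ b * c.
  move=> cw; elim: b => [|b IHb]; first by rewrite mulg1 mul1g.
  by rewrite !expgS mulgA cw -mulgA IHb mulgA.
rewrite !mulgA (shift _ _ _ cw0) -(mulgA (_ ^+ _)) (shift _ _ _ cw1) mulgA.
by rewrite -(mulgA (_ * _)) (shift _ _ _ cw2) !mulgA.
Qed.

Let vec_act_lt v : v < N -> vec_act e0 e1 e2 v < N.
Proof.
have lt2 b : b %% 2 < 2 by rewrite ltn_pmod.
by move=> lt_v; rewrite !vec_add_lt ?mul_bit_lt.
Qed.

Let phi a := vec_elt (a %% N) * c ^+ (a %/ N).

Lemma affine_chromatic F T (S : connection_set gT) :
  colorings_suffice (N * r) (affine_mul N r e0 e1 e2) F T ->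
  (forall t, t \in T -> t < N * r /\ vec_elt (t %% N) * c ^+ (t %/ N) \in (S : {set gT})) ->
  girth_at_least (Cay S) 6 -> chromatic_number (Cay S) <= 3.
Proof.
move=> suffF TS girth6; have gT_gt0 : 0 < N * r by rewrite -card_gT (cardD1 1).
have /andP[N_gt0 r_gt0] : (0 < N) && (0 < r) by rewrite -muln_gt0.
have phiE v i : v < N -> phi (v + N * (i %% r)) = vec_elt v * c ^+ i.
  move=> lt_v; rewrite /phi mulnC addnC modnMDl divnMDl // modn_small // divn_small // addn0.
  by rewrite expg_mod.
have code_lt v i : v < N -> v + N * (i %% r) < N * r.
  move=> lt_v; apply: (@leq_trans (N * (i %% r).+1)%N).
    by rewrite mulnS ltn_add2r.
  by rewrite leq_mul2l ltn_pmod ?orbT.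
have iter_lt i v : v < N -> iter i (vec_act e0 e1 e2) v < N.
  by elim: i => //= i IHi /IHi; apply: vec_act_lt.
have ci_vec i v : v < N -> c ^+ i * vec_elt v = vec_elt (iter i (vec_act e0 e1 e2) v) * c ^+ i.
  move=> lt_v; elim: i => [|i IHi]; first by rewrite mul1g mulg1.
  by rewrite expgS -mulgA IHi mulgA c_vec ?iter_lt // -mulgA.
have mod_lt a : a %% N < N by rewrite ltn_pmod.
apply: (model_chromatic (phi := phi) card_gT _ _ _ _ girth6 suffF) => //.
- by rewrite /phi mod0n div0n vec_elt_small mulg1.
- move=> g; have [v lt_v [i ->]] := gen g.
  by exists (v + N * (i %% r))%N; rewrite ?code_lt ?phiE.
- by move=> a a' _ _; rewrite /affine_mul code_lt ?vec_add_lt ?iter_lt.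
move=> a a' _ _; rewrite /affine_mul phiE ?vec_add_lt ?iter_lt // vec_eltM /phi.
move: (ci_vec (a %/ N) _ (mod_lt a')); move: (vec_elt _) => w'; move: (vec_elt _) => w.
by move: (vec_elt _) => w'' ww'; rewrite expgD !mulgA -(mulgA w'' _ w') ww' !mulgA.
Qed.

End ElementaryByCyclic.

(** * Normal subgroups of small index *)

(** Conjugation embeds the quotient by the centraliser into Aut A. *)
Lemma index_cent_dvd_Aut (gT : finGroupType) (A G : {group gT}) :
  A <| G -> #|G : 'C_G(A)| %| #|Aut A|.
Proof.
case/andP=> _ nAG; have := cardSg (subset_trans (morphimS _ (subxx G)) (Aut_conj_aut A G)).
by rewrite card_morphim ker_conj_aut /= (setIidPr nAG) indexgI.
Qed.

Section NormalIndex.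
Variables (gT : finGroupType) (G H : {group gT}).
Hypothesis nHG : H <| G.

Lemma expg_index_normal y : y \in G -> y ^+ #|G : H| \in H.
Proof.
move=> Gy; have Ny : y \in 'N(H) := subsetP (normal_norm nHG) y Gy.
apply: coset_idr; rewrite ?groupX // morphX //.
have Qy : coset H y \in G / H by rewrite mem_quotient.
by rewrite -card_quotient ?normal_norm // expg_cardG.
Qed.

Lemma prime_index_gen y : prime #|G : H| -> y \in G -> y \notin H -> H * <[y]> = G.
Proof.
move=> p_pr Gy Hy; have Ny : <[y]> \subset 'N(H).
  by rewrite cycle_subG (subsetP (normal_norm nHG)).
rewrite -norm_joinEr //; have sJG : H <*> <[y]> \subset G.
  by rewrite join_subG normal_sub //= cycle_subG.
have := Lagrange_index sJG (joing_subl H <[y]>).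
case/primeP: p_pr => p_gt1 d_p iGJ; have /d_p : #|H <*> <[y]> : H| %| #|G : H|.
  by rewrite -iGJ dvdn_mull.
case/orP=> [/eqP/eqP | /eqP iJH].
  rewrite indexg_eq1 join_subG subxx /= cycle_subG => yH.
  by rewrite yH in Hy.
move: iGJ; rewrite iJH => /eqP; rewrite -[X in _ == X]mul1n eqn_pmul2r ?(ltnW p_gt1) //.
by rewrite indexg_eq1 => sGJ; apply/eqP; rewrite eqEsubset sJG.
Qed.

End NormalIndex.

(** The coset of y has order dividing 4, and neither 1 nor 2. *)
Lemma index4_gen (gT : finGroupType) (G H : {group gT}) y : H <| G ->
  #|G : H| = 4 -> y \in G -> y ^+ 2 \notin H -> H * <[y]> = G.
Proof.
move=> nHG iHG Gy y2; have Ny : <[y]> \subset 'N(H).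
  by rewrite cycle_subG (subsetP (normal_norm nHG)).
rewrite -norm_joinEr //; have sJG : H <*> <[y]> \subset G.
  by rewrite join_subG normal_sub //= cycle_subG.
have nHJ : H <| H <*> <[y]> := normalS (joing_subl _ _) sJG nHG.
have Jy : y \in H <*> <[y]> by rewrite (subsetP (joing_subr _ _)) ?cycle_id.
have yJ := expg_index_normal nHJ Jy.
have := Lagrange_index sJG (normal_sub nHJ); rewrite iHG => iJ.
have : #|H <*> <[y]> : H| %| (2 ^ 2)%N by rewrite -[(2 ^ 2)%N]iJ dvdn_mull.
case/(dvdn_pfactor _ 2 (isT : prime 2)) => [[|[|[|//]]] _ e]; rewrite e in yJ iJ.
- by case/negP: y2; rewrite groupX // -(expg1 y).
- by rewrite yJ in y2.
apply/eqP; rewrite eqEsubset sJG -indexg_eq1.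
by move/eqP: iJ; rewrite (@eqn_pmul2r 4 _ 1).
Qed.

(** * Certificates for orders 54, 56, 60 and 63 *)

(** A pair (q, f) is a colouring f of the quotient by <[c^q]>; see
    [lift_coloring].  The parameters of the searches run over the presentations
    that survive the analysis of the corresponding orders. *)
Section Searches.
Local Open Scope nat_scope.

Definition colorings63 : seq (nat * seq nat) :=
  [:: (3, [:: 0; 1; 2; 0; 1; 2; 0; 1; 2]);
     (7, [:: 0; 0; 0; 1; 1; 1; 2; 0; 1; 1; 0; 0; 1; 2; 0; 1; 0; 1; 0; 1; 2]);
     (7, [:: 0; 1; 0; 1; 0; 1; 2; 0; 0; 0; 1; 1; 1; 2; 0; 1; 1; 0; 0; 1; 2]);
     (7, [:: 0; 1; 1; 0; 0; 1; 2; 0; 1; 0; 1; 0; 1; 2; 0; 0; 0; 1; 1; 1; 2]);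
     (3, [:: 0; 0; 0; 1; 1; 1; 2; 2; 2]);
     (3, [:: 0; 1; 2; 1; 2; 0; 0; 1; 2]);
     (3, [:: 0; 1; 2; 0; 1; 2; 2; 0; 1]);
     (3, [:: 0; 1; 2; 0; 1; 2; 1; 2; 0])].

Definition colorings60_cyclic : seq (nat * seq nat) :=
  [:: (3, [:: 0; 1; 2; 0; 1; 2; 0; 1; 2; 0; 1; 2]);
     (3, [:: 0; 1; 2; 1; 2; 0; 0; 1; 2; 1; 2; 0]);
     (3, [:: 0; 1; 2; 0; 1; 2; 1; 2; 0; 2; 0; 1]);
     (3, [:: 0; 0; 0; 0; 0; 0; 1; 1; 1; 1; 1; 1]);
     (3, [:: 0; 1; 2; 0; 1; 2; 2; 0; 1; 1; 2; 0]);
     (3, [:: 0; 1; 2; 2; 0; 1; 0; 1; 2; 2; 0; 1])].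

Definition colorings60_klein : seq (nat * seq nat) :=
  [:: (3, [:: 0; 1; 2; 1; 2; 0; 1; 2; 0; 0; 1; 2]);
     (3, [:: 0; 0; 0; 1; 1; 1; 1; 1; 1; 0; 0; 0]);
     (3, [:: 0; 0; 0; 0; 0; 0; 1; 1; 1; 1; 1; 1]);
     (3, [:: 0; 1; 2; 0; 1; 2; 1; 2; 0; 1; 2; 0]);
     (3, [:: 0; 1; 2; 0; 1; 2; 2; 0; 1; 2; 0; 1]);
     (3, [:: 0; 1; 2; 0; 1; 2; 0; 1; 2; 0; 1; 2])].

Definition colorings56_cyclic : seq (nat * seq nat) :=
  [:: (2, [:: 0; 0; 0; 0; 1; 1; 1; 1]);
     (2, [:: 0; 1; 0; 1; 0; 1; 0; 1]);
     (7, [:: 0; 0; 1; 2; 0; 1; 2; 0; 1; 2; 0; 1; 1; 2; 1; 2; 0; 1; 1; 2; 0; 2; 0; 0; 1; 2; 0; 1]);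
     (7, [:: 0; 0; 0; 1; 1; 1; 2; 0; 0; 0; 1; 1; 1; 2; 0; 0; 0; 1; 1; 1; 2; 0; 0; 0; 1; 1; 1; 2]);
     (7, [:: 0; 1; 0; 1; 2; 0; 2; 1; 0; 1; 2; 1; 2; 0; 0; 1; 0; 1; 2; 0; 2; 1; 0; 1; 2; 1; 2; 0]);
     (2, [:: 0; 0; 1; 1; 0; 0; 1; 1]);
     (7, [:: 0; 0; 1; 2; 0; 1; 2; 1; 1; 2; 0; 1; 2; 0; 0; 0; 1; 2; 0; 1; 2; 1; 1; 2; 0; 1; 2; 0]);
     (7, [:: 0; 0; 0; 1; 1; 2; 2; 1; 2; 2; 0; 0; 1; 1; 0; 0; 0; 1; 1; 2; 2; 1; 2; 2; 0; 0; 1; 1]);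
     (7, [:: 0; 1; 0; 1; 2; 0; 2; 0; 1; 2; 1; 2; 0; 1; 0; 1; 0; 1; 2; 0; 2; 0; 1; 2; 1; 2; 0; 1]);
     (7, [:: 0; 0; 0; 1; 1; 2; 2; 1; 1; 2; 2; 0; 0; 1; 0; 0; 0; 1; 1; 2; 2; 1; 1; 2; 2; 0; 0; 1]);
     (7, [:: 0; 0; 1; 2; 0; 1; 2; 2; 0; 1; 2; 0; 1; 1; 0; 0; 1; 2; 0; 1; 2; 2; 0; 1; 2; 0; 1; 1]);
     (7, [:: 0; 0; 0; 1; 1; 2; 2; 0; 0; 1; 1; 1; 2; 2; 0; 0; 0; 1; 1; 2; 2; 0; 0; 1; 1; 1; 2; 2]);
     (7, [:: 0; 1; 0; 1; 2; 0; 2; 1; 2; 1; 2; 0; 1; 0; 0; 1; 0; 1; 2; 0; 2; 1; 2; 1; 2; 0; 1; 0]);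
     (7, [:: 0; 0; 1; 2; 0; 1; 2; 2; 0; 1; 1; 2; 0; 1; 0; 0; 1; 2; 0; 1; 2; 2; 0; 1; 1; 2; 0; 1])].

Definition colorings56_central : seq (nat * seq nat) :=
  [:: (2, [:: 0; 0; 0; 0; 1; 1; 1; 1]);
     (2, [:: 0; 1; 1; 0; 0; 1; 1; 0]);
     (7, [:: 0; 0; 1; 2; 0; 1; 2; 1; 2; 0; 1; 1; 2; 0; 1; 2; 0; 1; 1; 2; 0; 0; 0; 1; 2; 0; 1; 2]);
     (7, [:: 0; 0; 0; 1; 1; 2; 2; 0; 0; 0; 1; 1; 2; 2; 1; 1; 2; 2; 0; 0; 1; 1; 1; 2; 2; 0; 0; 1]);
     (7, [:: 0; 1; 0; 1; 2; 0; 2; 0; 1; 0; 1; 2; 0; 2; 1; 0; 1; 2; 1; 2; 0; 1; 0; 1; 2; 1; 2; 0]);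
     (2, [:: 0; 0; 1; 1; 1; 1; 0; 0]);
     (2, [:: 0; 0; 1; 1; 0; 0; 1; 1]);
     (7, [:: 0; 1; 0; 1; 2; 0; 2; 1; 0; 1; 2; 1; 2; 0; 1; 0; 1; 2; 1; 2; 0; 0; 1; 0; 1; 2; 0; 2]);
     (7, [:: 0; 0; 0; 1; 1; 2; 2; 1; 1; 2; 2; 0; 0; 1; 1; 1; 2; 2; 0; 0; 1; 0; 0; 0; 1; 1; 2; 2]);
     (7, [:: 0; 1; 0; 1; 2; 0; 2; 1; 0; 1; 2; 1; 2; 0; 0; 1; 0; 1; 2; 0; 2; 1; 0; 1; 2; 1; 2; 0]);
     (7, [:: 0; 0; 1; 2; 0; 1; 2; 1; 2; 0; 1; 1; 2; 0; 0; 0; 1; 2; 0; 1; 2; 1; 2; 0; 1; 1; 2; 0]);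
     (7, [:: 0; 0; 0; 1; 1; 2; 2; 1; 1; 2; 2; 0; 0; 1; 0; 0; 0; 1; 1; 2; 2; 1; 1; 2; 2; 0; 0; 1]);
     (7, [:: 0; 0; 1; 2; 0; 1; 2; 0; 0; 1; 2; 0; 1; 2; 1; 2; 0; 1; 1; 2; 0; 1; 2; 0; 1; 1; 2; 0])].

Definition colorings56_inverted : seq (nat * seq nat) :=
  [:: (2, [:: 0; 0; 0; 0; 1; 1; 1; 1]);
     (2, [:: 0; 1; 0; 1; 1; 0; 1; 0]);
     (7, [:: 0; 0; 1; 2; 0; 1; 2; 0; 0; 1; 2; 0; 1; 2; 0; 1; 2; 0; 1; 1; 2; 0; 1; 2; 0; 1; 1; 2]);
     (7, [:: 0; 0; 0; 1; 1; 2; 2; 0; 0; 0; 1; 1; 2; 2; 2; 2; 0; 0; 1; 1; 1; 2; 2; 0; 0; 1; 1; 1]);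
     (7, [:: 0; 1; 0; 1; 2; 0; 2; 1; 0; 1; 2; 1; 2; 0; 2; 1; 2; 0; 1; 0; 1; 1; 2; 0; 2; 0; 1; 0]);
     (2, [:: 0; 0; 1; 1; 0; 0; 1; 1]);
     (2, [:: 0; 0; 1; 1; 1; 1; 0; 0])].

Definition colorings54 : seq (nat * seq nat) :=
  [:: (3, [:: 0; 1; 2; 0; 1; 2; 0; 1; 2; 0; 1; 2; 0; 1; 2; 0; 1; 2]);
     (3, [:: 0; 0; 0; 0; 0; 0; 0; 0; 0; 1; 1; 1; 1; 1; 1; 1; 1; 1]);
     (3, [:: 0; 0; 0; 1; 1; 1; 2; 2; 2; 2; 2; 2; 0; 0; 0; 1; 1; 1]);
     (3, [:: 0; 0; 0; 1; 1; 1; 2; 2; 2; 1; 1; 1; 2; 2; 2; 0; 0; 0])].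

Lemma search63 a : a \in [:: 0; 7; 14] ->
  pc_colorings_suffice 21 3 1 4 1 1 a 0 0 colorings63.
Proof. by move: a; apply/allP; vm_cast_no_check (erefl true). Qed.

Lemma search60_cyclic u : u \in [:: 1; 2; 4; 7; 8; 11; 13; 14] ->
  pc_colorings_suffice 15 4 1 u 1 1 0 0 0 colorings60_cyclic.
Proof. by move: u; apply/allP; vm_cast_no_check (erefl true). Qed.

Lemma search60_klein uv : uv \in [:: (1, 1); (1, 4); (1, 11); (14, 14); (4, 14)] ->
  pc_colorings_suffice 15 2 2 uv.1 uv.2 1 0 0 0 colorings60_klein.
Proof. by move: uv; apply/allP; vm_cast_no_check (erefl true). Qed.

Lemma search56_cyclic ua : ua \in [:: (1, 0); (1, 7); (13, 0); (13, 7)] ->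
  pc_colorings_suffice 14 4 1 ua.1 1 1 ua.2 0 0 colorings56_cyclic.
Proof. by move: ua; apply/allP; vm_cast_no_check (erefl true). Qed.

(** The exponents (a, (b, d)) of y^2, z^2 and the commutator of z and y as powers of
    c; all three elements lie in the subgroup of order 2 of <[c]>. *)
Definition relators56 :=
  [seq (a, bd) | a <- [:: 0; 7], bd <- [seq (b, d) | b <- [:: 0; 7], d <- [:: 0; 7]]].

Lemma search56_central abd : abd \in relators56 ->
  pc_colorings_suffice 14 2 2 1 1 1 abd.1 abd.2.1 abd.2.2 colorings56_central.
Proof. by move: abd; apply/allP; vm_cast_no_check (erefl true). Qed.

Lemma search56_inverted abd : abd \in relators56 ->
  pc_colorings_suffice 14 2 2 1 13 1 abd.1 abd.2.1 abd.2.2 colorings56_inverted.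
Proof. by move: abd; apply/allP; vm_cast_no_check (erefl true). Qed.

Lemma search54 uvw : uvw \in [:: (1, (1, 1)); (1, (1, 2)); (1, (8, 1)); (1, (8, 2));
    (4, (1, 1)); (4, (8, 1)); (7, (1, 1)); (7, (8, 1))] ->
  pc_colorings_suffice 9 3 2 uvw.1 uvw.2.1 uvw.2.2 0 0 0 colorings54.
Proof. by move: uvw; apply/allP; vm_cast_no_check (erefl true). Qed.

(** Colourings of A4, pulled back along its product with a group of order 5. *)
Definition coloringsA4 : seq (seq nat) :=
  [:: [:: 0; 0; 0; 0; 1; 1; 1; 1; 2; 2; 2; 2];
      [:: 0; 1; 0; 2; 0; 1; 1; 2; 0; 1; 2; 2];
      [:: 0; 1; 0; 2; 1; 0; 2; 1; 2; 2; 1; 0];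
      [:: 0; 1; 0; 2; 2; 0; 1; 2; 0; 2; 1; 1];
      [:: 0; 1; 0; 2; 0; 2; 2; 1; 1; 1; 2; 0];
      [:: 0; 1; 1; 2; 0; 0; 1; 2; 0; 2; 1; 2];
      [:: 0; 0; 1; 2; 2; 1; 0; 1; 1; 2; 2; 0];
      [:: 0; 0; 1; 2; 1; 2; 0; 2; 1; 0; 2; 1];
      [:: 0; 1; 1; 2; 0; 0; 2; 1; 2; 1; 2; 0]].

Lemma search60_A4 : colorings_suffice 60 (affine_mul 4 15 2 3 0)
  [seq [seq nth 0 f (a %% 12) | a <- iota 0 60] | f <- coloringsA4] [::].
Proof. by vm_cast_no_check (erefl true). Qed.

Definition coloringsF56 : seq (seq nat) :=
  [:: [:: 0; 0; 2; 2; 0; 0; 1; 1; 1; 1; 1; 1; 2; 2; 2; 2; 0; 2; 2; 0; 0; 1; 1; 0; 1; 0; 0; 1; 1;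
      0; 0; 1; 0; 1; 2; 2; 2; 2; 1; 0; 2; 2; 1; 1; 1; 1; 2; 2; 1; 1; 0; 0; 2; 2; 0; 0];
      [:: 0; 1; 1; 0; 1; 0; 1; 0; 1; 0; 0; 1; 0; 1; 2; 2; 0; 1; 2; 2; 2; 2; 0; 1; 1; 0; 1;
          0; 0; 1; 2; 2; 2; 2; 0; 1; 2; 2; 1; 0; 0; 1; 1; 0; 1; 0; 0; 1; 2; 2; 0; 1; 0; 1;
          2; 2];
      [:: 0; 1; 1; 0; 1; 0; 0; 1; 1; 0; 0; 2; 0; 1; 2; 0; 2; 1; 2; 1; 1; 2; 1; 2; 0; 0; 1;
          2; 0; 0; 2; 1; 1; 2; 0; 0; 1; 2; 0; 0; 2; 1; 2; 1; 2; 1; 2; 1; 1; 2; 0; 2; 0; 2;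
          1; 2];
      [:: 0; 0; 1; 1; 0; 0; 1; 1; 1; 1; 0; 0; 2; 2; 2; 2; 0; 2; 1; 2; 1; 0; 0; 1; 1; 1; 2;
          0; 0; 2; 1; 0; 0; 2; 0; 2; 2; 0; 2; 1; 2; 0; 1; 1; 1; 1; 0; 0; 1; 1; 0; 0; 2; 2;
          2; 2];
      [:: 0; 1; 1; 0; 1; 0; 0; 1; 1; 2; 0; 2; 2; 1; 2; 0; 2; 0; 2; 0; 0; 2; 0; 2; 0; 2; 0;
          2; 1; 1; 1; 1; 1; 1; 1; 1; 0; 0; 0; 0; 0; 2; 2; 0; 1; 2; 2; 1; 2; 0; 0; 2; 2; 1;
          1; 2];
      [:: 0; 1; 0; 1; 0; 1; 0; 2; 1; 0; 1; 2; 2; 0; 2; 1; 0; 1; 2; 0; 1; 1; 0; 2; 1; 0; 0;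
          2; 2; 2; 1; 1; 0; 1; 2; 1; 1; 0; 2; 0; 1; 0; 0; 2; 2; 1; 0; 2; 2; 2; 2; 0; 1; 0;
          1; 1];
      [:: 0; 1; 2; 0; 1; 0; 0; 2; 1; 0; 0; 2; 0; 1; 2; 0; 0; 1; 2; 0; 1; 0; 0; 2; 1; 0; 0;
          2; 0; 1; 2; 0; 0; 2; 1; 0; 2; 0; 0; 1; 1; 1; 2; 2; 1; 1; 2; 2; 2; 2; 1; 1; 2; 2;
          1; 1];
      [:: 0; 1; 1; 0; 2; 2; 2; 2; 1; 0; 0; 1; 0; 1; 1; 0; 0; 1; 1; 0; 1; 0; 0; 1; 1; 0; 0;
          1; 2; 2; 2; 2; 2; 2; 2; 2; 0; 1; 1; 0; 1; 0; 0; 1; 2; 2; 2; 2; 2; 2; 2; 2; 0; 1;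
          1; 0];
      [:: 0; 0; 1; 2; 1; 1; 0; 2; 1; 1; 0; 1; 0; 0; 1; 0; 0; 0; 2; 2; 1; 1; 2; 2; 2; 1; 1;
          1; 2; 0; 0; 0; 0; 0; 0; 0; 1; 1; 1; 1; 2; 1; 1; 2; 2; 0; 0; 2; 1; 2; 2; 1; 0; 2;
          2; 0];
      [:: 0; 2; 1; 2; 1; 2; 0; 2; 1; 1; 0; 0; 0; 0; 1; 1; 0; 0; 1; 1; 1; 1; 0; 0; 1; 2; 0;
          2; 0; 2; 1; 2; 2; 1; 2; 0; 2; 0; 2; 1; 1; 2; 0; 2; 0; 2; 1; 2; 2; 1; 2; 0; 2; 0;
          2; 1];
      [:: 0; 0; 1; 1; 1; 1; 0; 0; 1; 2; 0; 2; 2; 0; 2; 1; 0; 0; 1; 1; 1; 1; 0; 0; 1; 2; 0;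
          2; 2; 0; 2; 1; 2; 0; 2; 1; 1; 2; 0; 2; 1; 2; 0; 2; 2; 0; 2; 1; 2; 1; 2; 0; 0; 2;
          1; 2];
      [:: 0; 0; 0; 0; 2; 1; 1; 2; 1; 2; 2; 1; 0; 0; 0; 0; 0; 0; 0; 0; 2; 1; 1; 2; 1; 2; 2;
          1; 0; 0; 0; 0; 0; 0; 0; 0; 1; 2; 2; 1; 1; 2; 2; 1; 2; 1; 1; 2; 2; 1; 1; 2; 1; 2;
          2; 1];
      [:: 0; 0; 2; 2; 0; 0; 1; 1; 1; 1; 0; 0; 2; 2; 0; 0; 0; 0; 1; 1; 0; 0; 2; 2; 1; 1; 2;
          2; 2; 2; 1; 1; 2; 2; 0; 0; 1; 1; 0; 0; 0; 0; 2; 2; 0; 0; 1; 1; 2; 2; 1; 1; 1; 1;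
          2; 2];
      [:: 0; 0; 2; 2; 2; 2; 1; 1; 1; 1; 1; 1; 0; 0; 0; 0; 0; 0; 0; 0; 1; 1; 1; 1; 1; 1; 2;
          2; 2; 2; 0; 0; 2; 2; 1; 1; 0; 0; 2; 2; 1; 1; 2; 2; 2; 2; 0; 0; 2; 2; 1; 1; 0; 0;
          2; 2];
      [:: 0; 1; 1; 0; 1; 0; 0; 1; 1; 0; 0; 1; 0; 2; 2; 0; 2; 2; 2; 2; 1; 1; 1; 1; 0; 0; 1;
          1; 2; 2; 2; 2; 1; 1; 0; 0; 1; 1; 0; 0; 0; 2; 1; 2; 2; 0; 2; 1; 2; 0; 2; 1; 0; 2;
          1; 2];
      [:: 0; 1; 0; 0; 1; 2; 1; 2; 1; 0; 2; 1; 2; 0; 0; 1; 2; 1; 0; 0; 1; 1; 2; 0; 0; 0; 1;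
          2; 2; 2; 0; 1; 1; 1; 2; 1; 0; 0; 2; 0; 0; 2; 0; 2; 1; 2; 0; 2; 2; 0; 1; 1; 0; 0;
          2; 1];
      [:: 0; 1; 0; 1; 0; 1; 0; 1; 1; 0; 1; 0; 1; 2; 1; 2; 0; 2; 0; 2; 2; 0; 2; 0; 1; 0; 2;
          1; 1; 2; 0; 1; 0; 1; 1; 2; 2; 1; 1; 0; 2; 2; 0; 0; 0; 0; 2; 2; 1; 0; 2; 2; 2; 2;
          1; 0];
      [:: 0; 1; 1; 0; 0; 1; 1; 0; 1; 0; 0; 1; 1; 0; 0; 1; 0; 1; 1; 0; 2; 2; 2; 2; 2; 2; 2;
          2; 1; 0; 0; 1; 1; 0; 0; 1; 2; 2; 2; 2; 2; 2; 2; 2; 1; 0; 0; 1; 1; 0; 0; 1; 2; 2;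
          2; 2];
      [:: 0; 0; 1; 1; 1; 0; 0; 1; 1; 2; 0; 2; 0; 1; 1; 0; 0; 0; 1; 1; 2; 2; 2; 2; 2; 2; 2;
          2; 0; 0; 1; 1; 1; 1; 0; 0; 1; 1; 0; 0; 2; 0; 2; 1; 0; 0; 1; 1; 1; 2; 0; 2; 2; 1;
          2; 0];
      [:: 0; 2; 0; 1; 0; 2; 0; 1; 1; 0; 2; 0; 1; 0; 2; 0; 0; 2; 0; 1; 0; 2; 0; 1; 1; 1; 2;
          2; 1; 1; 2; 2; 0; 2; 0; 1; 0; 2; 0; 1; 1; 1; 2; 2; 1; 1; 2; 2; 2; 0; 1; 0; 2; 0;
          1; 0];
      [:: 0; 2; 1; 0; 1; 0; 0; 2; 1; 0; 0; 2; 0; 2; 1; 0; 0; 2; 1; 0; 1; 0; 0; 2; 1; 1; 2;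
          2; 2; 2; 1; 1; 0; 2; 1; 0; 1; 0; 0; 2; 1; 1; 2; 2; 2; 2; 1; 1; 2; 0; 0; 1; 0; 1;
          2; 0];
      [:: 0; 0; 2; 2; 1; 1; 0; 0; 1; 1; 0; 0; 0; 0; 2; 2; 0; 0; 2; 2; 1; 1; 0; 0; 1; 1; 1;
          1; 2; 2; 2; 2; 0; 0; 2; 2; 1; 1; 0; 0; 1; 1; 1; 1; 2; 2; 2; 2; 2; 2; 0; 0; 0; 0;
          1; 1];
      [:: 0; 0; 2; 2; 1; 1; 1; 1; 1; 1; 1; 1; 2; 2; 0; 0; 0; 0; 2; 2; 0; 0; 2; 2; 2; 2; 0;
          0; 1; 1; 1; 1; 1; 1; 1; 1; 0; 0; 2; 2; 0; 0; 2; 2; 1; 1; 1; 1; 2; 2; 0; 0; 2; 2;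
          0; 0];
      [:: 0; 1; 1; 0; 1; 2; 2; 1; 1; 2; 2; 1; 0; 1; 1; 0; 0; 0; 0; 0; 2; 2; 2; 2; 2; 1; 1;
          2; 1; 0; 0; 1; 1; 0; 0; 1; 2; 1; 1; 2; 0; 1; 1; 0; 1; 2; 2; 1; 2; 2; 2; 2; 0; 0;
          0; 0];
      [:: 0; 1; 0; 2; 2; 0; 1; 0; 1; 0; 2; 0; 0; 2; 0; 1; 0; 1; 0; 2; 2; 0; 1; 0; 1; 2; 2;
          1; 1; 2; 2; 1; 0; 1; 0; 2; 2; 0; 1; 0; 1; 2; 2; 1; 1; 2; 2; 1; 2; 0; 1; 0; 0; 1;
          0; 2];
      [:: 0; 0; 2; 0; 1; 1; 0; 2; 1; 1; 1; 2; 0; 0; 1; 0; 0; 2; 2; 1; 2; 1; 0; 2; 1; 1; 0;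
          0; 0; 2; 1; 1; 0; 2; 1; 2; 2; 1; 2; 0; 1; 0; 2; 1; 1; 0; 0; 2; 2; 1; 0; 2; 0; 2;
          2; 1]].

(** To keep the search short, it starts from an element of S of order 7, coded 8,
    and its inverse, coded 48.  The parameter e describes one of the two
    irreducible cubic polynomials over the field with 2 elements. *)
Lemma searchF56 e : e \in [:: 3; 5] ->
  colorings_suffice 56 (affine_mul 8 7 2 4 e) coloringsF56 [:: 8; 48].
Proof. by move: e; apply/allP; vm_cast_no_check (erefl true). Qed.

End Searches.

(** * Order 63 *)
Lemma normal_prime_Sylow (gT : finGroupType) (G : {group gT}) p : prime p ->
  logn p #|G| = 1%N -> [seq d <- divisors #|G| | d %% p == 1%N] = [:: 1%N] ->
  exists c, [/\ #[c] = p, <[c]> <| G & p.-Sylow(G) <[c]>].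
Proof.
move=> p_pr logp Syl1; have [P sylP nP] := unique_Sylow_normal p_pr Syl1.
have oP : #|P| = p by rewrite (card_Hall sylP) p_part logp expn1.
have /cyclicP[c defP] : cyclic P by rewrite prime_cyclic // oP.
by exists c; rewrite /order -defP; split.
Qed.

Section Order63.
Variables (gT : finGroupType) (S : connection_set gT).
Hypothesis girth6 : girth_at_least (Cay S) 6.

(** The Sylow 7-subgroup is normal and its centraliser Z has index 1 or 3.  In the
    first case the group is abelian; in the second Z is cyclic of order 21, and
    a suitable y outside Z acts on it by the power 4. *)
Lemma chromatic63 : #|gT| = 63 -> chromatic_number (Cay S) <= 3.
Proof.
move=> oT; pose G := [set: gT]%G; have oG : #|G| = 63 by rewrite cardsT.
have [|||c [oc nC sylC]] := @normal_prime_Sylow _ G 7; rewrite /= ?oG //.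
pose Z := 'C_G(<[c]>)%G; have nZ : Z <| G.
  by have := subcent_normal G <[c]>; rewrite (setIidPl (normal_norm nC)).
have iZ : #|G : Z| %| 3.
  have := index_cent_dvd_Aut nC; rewrite card_Aut_cycle oc => iZ6.
  by rewrite -[3]/(gcdn 6 63) dvdn_gcd iZ6 -oG dvdn_indexg.
have [e eZ oe] : {e | e \in Z & #[e] = 3}.
  apply: Cauchy => //; have := Lagrange (normal_sub nZ); rewrite oG => oZ.
  have: 3 ^ 2 %| #|Z| * #|G : Z| by rewrite oZ.
  case/primeP: (isT : prime 3) => _ d3; case/orP: (d3 _ iZ) => /eqP ->.
    by rewrite muln1; apply: dvdn_trans.
  by rewrite (@dvdn_pmul2r 3 3).
have cce : commute c e by case/setIP: eZ => _ /centP/(_ c (cycle_id c)) /commute_sym.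
pose h := c * e; have oh : #[h] = 21 by rewrite orderM ?oc ?oe.
have sCZ : <[c]> \subset Z by rewrite subsetI (normal_sub nC); apply: cycle_abelian.
have hZ : <[h]> \subset Z.
  have cZ : c \in Z by rewrite inE in_setT (subsetP (cycle_abelian c)) ?cycle_id.
  by rewrite cycle_subG groupM.
have [iZ1|iZ3] : #|G : Z| = 1%N \/ #|G : Z| = 3.
- by case/primeP: (isT : prime 3) => _ /(_ _ iZ) /orP[] /eqP->; auto.
- have /eqP := iZ1; rewrite indexg_eq1 => sGZ.
  have [T sylT] := Sylow_exists 3 G.
  have oT9 : #|T| = 9 by rewrite (card_Hall sylT) oG p_part.
  have defG : <[c]> * T = G.
    apply/eqP; rewrite eqEcard subsetT coprime_cardMg -?orderE ?oc ?oT9 //=.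
    by rewrite oG.
  apply: (abelian_support_chromatic girth6 (A := G)); last exact: subsetT.
  rewrite -defG abelianM cycle_abelian (@card_p2group_abelian _ 3) //=.
  apply/centsP=> x _ z zc.
  by have /setIP[_ /centP/(_ z zc)] := subsetP sGZ x (in_setT x).
have defZ : <[h]> = Z.
  apply/eqP; rewrite eqEcard hZ -orderE oh.
  by have := Lagrange (normal_sub nZ); rewrite iZ3 oG => /eqP; rewrite (@eqn_pmul2r 3 _ 21) // => /eqP->.
have nh : <[h]> <| G by rewrite defZ.
have [y [Gy hy y4]] : exists y, [/\ y \in G, y \notin <[h]> & y * h = h ^+ 4 * y].
  have /subsetPn[y Gy yZ] : ~~ (G \subset <[h]>) by rewrite defZ -indexg_eq1 iZ3.
  have [u lt_u yh] := normal_cycle_action y nh; rewrite oh in lt_u.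
  have y3 : y ^+ 3 \in <[h]> by rewrite -iZ3 -defZ expg_index_normal ?defZ.
  have u3 : (u ^ 3 == 1 %[mod 21])%N.
    rewrite -oh -eq_expg_mod_order expg1 -(inj_eq (mulIg (y ^+ 3))) -(action_power 3 yh).
    by apply/eqP; apply: (centsP (cycle_abelian h)); rewrite ?cycle_id.
  have: all (fun u => (u ^ 3 == 1 %[mod 21]) ==> (u \in [:: 1; 4; 16]))%N (iota 0 21).
    by vm_compute.
  move/allP/(_ u); rewrite mem_iota lt_u u3 !inE => /(_ isT) /or3P[] /eqP u_.
  - case/negP: yZ; rewrite defZ inE Gy; apply/centP=> x xc; move: yh.
    rewrite u_ expg1 => yh; have ych : commute y h by [].
    suffices /cycleP[i ->] : x \in <[h]> by apply: commuteX.
    by rewrite defZ (subsetP sCZ).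
  - by exists y; rewrite -u_.
  (* The square of 16 is 4 modulo 21. *)
  exists (y ^+ 2); split; first exact: groupX.
    apply: contra yZ => y2; rewrite -(mulKg (y ^+ 2) y) -expgSr.
    by rewrite groupM ?groupV.
  have -> : h ^+ 4 = h ^+ (16 ^ 2).
    by apply/eqP; rewrite eq_expg_mod_order oh.
  by rewrite (action_power 2 yh) u_.
have [a lt_a ya] : exists2 a, a < 21 & y ^+ 3 = h ^+ a.
  have : y ^+ 3 \in <[h]> by rewrite -iZ3 -defZ expg_index_normal ?defZ.
  by case/cyclePmin=> i; rewrite oh; exists i.
(* y centralises its own cube. *)
have a_ : a \in [:: 0; 7; 14]%N.
  have: all (fun a => (4 * a == a %[mod 21]) ==> (a \in [:: 0; 7; 14]))%N (iota 0 21).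
    by vm_compute.
  move/allP/(_ a); rewrite mem_iota lt_a => /(_ isT)/implyP; apply.
  rewrite -oh -eq_expg_mod_order -(inj_eq (mulIg y)) -(shift_power a y4) -ya.
  by rewrite -expgS -expgSr.
apply: (polycyclic_chromatic (c := h) (y := y) (z := 1) _ _ _ _ _ _ _ _ _ _ _ _ _
          (search63 a_) girth6) => //.
- by rewrite -oh expg_order.
- by rewrite mulg1 mul1g.
- by rewrite !mul1g mulg1.
- exact/commute_sym/commute1.
- exact/commute_sym/commute1.
have p3 : prime #|G : <[h]>| by rewrite defZ iZ3.
by rewrite cycle1 mulg1 (prime_index_gen nh p3 Gy hy).
Qed.

End Order63.

(** * Order 60 with a normal Sylow 5-subgroup *)

(** The sets of nonidentity elements of the subgroups are disjoint. *)
Lemma TI_family_card (gT : finGroupType) (Ps : {set {group gT}}) (A : {set gT}) k :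
  (forall P : {group gT}, P \in Ps -> #|P| = k /\ P^# \subset A) ->
  (forall P Q : {group gT}, P \in Ps -> Q \in Ps -> P :&: Q != 1 -> P = Q) ->
  #|Ps| * k.-1 <= #|A|.
Proof.
move=> PsA PsTI.
have -> : (#|Ps| * k.-1 = \sum_(P in Ps) \sum_(x in A) (x \in (P : {group gT})^#))%N.
  rewrite -sum_nat_const; apply: eq_bigr => P /PsA[oP sPA].
  have := cardsD1 1 P; rewrite group1 oP => ->; rewrite -sum1_card big_mkcond /=.
  rewrite [RHS]big_mkcond /=; apply: eq_bigr => x _; rewrite /=.
  case Px: (x \in P^#); last by case: ifP.
  by rewrite (subsetP sPA x Px).
rewrite exchange_big -sum1_card; apply: leq_sum => x _ /=.
rewrite -big_mkcondr /= sum1dep_card; apply/card_le1_eqP => P Q; rewrite !inE.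
move=> /andP[PP Px] /andP[QP Qx]; apply: PsTI => //.
case/andP: Px Qx => x1 Px /andP[_ Qx].
by apply/trivgPn; exists x; rewrite // inE Qx Px.
Qed.

Lemma Sylow_order_card (gT : finGroupType) (H : {group gT}) p : prime p ->
  logn p #|H| = 1%N -> #|'Syl_p(H)| * p.-1 <= #|[set x in H | #[x] == p]|.
Proof.
move=> p_pr logp; have oSyl P : P \in 'Syl_p(H) -> #|P| = p.
  by rewrite inE => sylP; rewrite (card_Hall sylP) p_part logp expn1.
apply: TI_family_card => [P sylP | P Q /oSyl oP /oSyl oQ].
  have oP := oSyl P sylP; split=> //; apply/subsetP=> x; rewrite !inE => /andP[x1 Px].
  move: sylP; rewrite inE => /andP[sPH _]; rewrite (subsetP sPH) //=.
  have : #[x] %| p by rewrite -oP order_dvdG.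
  by case/primeP: p_pr => _ d_p /d_p; rewrite order_eq1 (negbTE x1).
move=> ntPQ; have tiPQ (R : {group gT}) : #|R| = p -> P :&: Q \subset R -> P :&: Q = R.
  move=> oR sR; apply/eqP; rewrite eqEcard sR oR dvdn_leq ?cardG_gt0 //.
  have := cardSg sR; rewrite oR; case/primeP: p_pr => _ d_p /d_p.
  by rewrite -trivg_card1 (negbTE ntPQ) => /eqP->.
by apply: val_inj; rewrite /= -(tiPQ P) ?subsetIl // (tiPQ Q) ?subsetIr.
Qed.

(** The Sylow p-subgroups have order p, and their nonidentity elements fill all of
    H but |K| elements; as K contains none of them, it is the set of the
    remaining elements, which conjugation preserves. *)
Lemma Sylow_complement_normal (gT : finGroupType) (H K : {group gT}) p : prime p ->
  logn p #|H| = 1%N -> (#|'Syl_p(H)| * p)%N = #|H| -> K \subset H ->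
  (#|K| * p)%N = #|H| -> K <| H.
Proof.
move=> p_pr logp nSyl sKH oK; pose E := [set x in H | #[x] == p].
have p_gt0 := prime_gt0 p_pr.
have nSylK : #|'Syl_p(H)| = #|K|.
  by apply/eqP; rewrite -(eqn_pmul2r p_gt0) nSyl oK.
have le_E : #|K| * p.-1 <= #|E| by rewrite -nSylK Sylow_order_card.
have defK : K :=: H :\: E.
  apply/eqP; rewrite eqEcard; apply/andP; split.
    apply/subsetP=> x Kx; rewrite !inE (subsetP sKH) // andbT /=; apply/negP=> /eqP ox.
    have pK : p %| #|K| by rewrite -ox order_dvdG.
    have : p ^ 2 %| #|H| by rewrite -oK dvdn_mul.
    by rewrite pfactor_dvdn ?cardG_gt0 // logp.
  have EH : E \subset H by apply/subsetP=> x; rewrite inE => /andP[].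
  rewrite cardsD (setIidPr EH) leq_subLR -oK -{1}(prednK p_gt0) mulnS addnC.
  by rewrite leq_add2r.
rewrite /normal sKH; apply/subsetP=> h Hh; rewrite inE defK conjDg conjGid //.
apply: setDS; apply/subsetP=> x; rewrite inE => /andP[Hx ox].
by rewrite mem_conjg inE orderJ ox groupJ ?groupV.
Qed.

Section Order60.
Variables (gT : finGroupType) (S : connection_set gT).
Hypotheses (girth6 : girth_at_least (Cay S) 6) (oT : #|gT| = 60).
Let G := [set: gT]%G.
Let oG : #|G| = 60. Proof. by rewrite cardsT. Qed.

Section Cyclic15.
Variable c : gT.
Hypotheses (oc : #[c] = 15) (nc : <[c]> <| G).

Let c15 : c ^+ 15 = 1. Proof. by rewrite -oc expg_order. Qed.

Let action_order k y u : y ^+ k = 1 -> y * c = c ^+ u * y -> (u ^ k == 1 %[mod 15])%N.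
Proof.
move=> yk yc; rewrite -oc -eq_expg_mod_order expg1.
by have := action_power k yc; rewrite yk mul1g mulg1 => <-.
Qed.

(** The pairs (u, v) represent the actions of a Klein four-group on <[c]> up to the
    choice of two of its involutions as generators. *)
Lemma chromatic60_klein_generators (y z : gT) u v :
  (u, v) \in [:: (1, 1); (1, 4); (1, 11); (14, 14); (4, 14)]%N ->
  y ^+ 2 = 1 -> z ^+ 2 = 1 -> commute y z -> y * c = c ^+ u * y -> z * c = c ^+ v * z ->
  G = <[c]> * <[y]> * <[z]> :> {set gT} -> chromatic_number (Cay S) <= 3.
Proof.
move=> uvL y2 z2 cyz yc zc gen.
apply: (polycyclic_chromatic (c := c) (y := y) (z := z) _ _ _ _ _ _ _ _ _ _ _ _ _
          (search60_klein uvL) girth6) => //.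
- by rewrite mul1g cyz.
- exact/commute_sym/commute1.
exact/commute_sym/commute1.
Qed.

(** A Sylow 2-subgroup complements <[c]>; it is cyclic, generated by an
    element acting by a fourth root of 1 modulo 15, or a Klein four-group. *)
Lemma chromatic60_cyclic15 : chromatic_number (Cay S) <= 3.
Proof.
have [R sylR] := Sylow_exists 2 G.
have oR : #|R| = 4 by rewrite (card_Hall sylR) oG p_part.
have defG : <[c]> * R = G.
  by apply/eqP; rewrite eqEcard subsetT coprime_cardMg -?orderE ?oc ?oR //= oG.
have [/cyclicP[y defR] | ncR] := boolP (cyclic R).
  have y4 : y ^+ 4 = 1 by rewrite -oR defR -orderE expg_order.
  have [u lt_u yc] := normal_cycle_action y nc; rewrite oc in lt_u.
  have u_ : u \in [:: 1; 2; 4; 7; 8; 11; 13; 14]%N.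
    have: all (fun u => (u ^ 4 == 1 %[mod 15]) ==> (u \in [:: 1; 2; 4; 7; 8; 11; 13; 14]))%N (iota 0 15).
      by vm_compute.
    by move/allP/(_ u); rewrite mem_iota lt_u (action_order y4 yc) => /(_ isT).
  apply: (polycyclic_chromatic (c := c) (y := y) (z := 1) _ _ _ _ _ _ _ _ _ _ _ _ _
            (search60_cyclic u_) girth6) => //.
  - by rewrite mulg1 mul1g.
  - by rewrite !mul1g mulg1.
  - exact/commute_sym/commute1.
  - exact/commute_sym/commute1.
  by rewrite cycle1 mulg1 -defR defG.
have R2 x : x \in R -> x ^+ 2 = 1.
  move=> Rx; apply/eqP; rewrite -order_dvdn.
  have : #[x] %| 4 by rewrite -oR order_dvdG.
  have ox4 : #[x] != 4.
    apply: contra ncR => /eqP ox; apply/cyclicP; exists x; apply/esym/eqP.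
    by rewrite eqEcard cycle_subG Rx oR -orderE ox.
  rewrite (_ : 4 = 2 ^ 2)%N // => /(dvdn_pfactor _ 2 (isT : prime 2))[[|[|[|//]]] _ ox]; rewrite ox // in ox4 *.
have abR : abelian R by apply: (@card_p2group_abelian _ 2).
have [y Ry y1] : exists2 y, y \in R & y != 1.
  by apply/trivgPn; rewrite trivg_card1 oR.
have [z Rz zy] : exists2 z, z \in R & z \notin [set 1; y].
  apply/subsetPn/negP => /subset_leq_card.
  by rewrite cards2 oR; case: eqP.
have key y' z' u v : (u, v) \in [:: (1, 1); (1, 4); (1, 11); (14, 14); (4, 14)]%N ->
    y' \in R -> z' \in R -> y' != 1 -> z' != 1 -> y' != z' ->
    y' * c = c ^+ u * y' -> z' * c = c ^+ v * z' -> chromatic_number (Cay S) <= 3.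
  move=> uvL Ry' Rz' y'1 z'1 nyz yc zc.
  apply: (chromatic60_klein_generators uvL (R2 _ Ry') (R2 _ Rz') _ yc zc).
    by apply: (centsP abR).
  have o2 x : x \in R -> x != 1 -> #[x] = 2.
    by move=> Rx x1; apply: nt_prime_order => //; apply: R2.
  rewrite -mulgA -[LHS]defG; congr (_ * _); apply/esym/eqP.
  rewrite eqEcard mul_subG ?cycle_subG //= TI_cardMg; first by rewrite -!orderE !o2 // oR.
  by rewrite prime_TIg -?orderE ?o2 // cycle_subG /= (cycle2g (o2 _ Rz' z'1)) !inE negb_or y'1.
move: zy; rewrite !inE negb_or => /andP[z1 nzy]; have nyz : y != z by rewrite eq_sym.
have [[u lt_u yc] [v lt_v zc]] := (normal_cycle_action y nc, normal_cycle_action z nc).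
rewrite oc in lt_u lt_v.
have yzc : (y * z) * c = c ^+ (u * v %% 15) * (y * z).
  by rewrite (expg_mod _ c15) -mulgA zc mulgA (shift_power _ yc) -!mulgA.
have Ryz : y * z \in R by rewrite groupM.
have yz1 : y * z != 1.
  have yV : y^-1 = y by apply/eqP; rewrite eq_invg_mul -[X in _ * X]expg1 -expgS R2.
  by rewrite -eq_invg_mul yV.
have yzy : y != y * z by rewrite -{1}[y]mulg1 (inj_eq (mulgI y)) eq_sym.
have yzz : z != y * z by rewrite -{1}[z]mul1g (inj_eq (mulIg z)) eq_sym.
have sq1 x w : w < 15 -> x \in R -> x * c = c ^+ w * x -> w \in [:: 1; 4; 11; 14]%N.
  have: all (fun w => (w ^ 2 == 1 %[mod 15]) ==> (w \in [:: 1; 4; 11; 14]))%N (iota 0 15).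
    by vm_compute.
  by move=> /allP/(_ w) + lt_w Rx xc; rewrite mem_iota lt_w (action_order (R2 x Rx) xc) => /(_ isT).
have nzyz : y * z != z by rewrite eq_sym. have nyzy : y * z != y by rewrite eq_sym.
(* The three involutions of R act with exponents u, v and u v. *)
move: (sq1 _ _ lt_u Ry yc) (sq1 _ _ lt_v Rz zc); rewrite !inE.
case/or4P=> /eqP u_; case/or4P=> /eqP v_; rewrite u_ v_ /= in yc zc yzc;
  first [by apply: (key y z) yc zc | by apply: (key z y) zc yc
       | by apply: (key y (y * z)) yc yzc | by apply: (key (y * z) y) yzc yc
       | by apply: (key z (y * z)) zc yzc | by apply: (key (y * z) z) yzc zc].
Qed.

End Cyclic15.
End Order60.

Section Order60Normal5.
Variables (gT : finGroupType) (S : connection_set gT).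
Hypotheses (girth6 : girth_at_least (Cay S) 6) (oT : #|gT| = 60).
Let G := [set: gT]%G.
Let oG : #|G| = 60. Proof. by rewrite cardsT. Qed.
Variable p : gT.
Hypotheses (op : #[p] = 5) (np : <[p]> <| G).
Let H := (G / <[p]>)%G.
Let oH : #|H| = 12.
Proof.
rewrite /H /= card_quotient ?normal_norm //.
by have /eqP := Lagrange (normal_sub np); rewrite oG -orderE op (@eqn_pmul2l 5 _ 12) // => /eqP.
Qed.

(** The preimage of T has order 15, hence is cyclic, as an automorphism group of a
    group of order 5 has no element of order 3. *)
Lemma chromatic60_normal3 (T : {group coset_of <[p]>}) :
  3.-Sylow(H) T -> T <| H -> chromatic_number (Cay S) <= 3.
Proof.
move=> sylT nT; have oT3 : #|T| = 3 by rewrite (card_Hall sylT) oH p_part.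
have [J defT sPJ nJ] := inv_quotientN np nT.
have oJ : #|J| = 15.
  have := Lagrange sPJ; rewrite -orderE op -card_quotient ?(subset_trans (normal_sub nJ)) ?normal_norm //.
  by rewrite -defT oT3 => <-.
have sJC : J \subset 'C(<[p]>).
  have nPJ : <[p]> <| J := normalS sPJ (normal_sub nJ) np.
  have := index_cent_dvd_Aut nPJ; rewrite card_Aut_cycle op => i4.
  have i15 : #|J : 'C_J(<[p]>)| %| 15 by rewrite -oJ dvdn_indexg.
  have : #|J : 'C_J(<[p]>)| %| gcdn 4 15 by rewrite dvdn_gcd i4.
  rewrite (_ : gcdn 4 15 = 1%N) // dvdn1 indexg_eq1 => sJ.
  by apply: subset_trans sJ _; apply: subsetIr.
have [e Je oe] : {e | e \in J & #[e] = 3} by apply: Cauchy; rewrite // oJ.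
have cpe : commute p e by apply/esym; apply: (centP (subsetP sJC e Je)); apply: cycle_id.
have oc : #[p * e] = 15 by rewrite orderM ?op ?oe.
apply: (chromatic60_cyclic15 girth6 oT oc).
have <- // : J :=: <[p * e]>.
apply/esym/eqP; rewrite eqEcard cycle_subG -orderE oc oJ groupM //.
by rewrite (subsetP sPJ) ?cycle_id.
Qed.

(** With four Sylow 3-subgroups the quotient by <[p]> is A4.  As A4 has no
    quotient of order 2, <[p]> is central, and the group is the product of <[p]>
    with a Klein four-group extended by an element of order 3. *)
Lemma chromatic60_A4 : #|'Syl_3(H)| = 4 -> chromatic_number (Cay S) <= 3.
Proof.
move=> nSyl; have [e Ge oe] : {e | e \in G & #[e] = 3} by apply: Cauchy; rewrite // oG.
have nPG := normal_norm np; have nPe : <[e]> \subset 'N(<[p]>).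
  by rewrite cycle_subG (subsetP nPG).
pose T := (<[e]> / <[p]>)%G.
have sylT : 3.-Sylow(H) T.
  by apply: quotient_pHall; rewrite // pHallE subsetT oG p_part -orderE oe.
have oT3 : #|T| = 3 by rewrite (card_Hall sylT) oH p_part.
have iNT : #|'N_H(T)| = 3.
  have := Lagrange (subsetIl H 'N(T)); rewrite -(card_Syl sylT) nSyl oH.
  by move/eqP; rewrite (@eqn_pmul2r 4 _ 3) // => /eqP.
have defNT : 'N_H(T) = T.
  by apply/esym/eqP; rewrite eqEcard iNT oT3 subsetI (pHall_sub sylT) normG.
(* The centraliser C of p contains the elements of order 3, as Aut <[p]> is a
   2-group; the Frattini argument then shows that C is everything. *)
have pZ : G \subset 'C(<[p]>).
  pose C := 'C_G(<[p]>)%G; have nC : C <| G.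
    by have := subcent_normal G <[p]>; rewrite (setIidPl nPG).
  have sPC : <[p]> \subset C by rewrite subsetI (normal_sub np); apply: cycle_abelian.
  have /dvdnP[k iC4] : #|G : C| %| 4.
    by have := index_cent_dvd_Aut np; rewrite card_Aut_cycle op.
  have eC : e \in C.
    have -> : e = e ^+ 4 by rewrite expgS -oe expg_order mulg1.
    by rewrite iC4 mulnC expgM groupX // expg_index_normal.
  have sTC : T \subset C / <[p]> by rewrite quotientS // cycle_subG.
  have nCH : C / <[p]> <| H by apply: quotient_normal.
  have := Frattini_arg nCH (pHall_subl sTC (normal_sub nCH) sylT).
  rewrite defNT mulGSid // => eqCH.
  have -> : G :=: C by apply: (quotient_inj np) => //; apply: normalS sPC (normal_sub nC) np.
  exact: subsetIr.
have [Kb sylK] := Sylow_exists 2 H.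
have oK : #|Kb| = 4 by rewrite (card_Hall sylK) oH p_part.
have nKH : Kb <| H.
  apply: (@Sylow_complement_normal _ H Kb 3); rewrite ?nSyl ?oH ?oK ?(pHall_sub sylK) //.
have [M defK sPM nM] := inv_quotientN np nKH.
have oM : #|M| = 20.
  have := Lagrange sPM; rewrite -orderE op -card_quotient ?(subset_trans (normal_sub nM)) //.
  by rewrite -defK oK => <-.
have [V sylV] := Sylow_exists 2 M.
have oV : #|V| = 4 by rewrite (card_Hall sylV) oM p_part.
have abV : abelian V by apply: (@card_p2group_abelian _ 2).
have sVM := pHall_sub sylV.
have defM : <[p]> * V = M.
  apply/eqP; rewrite eqEcard mul_subG //= coprime_cardMg -?orderE ?op ?oV //.
  by rewrite oM.
have abM : abelian M.
  by rewrite -defM abelianM cycle_abelian abV (subset_trans (subsetT V) pZ).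
have nVG : V <| G.
  have nVM : V <| M by rewrite /normal sVM (subset_trans abM) // (subset_trans (centS sVM)) ?cent_sub.
  have <- := normal_Hall_pcore sylV nVM.
  exact: char_normal_trans (pcore_char _ _) nM.
pose c := p * e.
have cpe : commute p e by apply/esym; apply: (centP (subsetP pZ e Ge)); apply: cycle_id.
have oc : #[c] = 15 by rewrite orderM ?op ?oe.
have c15 : c ^+ 15 = 1 by rewrite -oc expg_order.
have defG : V * <[c]> = G.
  apply/eqP; rewrite eqEcard subsetT coprime_cardMg -?orderE ?oc ?oV //.
  by rewrite oG.
have [w0 Vw0 cw0] : exists2 w0, w0 \in V & w0 ^ c^-1 != w0.
  apply/exists_inP; apply: contraT; rewrite negb_exists_in => /forall_inP fixV.
  have abH : abelian H.
    rewrite quotient_abelian // -[gval G]defG abelianM abV cycle_abelian cycle_subG /=.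
    apply/centP=> w Vw; apply/commute_sym/commgP/conjg_fixP.
    by have /negbNE/eqP := fixV w Vw => {1}<-; rewrite conjgKV.
  move: iNT; rewrite (setIidPl _) ?oH // (subset_trans abH) //.
  by rewrite (subset_trans (centS (pHall_sub sylT))) ?cent_sub.
pose w1 := w0 ^ c^-1; pose w2 := w1 ^ c^-1.
have VJ w : w \in V -> w ^ c^-1 \in V.
  by move=> Vw; rewrite memJ_norm // (subsetP (normal_norm nVG)) // inE.
have [Vw1 Vw2] : w1 \in V /\ w2 \in V by rewrite !VJ.
have n21 : w2 != w1 by rewrite (inj_eq (conjg_inj _)).
have n20 : w2 != w0.
  apply: contra cw0 => /eqP w20.
  have cc : c^-1 ^+ 2 \in 'C[w0].
    by rewrite cent1C; apply/cent1P/commgP/conjg_fixP; rewrite expgS expg1 conjgM; exact: w20.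
  have : (c^-1 ^+ 2) ^+ 8 \in 'C[w0] by rewrite groupX.
  rewrite -expgM (_ : 2 * 8 = 1 + 15)%N // expgD expgVn expg1 expgVn c15 invg1 mulg1.
  by rewrite cent1C => /cent1P/commgP/conjg_fixP->.
have nt0 : w0 != 1 by apply: contraNneq cw0 => ->; rewrite conj1g.
have nt1 : w1 != 1 by rewrite conjg_eq1.
have nt2 : w2 != 1 by rewrite conjg_eq1.
have defV : V :=: [set 1; w0; w1; w2].
  apply/esym/eqP; rewrite eqEcard oV; apply/andP; split.
    by apply/subsetP=> w; rewrite !inE => /orP[/orP[/orP[]|]|] /eqP->.
  rewrite setUC cardsU1 setUC cardsU1 cards2 !inE !negb_or n20 n21 nt2 nt1.
  by rewrite cw0 [1 == _]eq_sym nt0.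
have [o1 o2] : #[w1] = #[w0] /\ #[w2] = #[w0] by rewrite !orderJ.
have ow0 : #[w0] = 2.
  have [w Vw ow] : {w | w \in V & #[w] = 2} by apply: Cauchy; rewrite // oV.
  move: Vw ow; rewrite defV !inE -!orbA => /or4P[] /eqP-> //; rewrite ?order1 ?o1 ?o2 //.
have inv w : #[w] = 2 -> w ^+ 2 = 1 by move=> <-; apply: expg_order.
have w01 : w0 * w1 = w2.
  have : w0 * w1 \in V by rewrite groupM.
  have w0V : w0^-1 = w0 by apply/eqP; rewrite eq_invg_mul -[X in _ * X]expg1 -expgS inv.
  rewrite defV !inE -!orbA => /or4P[] /eqP // w01.
  - by case/negP: cw0; rewrite -/w1 -w0V eq_sym eq_invg_mul w01.
  - by case/negP: nt1; rewrite -(inj_eq (mulgI w0)) w01 mulg1.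
  by case/negP: nt0; rewrite -(inj_eq (mulIg w1)) w01 mul1g.
have cJ w : c * w = w ^ c^-1 * c by rewrite conjgE invgK -!mulgA mulVg mulg1.
apply: (@affine_chromatic _ 4 15 2 3 0 w0 w1 1 c oT _ _ _ _ _ _ _ _ _ _ _ _ _ _ _
   _ _ _ search60_A4 _ girth6) => //; rewrite ?expg1n //.
- exact: inv.
- by apply: inv; rewrite o1.
- by apply: (centsP abV).
- exact: commute1.
- exact: commute1.
- by rewrite cJ /vec_elt /= mul1g !mulg1.
- by rewrite cJ -/w2 -w01 /vec_elt /= !mulg1.
- by rewrite /vec_elt /= !mulg1 mul1g.
move=> g; have : g \in V * <[c]> by rewrite defG inE.
case/mulsgP=> w _ Vw /cycleP[i ->] ->; move: Vw.
rewrite defV !inE -!orbA => /or4P[] /eqP->.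
- by exists 0 => //; exists i; rewrite /vec_elt /= !mulg1.
- by exists 1%N => //; exists i; rewrite /vec_elt /= !mulg1.
- by exists 2 => //; exists i; rewrite /vec_elt /= mulg1 mul1g.
by exists 3 => //; exists i; rewrite /vec_elt /= mulg1 w01.
Qed.

Lemma chromatic60_normal5 : chromatic_number (Cay S) <= 3.
Proof.
have := Syl_dvd_mod H (isT : prime 3); rewrite oH.
have -> : [seq d <- divisors 12 | d %% 3 == 1%N] = [:: 1; 4]%N by [].
rewrite !inE => /orP[/normal_sylowP[T sylT nT] | /eqP]; last exact: chromatic60_A4.
exact: chromatic60_normal3 sylT nT.
Qed.

End Order60Normal5.

(** * Order 60 with six Sylow 5-subgroups *)

(** Otherwise there would be ten Sylow 3-subgroups and six Sylow 5-subgroups, with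
    20 and 24 nonidentity elements. *)
Lemma order30_normal_Sylow (gT : finGroupType) (K : {group gT}) : #|K| = 30 ->
  exists p, p \in [:: 3; 5] /\ exists2 T : {group gT}, p.-Sylow(K) T & T <| K.
Proof.
move=> oK; have := Syl_dvd_mod K (isT : prime 3); rewrite oK !inE => /orP[|/eqP nS3].
  by move=> nS; exists 3; split=> //; apply/normal_sylowP.
have := Syl_dvd_mod K (isT : prime 5); rewrite oK !inE => /orP[|/eqP nS5].
  by move=> nS; exists 5; split=> //; apply/normal_sylowP.
have := Sylow_order_card (isT : prime 5) (_ : logn 5 #|K| = 1%N).
have := Sylow_order_card (isT : prime 3) (_ : logn 3 #|K| = 1%N).
rewrite nS5 nS3 oK => /(_ erefl) le3 /(_ erefl) le5.
have : #|[set x in K | #[x] == 3] :|: [set x in K | #[x] == 5]| <= #|K|.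
  by apply: subset_leq_card; apply/subsetP=> x; rewrite !inE => /orP[] /andP[].
rewrite cardsU (_ : _ :&: _ = set0) ?cards0 ?subn0 ?oK => [le30|]; last first.
  by apply/setP=> x; rewrite !inE; case: (#[x] =P 3) => [->|]; rewrite !andbF.
by have := leq_trans (leq_add le3 le5) le30.
Qed.

Section SixSylow5.
Variable gT : finGroupType.
Let G := [set: gT]%G.
Hypotheses (oG : #|G| = 60) (nSyl : #|'Syl_5(G)| = 6).

Let mem_Syl5 (P : {group gT}) : #|P| = 5 -> 5.-Sylow(G) P.
Proof. by move=> oP; rewrite pHallE subsetT oG p_part oP. Qed.

Let card_norm5 (P : {group gT}) : #|P| = 5 -> #|'N_G(P)| = 10.
Proof.
move=> /mem_Syl5 sylP; have := Lagrange (subsetIl G 'N(P)).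
by rewrite -(card_Syl sylP) nSyl oG => /eqP; rewrite (@eqn_pmul2r 6 _ 10) // => /eqP.
Qed.

Let no_normal5 (K : {group gT}) : 5 %| #|K| -> #|'Syl_5(K)| = 1%N -> #|K| %| 10.
Proof.
move=> K5 /eqP/normal_sylowP[P sylP nP].
have oP : #|P| = 5.
  have : #|K| %| 60 by rewrite -oG cardSg ?subsetT.
  rewrite (card_Hall sylP) p_part => K60.
  suff -> : logn 5 #|K| = 1%N by [].
  apply/eqP; rewrite eqn_leq (dvdn_leq_log 5 _ K60) //=.
  by rewrite -pfactor_dvdn ?cardG_gt0.
by rewrite -(card_norm5 oP) cardSg // subsetI subsetT normal_norm.
Qed.

(** A normal Sylow 5-subgroup of K makes K a subgroup of its normaliser in G, of
    order 10.  This leaves order 30, where a normal Sylow 3-subgroup would extend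
    to a subgroup of order 15. *)
Lemma order_multiple5 (K : {group gT}) : 5 %| #|K| -> #|K| \in [:: 5; 10; 60].
Proof.
have no15 (L : {group gT}) : #|L| <> 15.
  move=> oL; have := Syl_dvd_mod L (isT : prime 5); rewrite oL inE => /eqP/no_normal5.
  by rewrite oL => /(_ isT).
move=> K5; have K60 : #|K| %| 60 by rewrite -oG cardSg ?subsetT.
have : #|K| \in [seq d <- divisors 60 | 5 %| d] by rewrite mem_filter K5 -dvdn_divisors.
rewrite (_ : [seq _ <- _ | _] = [:: 5; 10; 15; 20; 30; 60]) //.
have := Syl_dvd_mod K (isT : prime 5); have := no_normal5 K5; move: (no15 K).
rewrite !inE; case: eqP => // _; case: eqP => // _; case: eqP => // _ _ nK nS.
rewrite /=; case/or3P=> /eqP oK; rewrite oK // in nK nS *; first by move: nS; rewrite inE => /eqP/nK.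
have [p [p35 [T sylT nT]]] := order30_normal_Sylow oK.
move: p35; rewrite !inE => /orP[] /eqP p_; rewrite p_ in sylT; last first.
  by have /nK : #|'Syl_5(K)| = 1%N by apply/eqP/normal_sylowP; exists T.
have oT : #|T| = 3 by rewrite (card_Hall sylT) oK p_part.
have [P sylP] := Sylow_exists 5 K; have sPK := pHall_sub sylP.
have oP : #|P| = 5 by rewrite (card_Hall sylP) oK p_part.
case: (no15 (T <*> P)%G); rewrite /= norm_joinEr; last first.
  exact: subset_trans sPK (normal_norm nT).
by rewrite coprime_cardMg oT oP.
Qed.

(** The product of M with a Sylow 5-subgroup P has order 5 |M|, so that |M| is 1, 2
    or 12.  In the last two cases Sylow theory in G / M or in M yields a normal
    subgroup of forbidden order, or a normal Sylow 5-subgroup. *)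
Lemma normal_coprime5 (M : {group gT}) : M <| G -> ~~ (5 %| #|M|) -> M :=: 1.
Proof.
move=> nM M5; have [P sylP] := Sylow_exists 5 G.
have oP : #|P| = 5 by rewrite (card_Hall sylP) oG p_part.
have ext (L : {group gT}) : L <| G -> ~~ (5 %| #|L|) -> #|L| \in [:: 1; 2; 12]%N.
  move=> nL L5; have oLP : #|L <*> P| = (#|L| * 5)%N.
    rewrite norm_joinEr ?coprime_cardMg ?oP // 1?coprime_sym ?prime_coprime //.
    exact: subset_trans (subsetT P) (normal_norm nL).
  have := @order_multiple5 (L <*> P)%G; rewrite /= oLP dvdn_mull // => /(_ isT).
  by rewrite !inE -[5]/(1 * 5)%N -[10]/(2 * 5)%N -[60]/(12 * 5)%N !eqn_pmul2r.
move: (ext M nM M5); rewrite !inE => /or3P[|/eqP oM|/eqP oM]; first by rewrite -trivg_card1 => /eqP.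
  have oQ : #|G / M| = 30.
    rewrite card_quotient ?normal_norm //; have := Lagrange (normal_sub nM).
    by rewrite oG oM => /eqP; rewrite (@eqn_pmul2l 2 _ 30) // => /eqP.
  have [p [p35 [Tb sylT nT]]] := order30_normal_Sylow oQ.
  have [J defT sMJ nJ] := inv_quotientN nM nT.
  have oJ : #|J| = (2 * p)%N.
    rewrite -(Lagrange sMJ) oM -card_quotient; last first.
      exact: subset_trans (subsetT J) (normal_norm nM).
    rewrite -defT (card_Hall sylT) oQ.
    by move: p35; rewrite !inE => /orP[] /eqP->; rewrite p_part.
  move: p35; rewrite !inE => /orP[] /eqP p_; rewrite p_ in oJ.
    by have := ext J nJ; rewrite oJ => /(_ isT).
  have [R sylR nR] : exists2 R : {group gT}, 5.-Sylow(J) R & R <| J.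
    by apply: unique_Sylow_normal; rewrite // oJ.
  have nRG : R <| G.
    have <- := normal_Hall_pcore sylR nR.
    exact: char_normal_trans (pcore_char _ _) nJ.
  have : #|'Syl_5(G)| = 1%N.
    apply/eqP/normal_sylowP; exists R => //; apply: mem_Syl5.
    by rewrite (card_Hall sylR) oJ p_part.
  by rewrite nSyl.
have := Syl_dvd_mod M (isT : prime 3); rewrite oM !inE => /orP[/normal_sylowP[R sylR nR]|/eqP nS].
  have nRG : R <| G.
    have <- := normal_Hall_pcore sylR nR.
    exact: char_normal_trans (pcore_char _ _) nM.
  by have := ext R nRG; rewrite (card_Hall sylR) oM p_part => /(_ isT).
have [R sylR] := Sylow_exists 2 M.
have oR : #|R| = 4 by rewrite (card_Hall sylR) oM p_part.
have nR : R <| M.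
  by apply: (@Sylow_complement_normal _ M R 3); rewrite ?oM ?nS ?oR ?(pHall_sub sylR).
have nRG : R <| G.
  have <- := normal_Hall_pcore sylR nR.
  exact: char_normal_trans (pcore_char _ _) nM.
by have := ext R nRG; rewrite oR => /(_ isT).
Qed.

(** The normaliser of a Sylow 2-subgroup Q serves if it is larger than Q.
    Otherwise Q has 15 conjugates, two of which share a nonidentity element,
    whose centraliser then serves. *)
Lemma exists_subgroup12 : exists H : {group gT}, #|H| = 12.
Proof.
have [Q sylQ] := Sylow_exists 2 G; have oQ : #|Q| = 4 by rewrite (card_Hall sylQ) oG p_part.
have mult4 (L R : {group gT}) : #|R| = 4 -> R \proper L -> L :!=: G -> #|L| = 12.
  move=> oR /andP[sRL nLR] nLG; have L4 : 4 %| #|L| by rewrite -oR cardSg.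
  have L60 : #|L| %| 60 by rewrite -oG cardSg ?subsetT.
  have : #|L| \in [seq d <- divisors 60 | 4 %| d] by rewrite mem_filter L4 -dvdn_divisors.
  rewrite (_ : [seq _ <- _ | _] = [:: 4; 12; 20; 60]) // !inE => /or4P[] /eqP oL //.
  - by case/negP: nLR; rewrite -(geq_leqif (subset_leqif_card sRL)) oL oR.
  - by have := @order_multiple5 L; rewrite oL => /(_ isT).
  by case/eqP: nLG; apply/eqP; rewrite eqEcard subsetT oL oG.
have [sNQ | nNQ] := boolP ('N_G(Q) \subset Q); last first.
  exists 'N_G(Q)%G; apply: (mult4 _ Q oQ).
    by rewrite properE nNQ andbT subsetI subsetT normG.
  apply/eqP=> /= defN.
  have nQ : Q <| G by rewrite /normal subsetT; apply/setIidPl.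
  by have := normal_coprime5 nQ; rewrite oQ => /(_ isT) Q1; rewrite Q1 cards1 in oQ.
have nSyl2 : #|'Syl_2(G)| = 15.
  have defN : 'N_G(Q) = Q by apply/eqP; rewrite eqEsubset sNQ subsetI subsetT normG.
  rewrite (card_Syl sylQ) defN; have := Lagrange (subsetT Q).
  by rewrite oG oQ => /eqP; rewrite (@eqn_pmul2l 4 _ 15) // => /eqP.
have oSyl P : P \in 'Syl_2(G) -> #|P| = 4.
  by rewrite inE => sylP; rewrite (card_Hall sylP) oG p_part.
(* Fifteen Sylow 2-subgroups meeting trivially would leave no room for the 24
   elements of order 5. *)
have [/existsP[P /existsP[R /and4P[SP SR ntPR nPR]]] | TI2] := boolP [exists P : {group gT},
    exists R : {group gT}, [&& P \in 'Syl_2(G), R \in 'Syl_2(G), P :&: R != 1 & P != R]].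
  have [t /setIP[Pt Rt] t1] := trivgPn _ ntPR.
  have abel4 (L : {group gT}) : #|L| = 4 -> abelian L.
    by move=> oL; apply: (@card_p2group_abelian _ 2); rewrite ?oL.
  have sPC : P \subset 'C[t] by rewrite sub_cent1 (subsetP (abel4 P _)) ?oSyl.
  have sRC : R \subset 'C[t] by rewrite sub_cent1 (subsetP (abel4 R _)) ?oSyl.
  exists 'C[t]%G; apply: (mult4 _ P (oSyl P SP)).
    rewrite properE sPC /=; apply: contra nPR => sCP.
    have sRP := subset_trans sRC sCP.
    by apply/eqP/esym/val_inj/eqP; rewrite /= eqEcard sRP !oSyl.
  apply: contra t1 => /eqP defC; have nt : <[t]> <| G.
    by rewrite /normal subsetT cents_norm //= cent_cycle; apply/subsetP=> x Gx; have := defC => /= ->.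
  have := normal_coprime5 nt; rewrite -cycle_eq1 => ->//.
  have : #|<[t]>| %| 4 by rewrite -(oSyl P SP) cardSg ?cycle_subG.
  by move=> t4; apply/negP=> /dvdn_trans/(_ t4).
have : #|'Syl_2(G)| * 3 <= #|[set x : gT | #[x] != 5]|.
  apply: (@TI_family_card _ _ _ 4) => [P SP | P R SP SR ntPR].
    split; rewrite ?oSyl //; apply/subsetP=> x /setD1P[_ Px]; rewrite inE.
    by apply/eqP=> x5; have := order_dvdG Px; rewrite oSyl // x5.
  apply: contraNeq TI2 => nPR; apply/existsP; exists P; apply/existsP; exists R.
  by rewrite SP SR ntPR.
have := Sylow_order_card (isT : prime 5) (_ : logn 5 #|G| = 1%N).
rewrite nSyl nSyl2 oG => /(_ erefl) le24 le45.
have := cardsC [set x in G | #[x] == 5]; rewrite -cardsT oG => card60.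
suff : 6 * 4 + 15 * 3 <= 60 by [].
rewrite -card60; apply: leq_add le24 (leq_trans le45 _).
by apply: subset_leq_card; apply/subsetP=> x; rewrite !inE.
Qed.

End SixSylow5.

(** Permutations of five points are coded by their lists of values, in
    lexicographic order, the parity being that of the number of inversions.
    Element number 13 of [alt5] exchanges 0 with 1 and 2 with 3. *)
Fixpoint words5 k : seq (seq nat) :=
  if k is k'.+1 then [seq x :: w | x <- iota 0 5, w <- words5 k'] else [:: [::]].

Fixpoint inversions (w : seq nat) : nat :=
  if w is x :: w' then (count (gtn x) w' + inversions w')%N else 0.

Definition sym5 := [seq w <- words5 5 | uniq w].
Definition odd_word w := odd (inversions w).
Definition alt5 := [seq w <- sym5 | ~~ odd_word w].
Definition word_mul (u v : seq nat) := [seq nth 0 v i | i <- u].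
Definition code_mul (P : seq (seq nat)) (a b : nat) :=
  index (word_mul (nth [::] P a) (nth [::] P b)) P.

Lemma mem_words5 k w : (w \in words5 k) = (size w == k) && all (gtn 5) w.
Proof.
elim: k w => [|k IHk] [|x w] //.
  by apply/negP=> /allpairsP[[? ?] [_ _]].
have i5 i : (i \in iota 0 5) = (i < 5) by rewrite mem_iota.
rewrite -[all _ _]/((x < 5) && all (gtn 5) w) eqSS andbCA -IHk -i5.
apply/allpairsP/andP => [[[y v] [y5 vk [-> ->]]] // | [x5 wk]].
by exists (x, w).
Qed.

Section SearchA5.
Local Open Scope nat_scope.
Definition coloringsA5 : seq (seq nat) :=
  [::
     [:: 0; 0; 0; 2; 1; 1; 2; 0; 1; 2; 1; 1; 1; 1; 1; 0; 2; 0; 0; 2; 2; 1; 2; 0; 0; 2; 0; 2; 2;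
       1; 2; 0; 0; 2; 1; 2; 1; 0; 2; 1; 1; 2; 1; 1; 2; 0; 0; 0; 2; 2; 0; 0; 2; 1; 2; 0; 0; 1; 1;
       1];
     [:: 0; 0; 0; 1; 1; 1; 0; 0; 0; 1; 1; 1; 1; 1; 1; 2; 2; 2; 0; 0; 0; 2; 2; 2; 2; 2; 2; 0; 0;
       0; 0; 0; 0; 1; 1; 1; 1; 1; 1; 0; 0; 0; 2; 2; 2; 2; 2; 2; 2; 2; 2; 0; 0; 0; 1; 1; 1; 0; 0;
       0];
     [:: 0; 0; 0; 1; 2; 2; 0; 0; 0; 2; 1; 1; 2; 1; 2; 1; 2; 2; 2; 1; 1; 0; 0; 0; 1; 0; 0; 2; 0;
       1; 2; 1; 2; 1; 2; 2; 1; 2; 2; 2; 1; 1; 0; 1; 0; 0; 2; 1; 0; 0; 1; 2; 2; 1; 1; 0; 0; 2; 0;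
       1];
     [:: 0; 0; 0; 1; 1; 1; 1; 1; 1; 2; 2; 2; 1; 1; 1; 0; 0; 0; 2; 2; 2; 0; 0; 0; 2; 2; 2; 2; 2;
       2; 1; 1; 1; 0; 0; 0; 1; 1; 1; 0; 0; 0; 2; 2; 2; 1; 1; 1; 0; 0; 0; 1; 1; 1; 2; 2; 2; 0; 0;
       0];
     [:: 0; 0; 0; 1; 2; 1; 1; 2; 0; 1; 0; 1; 1; 1; 1; 0; 0; 1; 0; 1; 2; 0; 0; 2; 0; 0; 2; 1; 0;
       1; 1; 1; 1; 2; 0; 0; 2; 1; 0; 2; 1; 0; 0; 0; 0; 1; 1; 1; 0; 0; 1; 1; 2; 1; 1; 2; 1; 0; 0;
       0];
     [:: 0; 0; 0; 1; 1; 2; 0; 2; 1; 0; 1; 2; 1; 1; 1; 2; 1; 0; 2; 2; 0; 2; 0; 2; 2; 0; 0; 1; 2;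
       0; 1; 1; 1; 0; 0; 2; 2; 0; 2; 1; 1; 2; 0; 0; 0; 1; 1; 1; 2; 1; 0; 1; 2; 2; 2; 2; 1; 0; 0;
       2];
     [:: 0; 0; 0; 1; 2; 1; 0; 1; 2; 2; 2; 1; 2; 1; 2; 2; 2; 1; 0; 1; 0; 1; 0; 0; 1; 1; 2; 0; 0;
       0; 2; 2; 1; 1; 0; 2; 1; 1; 2; 2; 2; 1; 0; 0; 0; 1; 2; 0; 0; 0; 0; 2; 2; 1; 1; 1; 2; 0; 2;
       1];
     [:: 0; 0; 0; 0; 2; 2; 1; 1; 1; 1; 1; 2; 1; 1; 1; 0; 0; 2; 2; 0; 0; 2; 1; 0; 2; 1; 0; 1; 2;
       1; 2; 1; 0; 0; 0; 0; 2; 0; 0; 1; 2; 2; 0; 1; 2; 2; 2; 1; 2; 2; 0; 1; 2; 0; 1; 1; 1; 2; 0;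
       2];
     [:: 0; 0; 0; 1; 1; 1; 1; 1; 1; 2; 2; 2; 1; 1; 1; 2; 2; 2; 0; 0; 0; 0; 0; 0; 1; 1; 1; 0; 0;
       0; 2; 2; 2; 1; 1; 1; 2; 2; 2; 2; 2; 2; 1; 1; 1; 0; 0; 0; 0; 0; 0; 1; 1; 1; 0; 0; 0; 2; 2;
       2];
     [:: 0; 0; 2; 1; 1; 1; 1; 0; 1; 2; 0; 0; 2; 1; 1; 2; 1; 0; 0; 0; 0; 0; 1; 1; 0; 0; 0; 1; 2;
       0; 1; 2; 0; 1; 1; 1; 0; 0; 1; 1; 1; 1; 1; 0; 2; 0; 0; 2; 1; 1; 2; 0; 1; 0; 0; 0; 0; 2; 1;
       1];
     [:: 0; 0; 0; 1; 2; 1; 1; 2; 1; 0; 0; 0; 2; 1; 1; 2; 1; 2; 0; 0; 0; 2; 2; 1; 0; 0; 2; 0; 1;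
       2; 1; 0; 2; 1; 1; 2; 2; 0; 0; 1; 2; 1; 1; 2; 0; 0; 2; 1; 1; 1; 2; 2; 1; 2; 0; 0; 0; 2; 2;
       1];
     [:: 0; 0; 0; 0; 0; 0; 0; 0; 0; 0; 0; 0; 1; 1; 1; 1; 1; 1; 2; 2; 2; 2; 2; 2; 1; 1; 1; 2; 2;
       2; 2; 2; 2; 0; 0; 0; 1; 1; 1; 2; 2; 2; 1; 1; 1; 2; 2; 2; 1; 1; 1; 0; 0; 0; 2; 2; 2; 0; 0;
       0];
     [:: 0; 1; 2; 1; 1; 1; 0; 2; 0; 0; 0; 1; 0; 1; 1; 1; 0; 1; 0; 0; 2; 2; 0; 2; 2; 0; 0; 2; 0;
       2; 1; 1; 1; 1; 1; 0; 1; 1; 1; 0; 1; 2; 0; 2; 2; 0; 0; 2; 0; 2; 2; 1; 1; 1; 1; 0; 2; 2; 0;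
       1];
     [:: 0; 0; 0; 1; 1; 1; 1; 1; 1; 2; 2; 2; 1; 1; 1; 2; 2; 2; 0; 0; 0; 0; 0; 0; 2; 2; 2; 1; 1;
       1; 0; 0; 0; 2; 2; 2; 0; 0; 0; 0; 0; 0; 2; 2; 2; 1; 1; 1; 1; 1; 1; 2; 2; 2; 0; 0; 0; 2; 2;
       2];
     [:: 0; 0; 1; 1; 2; 1; 2; 1; 0; 0; 1; 2; 2; 1; 2; 0; 2; 1; 2; 1; 0; 1; 1; 2; 0; 1; 2; 2; 0;
       1; 2; 2; 0; 1; 0; 2; 0; 2; 2; 2; 0; 1; 0; 1; 1; 1; 0; 1; 0; 2; 1; 2; 0; 0; 0; 1; 2; 2; 2;
       1]].

(** Up to conjugation, element 13 is the only possible member of S: elements of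
    order 3 and 5 are excluded by the girth. *)
Lemma searchA5 : colorings_suffice 60 (code_mul alt5) coloringsA5 [:: 13].
Proof. by vm_cast_no_check (erefl true). Qed.

End SearchA5.

(** Parity is a morphism; this is a finite check on 120 words. *)
Lemma odd_word_mul :
  all (fun u => all (fun v => odd_word (word_mul u v) == odd_word u (+) odd_word v) sym5) sym5.
Proof. by vm_cast_no_check (erefl true). Qed.

Lemma alt5_orders :
  all (fun a => has (fun k => iter k (code_mul alt5 a) 0 == 0) [:: 2; 3; 5]) (iota 0 60).
Proof. by vm_cast_no_check (erefl true). Qed.

Lemma alt5_involutions_conjugate :
  all (fun a => (a != 0) && (iter 2 (code_mul alt5 a) 0 == 0) ==>
         has (fun i => code_mul alt5 i 13 == code_mul alt5 a i) (iota 0 60)) (iota 0 60).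
Proof. by vm_cast_no_check (erefl true). Qed.

Section FivePoints.
Variables (gT : finGroupType) (S : connection_set gT) (H : {group gT}).
Let G := [set: gT]%G.
Hypotheses (girth6 : girth_at_least (Cay S) 6) (oG : #|G| = 60) (nSyl : #|'Syl_5(G)| = 6).
Hypothesis oH : #|H| = 12.

(** The group acts faithfully on the five right cosets of H, and by even
    permutations, as the even elements would otherwise form a subgroup of order
    30.  Counting identifies it with [alt5]. *)
Let points := enum (rcosets H G).

Let size_points : size points = 5.
Proof.
rewrite -cardE; have := Lagrange (subsetT H).
by rewrite oG oH => /eqP; rewrite (@eqn_pmul2l 12 _ 5) // => /eqP.
Qed.

Let pointsM (X : {set gT}) g : X \in points -> X :* g \in points.
Proof.
rewrite !mem_enum => /rcosetsP[x _ ->]; rewrite -rcosetM.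
by apply/rcosetsP; exists (x * g); rewrite ?inE.
Qed.

Let code g := [seq index (X :* g) points | X <- points].

Let code_sym g : code g \in sym5.
Proof.
rewrite mem_filter mem_words5 size_map size_points eqxx; apply/andP; split.
  rewrite map_inj_in_uniq ?enum_uniq // => X Y LX LY /(congr1 (nth set0 points)).
  by rewrite !nth_index ?pointsM // => /rcoset_inj.
by apply/allP=> _ /mapP[X LX ->] /=; rewrite -size_points index_mem pointsM.
Qed.

Let codeM g h : code (g * h) = word_mul (code g) (code h).
Proof.
rewrite /word_mul -map_comp; apply/eq_in_map => X LX /=.
rewrite (nth_map set0) ?index_mem ?pointsM // nth_index ?pointsM //.
by rewrite rcosetM.
Qed.

Let code_inj : injective code.
Proof.
move=> g h eq_gh; apply/eqP; rewrite eq_mulgV1; apply/eqP/set1P; rewrite -set1gE.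
have <- : gcore H G = 1.
  apply: (normal_coprime5 oG nSyl); first by rewrite /normal subsetT gcore_norm.
  have : #|gcore H G| %| 12 by rewrite -oH cardSg ?gcore_sub.
  by move=> d12; apply/negP=> /dvdn_trans/(_ d12).
rewrite -astabRs_rcosets !inE /=.
apply/subsetP=> X LX; rewrite inE /=.
have {}LX : X \in points by rewrite mem_enum.
have := congr1 (nth set0 points) (congr1 (nth 0 ^~ (index X points)) eq_gh).
rewrite !(nth_map set0) ?index_mem // !nth_index ?pointsM // => gh.
by rewrite rcosetE rcosetM gh -rcosetM mulgV rcoset1.
Qed.

Let code_odd g h : odd_word (code (g * h)) = odd_word (code g) (+) odd_word (code h).
Proof. by rewrite codeM (eqP (allP (allP odd_word_mul _ (code_sym g)) _ (code_sym h))). Qed.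

Let code_alt g : code g \in alt5.
Proof.
rewrite mem_filter code_sym andbT.
have gK : group_set [set x | ~~ odd_word (code x)].
  apply/group_setP; split=> [|x y]; rewrite !inE.
    by rewrite -[1]mulg1 code_odd addbb.
  by rewrite code_odd => /negbTE-> /negbTE->.
pose K := Group gK; apply/negP=> odd_g.
have defG : G \subset K :|: K :* g^-1.
  apply/subsetP=> x _; rewrite inE mem_rcoset invgK !inE code_odd odd_g addbT negbK.
  by case: (odd_word _).
have gK0 : g \notin K by rewrite inE negbK.
have le60 : 60 <= #|K| + #|K|.
  rewrite -{2}(card_rcoset K g^-1) -oG; apply: leq_trans (subset_leq_card defG) _.
  by rewrite cardsU leq_subr.
have oK : #|K| = 30.
  have : #|K| \in [seq d <- divisors 60 | 60 <= d + d].
    by rewrite mem_filter le60 -dvdn_divisors // -oG cardSg ?subsetT.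
  rewrite (_ : [seq _ <- _ | _] = [:: 30; 60]) // !inE => /orP[/eqP//|/eqP oK].
  have defK : K :=: G by apply/eqP; rewrite eqEcard subsetT oK oG.
  by rewrite defK inE in gK0.
by have := @order_multiple5 gT oG nSyl K; rewrite oK => /(_ isT).
Qed.

Let phi a := nth 1 (enum gT) (index (nth [::] alt5 a) [seq code g | g <- enum gT]).

Let codes_alt : [seq code g | g <- enum gT] =i alt5.
Proof.
have [] // := uniq_min_size (_ : uniq [seq code g | g <- enum gT]) _ (_ : size alt5 <= _).
- by rewrite map_inj_uniq ?enum_uniq.
- by move=> _ /mapP[g _ ->].
by rewrite size_map -cardE -cardsT oG.
Qed.

Let code_phi a : a < 60 -> code (phi a) = nth [::] alt5 a.
Proof.
move=> lt_a; have im_a : nth [::] alt5 a \in [seq code g | g <- enum gT].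
  by rewrite codes_alt mem_nth.
by rewrite -(nth_map 1 [::]) ?nth_index // -(size_map code) index_mem.
Qed.

Let code_mul_lt a b : a < 60 -> b < 60 -> code_mul alt5 a b < 60.
Proof.
by move=> lt_a lt_b; rewrite -[60]/(size alt5) index_mem -!code_phi // -codeM.
Qed.

Let phiM a b : a < 60 -> b < 60 -> phi (code_mul alt5 a b) = phi a * phi b.
Proof.
move=> lt_a lt_b; apply: code_inj; rewrite codeM !code_phi ?code_mul_lt //.
by rewrite nth_index // -!code_phi // -codeM.
Qed.

Let phi_onto g : exists2 a, a < 60 & phi a = g.
Proof.
have lt_a : index (code g) alt5 < 60 by rewrite -[60]/(size alt5) index_mem.
by exists (index (code g) alt5) => //; apply: code_inj; rewrite code_phi // nth_index.
Qed.

Let phi_inj a b : a < 60 -> b < 60 -> phi a = phi b -> a = b.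
Proof.
move=> lt_a lt_b eq_ab; have : code (phi a) = code (phi b) by rewrite eq_ab.
by rewrite !code_phi // => /eqP; rewrite nth_uniq // => /eqP.
Qed.

Let phi0 : phi 0 = 1.
Proof. by apply: (mulgI (phi 0)); rewrite -phiM // mulg1. Qed.

(** Every element of S is an involution.  Conjugating the identification with
    [alt5] makes one of them element 13, where the search starts. *)
Lemma chromatic60_five_points : chromatic_number (Cay S) <= 3.
Proof.
have oT : #|gT| = 60 by rewrite -cardsT.
have [S0 | [s Ss]] := set_0Vmem S.
  apply: (abelian_support_chromatic girth6 (abelian1 gT)).
  by rewrite S0 sub0set.
have [a lt_a phi_a] := phi_onto s; have a60 : a \in iota 0 60 by rewrite mem_iota.
have phiX k : iter k (code_mul alt5 a) 0 < 60 /\ phi (iter k (code_mul alt5 a) 0) = s ^+ k.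
  elim: k => [|k [lt_k phi_k]]; first by rewrite phi0.
  by rewrite iterS code_mul_lt // phiM // phi_k phi_a expgS.
have a0 : a != 0.
  by apply: contraTneq Ss => a0; rewrite -phi_a a0 phi0 cset_not1.
have s2 : s ^+ 2 = 1.
  have /hasP[k k235 /eqP ak] := allP alt5_orders a a60; have [_ sk] := phiX k.
  rewrite ak phi0 in sk; have [<-|] := girth6_order girth6 Ss; first exact: expg_order.
  have : #[s] %| k by rewrite order_dvdn -sk.
  move/dvdn_leq => le_k /leq_trans/(_ (le_k _)); move: k235; rewrite !inE.
  by case/or3P=> /eqP-> /(_ isT).
have aa : iter 2 (code_mul alt5 a) 0 == 0.
  by have [lt2 phi2] := phiX 2; apply/eqP/phi_inj; rewrite // phi0 -s2.
have := allP alt5_involutions_conjugate a a60; rewrite a0 aa => /hasP[i].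
rewrite mem_iota /= => lt_i /eqP conj_a.
pose psi b := phi b ^ (phi i)^-1.
have psi0 : psi 0 = 1 by rewrite /psi phi0 conj1g.
have psi_onto g : exists2 b, b < 60 & psi b = g.
  have [b lt_b phi_b] := phi_onto (g ^ phi i); exists b => //.
  by rewrite /psi phi_b conjgK.
have psiM b c : b < 60 -> c < 60 -> psi (code_mul alt5 b c) = psi b * psi c.
  by move=> lt_b lt_c; rewrite /psi phiM // conjMg.
have psi13 : psi 13 = s.
  by rewrite /psi conjgE invgK mulgA -phiM // conj_a phiM // mulgK phi_a.
apply: (model_chromatic oT psi0 psi_onto code_mul_lt psiM girth6 searchA5).
by move=> t; rewrite inE => /eqP->; rewrite psi13.
Qed.

End FivePoints.

(** * Order 56 *)
Section Order56.
Variables (gT : finGroupType) (S : connection_set gT).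
Hypotheses (girth6 : girth_at_least (Cay S) 6) (oT : #|gT| = 56).
Let G := [set: gT]%G.
Let oG : #|G| = 56. Proof. by rewrite cardsT. Qed.

Section Normal7.
Variable p : gT.
Hypotheses (op : #[p] = 7) (np : <[p]> <| G).

(** The centraliser of <[p]> has index at most 2, so it meets Q in a nontrivial
    normal subgroup of Q, which contains an involution of the centre of Q; this
    centralises both p and Q. *)
Lemma central_involution56 (Q : {group gT}) : 2.-Sylow(G) Q ->
  exists t, [/\ t \in Q, #[t] = 2 & G \subset 'C[t]].
Proof.
move=> sylQ; have oQ : #|Q| = 8 by rewrite (card_Hall sylQ) oG p_part.
pose C := 'C_G(<[p]>)%G; have nC : C <| G.
  by have := subcent_normal G <[p]>; rewrite (setIidPl (normal_norm np)).
have iC2 : #|G : C| %| 2.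
  have := index_cent_dvd_Aut np; rewrite card_Aut_cycle op => i6.
  by rewrite -[2]/(gcdn 6 56) dvdn_gcd i6 -oG dvdn_indexg.
have nQC : Q :&: C <| Q := normalGI (subsetT Q) nC.
have sylQC : 2.-Sylow(C) (Q :&: C) by rewrite setIC; apply: Sylow_setI_normal nC sylQ.
have ntQC : Q :&: C != 1.
  rewrite trivg_card1 (card_Hall sylQC); have := Lagrange (normal_sub nC); rewrite oG.
  by case/primeP: (isT : prime 2) => _ /(_ _ iC2) /orP[] /eqP-> /eqP;
     rewrite ?muln1 ?(@eqn_pmul2r 2 _ 28) // => /eqP->; rewrite p_part.
have pQ := pHall_pgroup sylQ.
have := meet_center_nil (pgroup_nil pQ) nQC ntQC.
have /pgroup_pdiv pdvd : 2.-group (Q :&: C :&: 'Z(Q)).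
  by apply: pgroupS pQ; apply: subset_trans (subsetIr _ _) (center_sub Q).
case/pdvd=> _ /Cauchy[] // t; rewrite 2!inE -andbA => /and3P[Qt Ct Zt] ot _.
exists t; split=> //; have defG : <[p]> * Q = G.
  by apply/eqP; rewrite eqEcard subsetT coprime_cardMg -?orderE ?op ?oQ //= oG.
rewrite -[gval G]defG mul_subG //; last first.
  by rewrite sub_cent1 (subsetP _ t Zt) // subsetIr.
by case/setIP: Ct => _; rewrite sub_cent1.
Qed.

(** With a central involution t, the element h = p t generates a normal subgroup of
    order 14 and index 4, on which every element acts by the power 1 or -1.  The
    quotient is cyclic if some y in Q has its square outside <[h]>; otherwise y
    is chosen in the centraliser of p and z outside <[h]> <[y]>. *)
Lemma chromatic56_normal7 : chromatic_number (Cay S) <= 3.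
Proof.
have [Q sylQ] := Sylow_exists 2 G; have oQ : #|Q| = 8 by rewrite (card_Hall sylQ) oG p_part.
have [t [Qt ot tZ]] := central_involution56 sylQ.
have comt x : commute t x by apply/esym/cent1P; rewrite (subsetP tZ) ?inE.
pose h := p * t; have oh : #[h] = 14 by rewrite orderM ?op ?ot //; apply/esym/comt.
have h14 : h ^+ 14 = 1 by rewrite -oh expg_order.
have h7 : h ^+ 7 = t.
  rewrite expgMn; last exact/esym/comt.
  by rewrite -{1}op expg_order mul1g (_ : 7 = 2 * 3 + 1)%N // expgD expgM -{1}ot expg_order expg1n mul1g.
have defh : <[h]> = <[p]> * <[t]> by rewrite cycleM ?op ?ot //; apply/esym/comt.
have nh : <[h]> <| G.
  rewrite /normal subsetT defh normsM // ?(normal_norm np) //.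
  by rewrite cents_norm // centsC cycle_subG; apply/centP=> x _; apply: comt.
(* Elements of Q in <[h]> lie in <[t]>, as their orders divide 14 and 8. *)
have inQh x : x \in Q -> x \in <[h]> -> exists2 a, a \in [:: 0; 7]%N & x = h ^+ a.
  move=> Qx /cyclePmin[a]; rewrite oh => lt_a xa; exists a => //.
  have: all (fun a => (8 * a == 0 %[mod 14]) ==> (a \in [:: 0; 7]))%N (iota 0 14) by vm_compute.
  move/allP/(_ a); rewrite mem_iota lt_a => /(_ isT)/implyP; apply.
  by rewrite -oh -eq_expg_mod_order expg0 mulnC expgM -xa -oQ expg_cardG.
have iH : #|G : <[h]>| = 4.
  by have /eqP := Lagrange (normal_sub nh); rewrite oG -orderE oh (@eqn_pmul2l 14 _ 4) // => /eqP.
pose C := 'C_G(<[p]>)%G; have nC : C <| G.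
  by have := subcent_normal G <[p]>; rewrite (setIidPl (normal_norm np)).
have iC2 : #|G : C| %| 2.
  have := index_cent_dvd_Aut np; rewrite card_Aut_cycle op => i6.
  by rewrite -[2]/(gcdn 6 56) dvdn_gcd i6 -oG dvdn_indexg.
have act_h x u : u < 14 -> x * h = h ^+ u * x -> u \in [:: 1; 13]%N.
  move=> lt_u xh.
  have: all (fun u => (u ^ 2 == 1 %[mod 14]) ==> (u \in [:: 1; 13]))%N (iota 0 14) by vm_compute.
  move/allP/(_ u); rewrite mem_iota lt_u => /(_ isT)/implyP; apply.
  have x2C : x ^+ 2 \in C.
    by case/dvdnP: iC2 => k ->; rewrite mulnC expgM groupX // expg_index_normal // inE.
  rewrite -oh -eq_expg_mod_order expg1 -(inj_eq (mulIg (x ^+ 2))) -(action_power 2 xh).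
  apply/eqP; apply: commuteM; last exact/esym/comt.
  by apply: (centP (subsetP (subsetIr _ _) _ x2C)); apply: cycle_id.
have [/exists_inP[y Qy y2] | ] := boolP [exists y in Q, y ^+ 2 \notin <[h]>].
  have [u lt_u yh] := normal_cycle_action y nh; rewrite oh in lt_u.
  have [a a07 ya] : exists2 a, a \in [:: 0; 7]%N & y ^+ 4 = h ^+ a.
    apply: inQh; first exact: groupX.
    by rewrite -iH expg_index_normal ?inE.
  have ua : (u, a) \in [:: (1, 0); (1, 7); (13, 0); (13, 7)]%N.
    by move: (act_h _ _ lt_u yh) a07; rewrite !inE => /orP[] /eqP-> /orP[] /eqP->.
  apply: (polycyclic_chromatic (c := h) (y := y) (z := 1) _ _ _ _ _ _ _ _ _ _ _ _ _
            (search56_cyclic ua) girth6) => //.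
  - by rewrite mulg1 mul1g.
  - by rewrite !mul1g mulg1.
  - exact/commute_sym/commute1.
  - exact/commute_sym/commute1.
  by rewrite cycle1 mulg1 (index4_gen nh iH) ?inE.
rewrite negb_exists_in => /forall_inP sqQ; have {}sqQ x : x \in Q -> x ^+ 2 \in <[h]>.
  by move/sqQ; rewrite negbK.
have sylQC : 2.-Sylow(C) (C :&: Q) := Sylow_setI_normal nC sylQ.
have [y /setIP[Cy Qy] hy] : exists2 y, y \in C :&: Q & y \notin <[h]>.
  apply/subsetPn/negP => sQh.
  have : C :&: Q \subset <[t]>.
    apply/subsetP=> x CQx; have [a] := inQh x (subsetP (subsetIr _ _) x CQx) (subsetP sQh x CQx).
    by rewrite !inE => /orP[] /eqP-> ->; rewrite ?group1 // h7 cycle_id.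
  move/subset_leq_card; rewrite -orderE ot (card_Hall sylQC).
  have := Lagrange (normal_sub nC); rewrite oG.
  by case/primeP: (isT : prime 2) => _ /(_ _ iC2) /orP[] /eqP-> /eqP;
     rewrite ?muln1 ?(@eqn_pmul2r 2 _ 28) // => /eqP->; rewrite p_part.
have yh : y * h = h ^+ 1 * y.
  rewrite expg1; apply: commuteM; last exact/esym/comt.
  by apply: (centP (subsetP (subsetIr _ _) _ Cy)); apply: cycle_id.
pose L := (<[h]> <*> <[y]>)%G.
have nhy : <[y]> \subset 'N(<[h]>) by rewrite (subset_trans (subsetT _)) ?normal_norm.
have defL : L = <[h]> * <[y]> :> {set gT} := norm_joinEr nhy.
have sLG : L \subset G := subsetT L.
have nhL : <[h]> <| L := normalS (joing_subl _ _) sLG nh.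
have Ly : y \in L by rewrite (subsetP (joing_subr _ _)) ?cycle_id.
have oL : #|L| = 28.
  have Ny : y \in 'N(<[h]>) by rewrite (subsetP (normal_norm nh)) ?inE.
  have oy : #[coset <[h]> y] = 2.
    apply: nt_prime_order => //.
      by rewrite -morphX //; apply: coset_id; apply: sqQ.
    by apply: contra hy => /eqP; apply: coset_idr.
  rewrite -(Lagrange (normal_sub nhL)) -card_quotient ?normal_norm //.
  by rewrite /L /= quotientYidl // quotient_cycle // -!orderE oy oh.
have [z Qz Lz] : exists2 z, z \in Q & z \notin L.
  apply/subsetPn/negP => sQL; have := cardSg sQL.
  by rewrite oQ oL.
have iL : #|G : L| = 2.
  by have /eqP := Lagrange sLG; rewrite oL oG (@eqn_pmul2l 28 _ 2) // => /eqP.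
have nLG : L <| G := index2_normal sLG iL.
have [v lt_v zh] := normal_cycle_action z nh; rewrite oh in lt_v.
have [a a07 ya] := inQh _ (groupX 2 Qy) (sqQ y Qy).
have [b b07 zb] := inQh _ (groupX 2 Qz) (sqQ z Qz).
have [d d07 zyd] : exists2 d, d \in [:: 0; 7]%N & z * y * z^-1 * y^-1 = h ^+ d.
  apply: inQh; first by rewrite !groupM ?groupV.
  have -> : z * y * z^-1 * y^-1 = [~ z^-1, y^-1] by rewrite commgEl conjgE !invgK !mulgA.
  have abGh : abelian (G / <[h]>).
    by apply: (@card_p2group_abelian _ 2); rewrite // card_quotient ?normal_norm.
  by apply: (subsetP (der1_min (normal_norm nh) abGh)); rewrite mem_commg ?inE.
have zy : z * y = h ^+ d * y ^+ 1 * z by rewrite -zyd expg1 !mulgKV.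
have comh e x : e \in [:: 0; 7]%N -> commute (h ^+ e) x.
  by rewrite !inE => /orP[] /eqP->; [apply/esym/commute1 | rewrite h7; apply: comt].
have abd : (a, (b, d)) \in relators56.
  by move: a07 b07 d07; rewrite !inE => /orP[] /eqP-> /orP[] /eqP-> /orP[] /eqP->.
have gen : [set: gT] = <[h]> * <[y]> * <[z]>.
  by rewrite -defL (prime_index_gen nLG) ?iL ?inE.
move: (act_h z v lt_v zh); rewrite !inE => /orP[] /eqP v_; rewrite v_ in zh.
  exact: (@polycyclic_chromatic gT 14 2 2 1 1 1 a b d h y z oT isT isT isT h14 ya zb yh zh zy
            (comh _ _ d07) (comh _ _ b07) gen _ S (search56_central abd) girth6).
exact: (@polycyclic_chromatic gT 14 2 2 1 13 1 a b d h y z oT isT isT isT h14 ya zb yh zh zy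
          (comh _ _ d07) (comh _ _ b07) gen _ S (search56_inverted abd) girth6).
Qed.

End Normal7.

(** With eight Sylow 7-subgroups the Sylow 2-subgroup V is normal, a subgroup of
    order 7 permutes its nonidentity elements regularly, and all elements outside
    V have order 7.  Taking for c an element of S outside V gives the search its
    starting point. *)
Section Frobenius.
Hypothesis nSyl : #|'Syl_7(G)| = 8.

Let self_normal c : #[c] = 7 -> 'N_G(<[c]>) = <[c]>.
Proof.
move=> oc; have sylc : 7.-Sylow(G) <[c]> by rewrite pHallE subsetT oG p_part -orderE oc.
have := Lagrange (subsetIl G 'N(<[c]>)); rewrite -(card_Syl sylc) nSyl oG.
move/eqP; rewrite (@eqn_pmul2r 8 _ 7) // => /eqP oN.
by apply/esym/eqP; rewrite eqEcard oN -orderE oc subsetI subsetT normG.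
Qed.

Variable V : {group gT}.
Hypothesis sylV : 2.-Sylow(G) V.

Let oV : #|V| = 8. Proof. by rewrite (card_Hall sylV) oG p_part. Qed.

Let nV : V <| G.
Proof. by apply: (@Sylow_complement_normal _ G V 7); rewrite ?nSyl ?oG ?oV ?subsetT. Qed.

Let centralizer7 (c w : gT) : #[c] = 7 -> commute c w -> w \in <[c]>.
Proof.
move=> oc cw; rewrite -(self_normal oc) inE in_setT /=.
by apply: (subsetP (cent_sub _)); rewrite cent_cycle; apply/cent1P/esym.
Qed.

Let fixed_point_free (c w : gT) : #[c] = 7 -> w \in V -> commute c w -> w = 1.
Proof.
move=> oc Vw cw; apply/set1P; rewrite -set1gE.
have <- : V :&: <[c]> = 1 by apply: coprime_TIg; rewrite -orderE oc oV.
by rewrite inE Vw centralizer7.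
Qed.

Let order7 x : x \notin V -> #[x] = 7.
Proof.
rewrite (mem_normal_Hall sylV nV) ?inE // /p_elt => x2.
have x56 : #[x] %| 8 * 7 by rewrite -[(8 * 7)%N]oG order_dvdG ?inE.
have x7 : 7 %| #[x].
  apply: contraR x2; rewrite -prime_coprime // coprime_sym => co7.
  by rewrite Gauss_dvdl // in x56; apply: pnat_dvd x56 _.
have /dvdnP[k ox] := x7; have k_gt0 : 0 < k by move: (order_gt0 x); rewrite ox; case: (k).
have oxk : #[x ^+ k] = 7 by rewrite orderXdiv ox ?dvdn_mulr // mulKn.
have xx : x \in <[x ^+ k]> by apply: centralizer7 => //; apply/esym/commuteX.
have : #[x] %| 7 by rewrite -oxk order_dvdG.
case/primeP: (isT : prime 7) => _ d7 /d7 /orP[/eqP x1|/eqP//].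
by rewrite x1 in x7.
Qed.

Lemma chromatic_F56 : chromatic_number (Cay S) <= 3.
Proof.
have [w0 Vw0 ow0] : {w0 | w0 \in V & #[w0] = 2} by apply: Cauchy; rewrite ?oV.
have nt0 : w0 != 1 by rewrite -order_gt1 ow0.
have JV g w : w \in V -> w ^ g \in V.
  by move=> Vw; rewrite memJ_norm // (subsetP (normal_norm nV)) ?inE.
(* An element of order 7 permutes the nonidentity elements of V cyclically. *)
have orbV (c w : gT) : #[c] = 7 -> w \in V -> w != 1 -> exists g, w = w0 ^ g.
  move=> oc Vw nt; suff : w \in w0 ^: <[c]> by case/imsetP=> g _ ->; exists g.
  have -> : w0 ^: <[c]> = V^#; last by rewrite !inE nt.
  apply/eqP; rewrite eqEcard; apply/andP; split.
    by apply/subsetP=> _ /imsetP[g _ ->]; rewrite !inE conjg_eq1 nt0 JV.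
  have /eqP := cardsD1 1 V; rewrite oV group1 eqSS => /eqP <-.
  rewrite -index_cent1; have : #|<[c]> : 'C_<[c]>[w0]| %| 7 by rewrite -oc orderE dvdn_indexg.
  case/primeP: (isT : prime 7) => _ d7 /d7 /orP[|/eqP->//].
  rewrite indexg_eq1 subsetI subxx /= => /subsetP/(_ c (cycle_id c)) /cent1P cw.
  by rewrite (fixed_point_free oc Vw0) ?eqxx // in nt0.
have [c0 _ oc0] : {c | c \in G & #[c] = 7} by apply: Cauchy; rewrite // oG.
have V2 w : w \in V -> w ^+ 2 = 1.
  have [-> _ | nt Vw] := eqVneq w 1; first exact: expg1n.
  by have [g ->] := orbV c0 w oc0 Vw nt; rewrite -conjXg -ow0 expg_order conj1g.
have VV w : w \in V -> w^-1 = w.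
  by move=> Vw; apply/eqP; rewrite eq_invg_mul -[X in _ * X]expg1 -expgS V2.
have comV x y : x \in V -> y \in V -> commute x y.
  by move=> Vx Vy; rewrite /commute -[x * y]VV ?groupM // invMg !VV.
have abV : abelian V by apply/centsP=> x Vx y Vy; apply: comV.
have [SV|] := boolP (S \subset V); first exact: abelian_support_chromatic girth6 _ abV SV.
case/subsetPn=> c Sc Vc; have oc := order7 Vc.
pose f w := w ^ c^-1; have fV w : w \in V -> f w \in V by apply: JV.
have f_inj : injective f by apply: conjg_inj.
have fM : {morph f : x y / x * y} by move=> x y; apply: conjMg.
have fix_f k : 0 < k < 7 -> iter k f w0 != w0.
  move=> /andP[k_gt0 k_lt7]; have -> : iter k f w0 = w0 ^ (c^-1 ^+ k).
    by elim: (k) => [|i IHi]; rewrite ?conjg1 // iterS IHi expgSr conjgM.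
  have ock : #[c^-1 ^+ k] = 7.
    by rewrite orderXgcd orderV oc; case: k k_gt0 k_lt7 => [|[|[|[|[|[|[|]]]]]]].
  by apply: contra nt0 => /eqP/conjg_fixP/commgP/esym/(fixed_point_free ock Vw0)->.
pose w1 := f w0; pose w2 := f w1; pose w3 := f w2; pose w4 := f w3.
have [Vw1 Vw2 Vw3] : [/\ w1 \in V, w2 \in V & w3 \in V] by rewrite !fV.
have n10 : w1 != w0 := fix_f 1%N isT.
have n20 : w2 != w0 := fix_f 2 isT.
have n30 : w3 != w0 := fix_f 3 isT.
have n40 : w4 != w0 := fix_f 4 isT.
have n21 : w2 != w1 by rewrite (inj_eq f_inj).
have n31 : w3 != w1 by rewrite (inj_eq f_inj).
have n32 : w3 != w2 by rewrite !(inj_eq f_inj).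
have f_nt w : w != 1 -> f w != 1 by rewrite conjg_eq1.
have [nt1 nt2 nt3] : [/\ w1 != 1, w2 != 1 & w3 != 1] by rewrite !f_nt.
have n2_01 : w2 != w0 * w1.
  apply: contra n30 => /eqP w2E; rewrite /w3 w2E fM -/w1 -/w2 w2E (comV w0) //.
  by rewrite mulgA -{2}(VV _ Vw1) mulgV mul1g.
have cf w : c * w = f w * c by rewrite /f conjgE invgK -!mulgA mulVg mulg1.
have o2 w : w \in V -> w != 1 -> #[w] = 2.
  by move=> Vw nt; apply: nt_prime_order => //; apply: V2.
have defV : <[w0]> * <[w1]> * <[w2]> = V.
  have def01 : <[w0]> <*> <[w1]> = <[w0]> * <[w1]>.
    by rewrite cent_joinEr // cycle_subG /= cent_cycle; apply/cent1P/comV.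
  have o01 : #|<[w0]> <*> <[w1]>| = 4.
    rewrite def01 TI_cardMg -?orderE ?o2 //.
    by rewrite prime_TIg -?orderE ?o2 // cycle_subG /= (cycle2g (o2 _ Vw1 nt1)) !inE negb_or nt0 eq_sym.
  rewrite -def01; apply/eqP; rewrite eqEcard mul_subG ?join_subG ?cycle_subG ?Vw0 //=.
  rewrite TI_cardMg ?o01 -?orderE ?o2 ?oV // setIC.
  rewrite prime_TIg -?orderE ?o2 // cycle_subG /= def01.
  rewrite (cycle2g (o2 _ Vw0 nt0)) (cycle2g (o2 _ Vw1 nt1)).
  apply/negP=> /mulsgP[x y]; rewrite !inE.
  case/orP=> /eqP-> /orP[] /eqP->; rewrite ?mul1g ?mulg1 => /eqP;
    by rewrite ?(negbTE nt2) ?(negbTE n20) ?(negbTE n21) ?(negbTE n2_01).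
have vecV w : w \in V -> exists2 v, v < 8 & w = vec_elt w0 w1 w2 v.
  rewrite -defV => /mulsgP[_ _ /mulsgP[_ _ /cycleP[i ->] /cycleP[j ->] ->] /cycleP[k ->] ->].
  exists (vec i j k); last by rewrite vec_elt_vec ?V2.
  rewrite /vec; have lt2 b : b %% 2 < 2 by rewrite ltn_pmod.
  by case: (i %% 2) (lt2 i) => [|[|//]] _; case: (j %% 2) (lt2 j) => [|[|//]] _;
     case: (k %% 2) (lt2 k) => [|[|//]] _.
have [e lt_e w3E] := vecV w3 Vw3.
(* The only relations compatible with a regular 7-cycle are those given by the
   two irreducible cubic polynomials over F_2. *)
have e35 : e \in [:: 3; 5].
  rewrite /vec_elt in w3E.
  case: e lt_e w3E => [|[|[|[|[|[|[|[|//]]]]]]]] _ //= w3E; exfalso;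
    move: w3E; rewrite ?mulg1 ?mul1g ?expg1 => /eqP.
  - by rewrite (negbTE nt3).
  - by rewrite (negbTE n30).
  - by rewrite (negbTE n31).
  - by rewrite (negbTE n32).
  - by rewrite -[w3]/(f w2) -/(f w0) -/w1 -[w1 * w2]fM (inj_eq f_inj) (negbTE n2_01).
  move/eqP=> w3E; case/eqP: n40; have fw2 : f w2 = w0 * w1 * w2 := w3E.
  have V12 : w1 * w2 \in V by rewrite groupM.
  rewrite /w4 w3E (fM (w0 * w1)) (fM w0) fw2 -/w1 -/w2 -(mulgA w0) [LHS]mulgA (comV (w1 * w2) w0) //.
  by rewrite -mulgA -{1}(VV _ V12) mulVg mulg1.
apply: (@affine_chromatic _ 8 7 2 4 e w0 w1 w2 c oT _ _ _ _ _ _ _ _ _ _ _ _ _ _ _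
   _ _ _ (searchF56 e35) _ girth6) => //; rewrite ?V2 //; try exact: comV.
- by rewrite -oc expg_order.
- by rewrite cf /vec_elt /= mul1g mulg1.
- by rewrite cf /vec_elt /= !mul1g.
- by rewrite cf -/w3 w3E.
- move=> g; have : g \in V * <[c]>.
    suff -> : V * <[c]> = G by rewrite inE.
    by apply/eqP; rewrite eqEcard subsetT coprime_cardMg -?orderE ?oc ?oV //= oG.
  case/mulsgP=> w _ Vw /cycleP[i ->] ->; have [v lt_v ->] := vecV w Vw.
  by exists v => //; exists i.
move=> x; rewrite !inE => /orP[] /eqP->; rewrite /vec_elt /= !mulg1 !mul1g; split=> //.
have -> : c ^+ 6 = c^-1 by apply/eqP; rewrite eq_sym eq_invg_mul -expgS -oc expg_order.
by rewrite mem_setV.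
Qed.

End Frobenius.

Lemma chromatic56 : chromatic_number (Cay S) <= 3.
Proof.
have := Syl_dvd_mod G (isT : prime 7); rewrite oG.
have -> : [seq d <- divisors 56 | d %% 7 == 1%N] = [:: 1; 8]%N by [].
rewrite !inE => /orP[/normal_sylowP[P sylP nP] | /eqP nSyl]; last first.
  by have [V sylV] := Sylow_exists 2 G; exact: (chromatic_F56 nSyl sylV).
have oP : #|P| = 7 by rewrite (card_Hall sylP) oG p_part.
have /cyclicP[p defP] : cyclic P by rewrite prime_cyclic // oP.
by apply: (@chromatic56_normal7 p); rewrite ?orderE -?defP.
Qed.

End Order56.

(** * Order 54 *)
Lemma odd_involution_fixpoint (T : finType) (f : T -> T) (X : {set T}) :
  (forall x, x \in X -> f x \in X) -> (forall x, x \in X -> f (f x) = x) -> odd #|X| ->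
  exists2 x, x \in X & f x = x.
Proof.
have [n] := ubnP #|X|; elim: n X => // n IHn X le_X fX ffX oddX.
have [x Xx] : exists x, x \in X by apply/set0Pn; rewrite -card_gt0 odd_gt0.
have [fx|nfx] := eqVneq (f x) x; first by exists x.
have Xfx := fX x Xx.
have oX : #|X| = #|X :\ x :\ f x|.+2.
  by rewrite (cardsD1 x) Xx (cardsD1 (f x)) !inE nfx Xfx.
have [||||y] := IHn (X :\ x :\ f x).
- by rewrite oX ltnS in le_X; apply: ltnW.
- move=> y; rewrite !inE => /and3P[nyfx nyx Xy]; rewrite fX // andbT; apply/andP; split.
    by apply: contraNneq nyx => fyfx; rewrite -(ffX y) // fyfx ffX.
  by apply: contraNneq nyfx => <-; rewrite ffX.
- by move=> y; rewrite !inE => /and3P[_ _ /ffX].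
- by rewrite oX /= negbK in oddX.
by rewrite !inE => /and3P[_ _ Xy] fy; exists y.
Qed.

(** An involution acts on the quotient of order 3 by inverting or fixing it, and
    on the odd coset x H, followed by inversion in the first case, as an
    involution; a fixed point is centralised or inverted. *)
Lemma involution_eigenelement (gT : finGroupType) (K H : {group gT}) t :
  t ^+ 2 = 1 -> t \in 'N(K) -> t \in 'N(H) -> H <| K -> #|K : H| = 3 -> odd #|H| ->
  exists x, [/\ x \in K, x \notin H & x ^ t \in [set x; x^-1]].
Proof.
move=> t2 Kt Ht nHK iHK oddH.
have /subsetPn[x Kx Hx] : ~~ (K \subset H) by rewrite -indexg_eq1 iHK.
have nH y : y \in K -> y \in 'N(H) by apply: subsetP; apply: normal_norm.
have tt y : (y ^ t) ^ t = y by rewrite -conjgM -[X in X * _]expg1 -expgSr t2 conjg1.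
have odd_coset y : odd #|H :* y| by rewrite card_rcoset.
have Hxt : x ^ t \notin H by rewrite memJ_norm.
have Kxt : x ^ t \in K by rewrite memJ_norm.
have : x ^ t \in H :* x \/ x ^ t \in H :* x^-1.
  have oKH : #|K / H| = 3 by rewrite card_quotient ?normal_norm.
  have Qx : coset H x \in K / H by rewrite mem_quotient.
  have ox : #[coset H x] = 3.
    have : #[coset H x] %| 3 by rewrite -oKH order_dvdG.
    case/primeP: (isT : prime 3) => _ d3 /d3 /orP[|/eqP//].
    by rewrite order_eq1 => /eqP x1; rewrite (coset_idr (nH x Kx)) in Hx.
  have : coset H (x ^ t) \in <[coset H x]>.
    have -> : <[coset H x]> = K / H by apply/eqP; rewrite eqEcard cycle_subG Qx oKH -orderE ox.
    by rewrite mem_quotient.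
  case/cyclePmin=> i; rewrite ox => lt_i3 xti.
  have {}xti : coset H (x ^ t) = coset H (x ^+ i) by rewrite morphX ?nH.
  have [i0|[i1|i2]] : i = 0 \/ i = 1%N \/ i = 2 by case: (i) lt_i3 => [|[|[|]]] //; auto.
  - case/negP: Hxt; apply: coset_idr; rewrite ?nH // xti i0.
    exact: morph1.
  - by left; apply/rcoset_kercosetP; rewrite ?nH // xti i1.
  right; apply/rcoset_kercosetP; rewrite ?groupV ?nH //.
  rewrite xti i2 morphX ?nH // morphV ?nH //; apply/esym/eqP.
  by rewrite eq_invg_mul -expgS -ox expg_order.
case=> xtH.
  have [||y Hxy yt] := @odd_involution_fixpoint _ (conjg^~ t) (H :* x) _ _ (odd_coset x).
  - move=> y /rcosetP[h Hh ->]; rewrite conjMg mem_rcoset -mulgA groupMl ?memJ_norm //.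
    by rewrite -mem_rcoset.
  - by move=> y _; apply: tt.
  exists y; rewrite yt !inE eqxx; split=> //; case/rcosetP: Hxy => h Hh -> {yt y}.
    by rewrite groupM // (subsetP (normal_sub nHK)).
  by rewrite groupMl.
have inv_coset y : y \in H :* x -> (y ^ t)^-1 \in H :* x.
  case/rcosetP=> h Hh ->; rewrite conjMg; case/rcosetP: xtH => k Hk ->.
  have : h ^ t \in H by rewrite memJ_norm.
  move: (h ^ t) => l Hl; rewrite norm_rlcoset ?nH // mem_lcoset !invMg invgK -!mulgA mulKg.
  by rewrite groupM ?groupV.
have [||z Hxz zt] := @odd_involution_fixpoint _ (fun y => (y ^ t)^-1) (H :* x) _ _ (odd_coset x).
- exact: inv_coset.
- by move=> y _; rewrite conjVg invgK.
have {}zt : z ^ t = z^-1 by rewrite -[LHS]invgK zt.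
exists z; rewrite zt !inE eqxx orbT; split=> //; case/rcosetP: Hxz => h Hh -> {zt z}.
  by rewrite groupM // (subsetP (normal_sub nHK)).
by rewrite groupMl.
Qed.

Section Order54.
Variables (gT : finGroupType) (S : connection_set gT).
Hypotheses (girth6 : girth_at_least (Cay S) 6) (oT : #|gT| = 54).
Let G := [set: gT]%G.
Let oG : #|G| = 54. Proof. by rewrite cardsT. Qed.

(** Here <[a]> <[b]> has order 27.  The action exponents k of b on a and e1, e2 of t
    on a and b satisfy k^3 = 1 and e1 k = k^e2 e1 modulo 9. *)
Lemma chromatic54_normal_form (a b t : gT) :
  #[a] = 9 -> #[b] = 3 -> #[t] = 2 -> <[a]> <| G -> b \notin <[a]> ->
  a ^ t \in [set a; a^-1] -> b ^ t \in [set b; b^-1] ->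
  chromatic_number (Cay S) <= 3.
Proof.
move=> oa ob ot na bNa aTt bTt.
have [a9 b3 t2] : [/\ a ^+ 9 = 1, b ^+ 3 = 1 & t ^+ 2 = 1].
  by split; rewrite -?oa -?ob -?ot expg_order.
have tV : t^-1 = t by apply/eqP; rewrite eq_invg_mul -[X in _ * X]expg1 -expgS t2.
have tJ x : t * x = x ^ t * t by rewrite conjgE tV -!mulgA -[X in _ * (_ * X)]expg1 -[t * t]/(t ^+ 2) t2 mulg1.
have [e1 e1_ ta] : exists2 e, e \in [:: 1; 8]%N & t * a = a ^+ e * t.
  case/set2P: aTt => at_; rewrite tJ at_; first by exists 1%N.
  exists 8 => //; congr (_ * _); apply/eqP.
  by rewrite eq_invg_mul -expgS a9.
have [e2 e2_ tb] : exists2 e, e \in [:: 1; 2]%N & t * b = b ^+ e * t.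
  case/set2P: bTt => bt_; rewrite tJ bt_; first by exists 1%N.
  exists 2 => //; congr (_ * _); apply/eqP.
  by rewrite eq_invg_mul -expgS b3.
have [k lt_k ba] := normal_cycle_action b na; rewrite oa in lt_k.
have k_ : k \in [:: 1; 4; 7]%N.
  have: all (fun k => (k ^ 3 == 1 %[mod 9]) ==> (k \in [:: 1; 4; 7]))%N (iota 0 9) by vm_compute.
  move/allP/(_ k); rewrite mem_iota lt_k => /(_ isT)/implyP; apply.
  rewrite -oa -eq_expg_mod_order expg1 -(inj_eq (mulIg (b ^+ 3))) -(action_power 3 ba).
  by rewrite b3 mulg1 mul1g.
have kk : (e1 * k == k ^ e2 * e1 %[mod 9])%N.
  rewrite -oa -eq_expg_mod_order -(inj_eq (mulIg (b ^+ e2 * t))); apply/eqP.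
  have -> : a ^+ (e1 * k) * (b ^+ e2 * t) = t * (b * a).
    by rewrite ba [RHS]mulgA (shift_power _ ta) -[RHS]mulgA tb.
  rewrite mulgA tb -mulgA ta mulgA (shift_power _ (action_power e2 ba)).
  by rewrite -mulgA.
have kee : (k, (e1, e2)) \in [:: (1, (1, 1)); (1, (1, 2)); (1, (8, 1)); (1, (8, 2));
    (4, (1, 1)); (4, (8, 1)); (7, (1, 1)); (7, (8, 1))]%N.
  by move: k_ e1_ e2_ kk; rewrite !inE => /or3P[] /eqP-> /orP[] /eqP-> /orP[] /eqP->.
have gen : [set: gT] = <[a]> * <[b]> * <[t]>.
  have nab : <[b]> \subset 'N(<[a]>) by rewrite (subset_trans (subsetT _)) ?normal_norm.
  have oab : #|<[a]> <*> <[b]>| = 27.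
    by rewrite norm_joinEr // TI_cardMg -?orderE ?oa ?ob // setIC prime_TIg -?orderE ?ob // cycle_subG.
  rewrite -norm_joinEr //; apply/esym/eqP; rewrite eqEcard subsetT.
  by rewrite coprime_cardMg -?orderE ?ot /= oab // oG.
apply: (@polycyclic_chromatic gT 9 3 2 k e1 e2 0 0 0 a b t oT isT isT isT a9 b3 t2 ba ta _
  (commute_sym (commute1 _)) (commute_sym (commute1 _)) gen _ S (search54 kee) girth6).
by rewrite mul1g.
Qed.

(** Let P be the Sylow 3-subgroup, of index 2.  If P is cyclic, or S misses P, the
    general results apply.  Otherwise S contains an element of P, of order 9, so
    the elements of order dividing 3 form a subgroup N of order 9 in P.  An
    involution t centralises or inverts some a in P outside N and some b in N
    outside <[a^3]>. *)
Lemma chromatic54 : chromatic_number (Cay S) <= 3.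
Proof.
have [P sylP] := Sylow_exists 3 G; have oP : #|P| = 27 by rewrite (card_Hall sylP) oG p_part.
have iP : #|G : P| = 2.
  by have /eqP := Lagrange (subsetT P); rewrite oG oP (@eqn_pmul2l 27 _ 2) // => /eqP.
have nP : P <| G := index2_normal (subsetT P) iP.
have pP : 3.-group P := pHall_pgroup sylP.
have [cycP | ncP] := boolP (cyclic P).
  by apply: (cyclic_index2_chromatic girth6 (m := 27) _ oP cycP iP); vm_compute.
have [dSP | ] := boolP [disjoint S & P].
  exact: bipartite_chromatic (bipartite_index2 iP dSP).
case/pred0Pn=> s /andP[/= Ss Ps].
have order_P x : x \in P -> x ^+ 3 != 1 -> #[x] = 9.
  move=> Px x3; have : #[x] %| 3 ^ 3 by rewrite -[(3 ^ 3)%N]oP order_dvdG.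
  case/(dvdn_pfactor _ 3 (isT : prime 3)) => [[|[|[|[|//]]]] _ ox //].
  - by rewrite -order_dvdn ox in x3.
  - by rewrite -order_dvdn ox in x3.
  case/negP: ncP; apply/cyclicP; exists x; apply/esym/eqP.
  by rewrite eqEcard cycle_subG Px oP -orderE ox.
have s9 : #[s] = 9.
  apply: order_P => //; rewrite -order_dvdn; apply/negP=> /dvdn_leq le3.
  by have [s2|] := girth6_order girth6 Ss; [have := order_dvdG Ps; rewrite s2 oP | rewrite ltnNge (leq_trans (le3 _))].
pose N := 'Ohm_1(P)%G.
have N3 : N :=: 'Ldiv_3(P).
  apply: Ohm1Eexponent => //; apply: exponent_Ohm1_class2 => //.
  by apply: leq_trans (nil_class_pgroup pP) _; rewrite oP.
have oN : #|N| = 9.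
  have : #|N| %| 3 ^ 3 by rewrite -[(3 ^ 3)%N]oP cardSg ?Ohm_sub.
  have ltN : #|N| < 27.
    rewrite -oP proper_card // properE Ohm_sub /=; apply/subsetPn; exists s => //.
    by rewrite /= N3 !inE -order_dvdn s9 andbF.
  have leN : 9 <= #|N|.
    have : 2 <= 'r_3(P) by rewrite ltnNge -(odd_pgroup_rank1_cyclic pP) ?oP.
    case/p_rank_geP=> E EP; have [sEP abE _] := pnElemP EP.
    by rewrite -[9]/(3 ^ 2)%N -(card_pnElem EP) subset_leq_card // -(Ohm1_id abE) OhmS.
  by case/(dvdn_pfactor _ 3 (isT : prime 3)) => [[|[|[|[|//]]]] _ eN]; rewrite eN // in ltN leN *.
have [t _ ot] : {t | t \in G & #[t] = 2} by apply: Cauchy; rewrite // oG.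
have t2 : t ^+ 2 = 1 by rewrite -ot expg_order.
have Pt : t \in 'N(P) by rewrite (subsetP (normal_norm nP)) ?inE.
have Nt : t \in 'N(N).
  by rewrite -sub1set (char_norm_trans (Ohm_char 1 P)) ?sub1set.
have nNP : N <| P := Ohm_normal 1 P.
have iN : #|P : N| = 3.
  by have /eqP := Lagrange (normal_sub nNP); rewrite oN oP (@eqn_pmul2l 9 _ 3) // => /eqP.
have [|a [Pa Na aTt]] := involution_eigenelement t2 Pt Nt nNP iN; first by rewrite oN.
have oa : #[a] = 9.
  by apply: order_P => //; apply: contra Na => a3; rewrite N3 !inE Pa.
have a9 : a ^+ 9 = 1 by rewrite -oa expg_order.
have na_t : t \in 'N(<[a]>).
  rewrite inE -cycleJ cycle_subG.
  by case/set2P: aTt => ->; rewrite ?groupV cycle_id.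
pose Z := <[a ^+ 3]>%G; have oZ : #|Z| = 3 by rewrite -orderE orderXdiv oa.
have sZN : Z \subset N.
  by rewrite cycle_subG N3 !inE groupX //= -expgM a9.
have iZ : #|N : Z| = 3.
  by have /eqP := Lagrange sZN; rewrite oN oZ (@eqn_pmul2l 3 _ 3) // => /eqP.
have normal3 (M K : {group gT}) : 3.-group K -> M \subset K -> #|K : M| = 3 -> M <| K.
  by move=> pK sMK iM; apply: (p_maximal_normal pK); apply: p_index_maximal; rewrite ?iM.
have nZN : Z <| N by apply: normal3 => //; apply: pgroupS pP; apply: Ohm_sub.
have Zt : t \in 'N(Z).
  rewrite inE -cycleJ cycle_subG conjXg.
  by case/set2P: aTt => ->; rewrite ?expgVn ?groupV cycle_id.
have [|b [Nb Zb bTt]] := involution_eigenelement t2 Nt Zt nZN iZ; first by rewrite oZ.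
have b3 : b ^+ 3 = 1 by move: Nb; rewrite /= N3 !inE => /andP[_ /eqP].
have ob : #[b] = 3.
  by apply: nt_prime_order => //; apply: contraNneq Zb => ->; apply: group1.
have bNa : b \notin <[a]>.
  apply: contra Zb => /cycleP[i bi].
  have : 3 * 3 %| i * 3 by rewrite -[(3 * 3)%N]oa order_dvdn expgM -bi b3.
  by rewrite dvdn_pmul2r // => /dvdnP[j ij]; rewrite bi ij mulnC expgM mem_cycle.
apply: (chromatic54_normal_form oa ob ot _ bNa aTt bTt).
have oPa : #|P : <[a]>| = 3.
  have sa : <[a]> \subset P by rewrite cycle_subG.
  by have /eqP := Lagrange sa; rewrite oP -orderE oa (@eqn_pmul2l 9 _ 3) // => /eqP.
have naP : <[a]> <| P by apply: normal3; rewrite // cycle_subG.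
rewrite /normal subsetT /=.
have <- : P * <[t]> = G.
  by apply/eqP; rewrite eqEcard subsetT coprime_cardMg -?orderE ?oP ?ot //= oG.
by rewrite mul_subG // ?cycle_subG // normal_norm.
Qed.

End Order54.

(** * All orders from 54 to 63 *)

Section Orders54to63.
Variables (gT : finGroupType) (S : connection_set gT).
Hypothesis girth6 : girth_at_least (Cay S) 6.

Lemma chromatic60 : #|gT| = 60 -> chromatic_number (Cay S) <= 3.
Proof.
move=> oT; have oG : #|[set: gT]%G| = 60 by rewrite cardsT.
have := Syl_dvd_mod [set: gT]%G (isT : prime 5); rewrite oG !inE => /orP[/normal_sylowP[P sylP nP] | /eqP n6].
  have oP : #|P| = 5 by rewrite (card_Hall sylP) oG p_part.
  have /cyclicP[p defP] : cyclic P by apply: prime_cyclic; rewrite oP.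
  by apply: (chromatic60_normal5 girth6 oT (p := p)); rewrite -?defP // orderE -defP.
have [H oH] := exists_subgroup12 oG n6.
exact: chromatic60_five_points girth6 oG n6 oH.
Qed.

Lemma twice_prime_chromatic p : prime p -> #|gT| = (p * 2)%N ->
  all (fun k => (k * k == 1 %[mod p])%N ==> (k == 1%N) || (k == p.-1)) (iota 0 p) ->
  chromatic_number (Cay S) <= 3.
Proof.
move=> p_pr oT sq1; have oG : #|[set: gT]%G| = (p * 2)%N by rewrite cardsT.
have [c _ oc] : {c | c \in [set: gT]%G & #[c] = p} by apply: Cauchy; rewrite // oG dvdn_mulr.
apply: (cyclic_index2_chromatic girth6 sq1 (A := <[c]>%G)); rewrite -?orderE ?cycle_cyclic //.
have /eqP := Lagrange (subsetT <[c]>); rewrite oG -orderE oc.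
by rewrite eqn_pmul2l ?prime_gt0 // => /eqP.
Qed.

Lemma chromatic54_63 : 54 <= #|gT| <= 63 -> chromatic_number (Cay S) <= 3.
Proof.
move=> lim; have : #|gT| \in iota 54 10 by rewrite mem_iota.
rewrite !inE; case/orP=> [/eqP|]; first exact: chromatic54.
case/orP=> [/eqP oT|].
  by apply: (pq_order_chromatic girth6 (p := 11) (q := 5)); rewrite ?oT.
case/orP=> [/eqP|]; first exact: chromatic56.
case/orP=> [/eqP oT|].
  by apply: (pq_order_chromatic girth6 (p := 19) (q := 3)); rewrite ?oT.
case/orP=> [/eqP oT|].
  by apply: (@twice_prime_chromatic 29); rewrite ?oT //; vm_compute.
case/orP=> [/eqP oT|]; first by apply: prime_order_chromatic; rewrite ?oT.
case/orP=> [/eqP|]; first exact: chromatic60.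
case/orP=> [/eqP oT|]; first by apply: prime_order_chromatic; rewrite ?oT.
case/orP=> [/eqP oT|/eqP]; last exact: chromatic63.
by apply: (@twice_prime_chromatic 31); rewrite ?oT //; vm_compute.
Qed.

End Orders54to63.

Theorem proposition6 :
  (* (i) *)
  (forall (gT : finGroupType) (S : connection_set gT), abelian [set: gT] ->
     (3 <= #|S| -> girth_at_most (Cay S) 4) /\
     (forall s t : gT, s \in S -> t \in S -> t \notin [set s; s^-1] ->
        is_cycle (G := Cay S) [:: 1; s; s * t; t])) /\
  (* (ii) *)
  (forall (A : finGroupType) (abelA : abelian [set: A])
          (S : connection_set (Dih abelA)),
     [/\ ~ (girth_at_least (Cay S) 6 /\ 4 <= chromatic_number (Cay S)),
         forall a rho : Dih abelA,
           a \in S -> a \in rotations abelA ->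
           rho \in S -> rho \in reflections abelA ->
           is_cycle (G := Cay S) [:: 1; rho; rho * a; a^-1]
       & S \subset reflections abelA -> bipartite (Cay S)]) /\
  (* (iii) *)
  (forall gT : finGroupType, 54 <= #|gT| <= 63 ->
     ~ abelian [set: gT] -> ~ generalized_dihedral gT ->
     forall S : connection_set gT, 4 <= #|S| <= 7 ->
     ~ (girth_at_least (Cay S) 6 /\ 4 <= chromatic_number (Cay S))) /\
  (* consequences *)
  (forall gT : finGroupType, 54 <= #|gT| <= 63 ->
     forall S : connection_set gT,
     ~ (girth_at_least (Cay S) 6 /\ chromatic_number (Cay S) = 4)) /\
  (forall G : sgraph, #|G| = 59 \/ #|G| = 61 -> vertex_transitive G ->
     ~ (girth_at_least G 6 /\ 4 <= chromatic_number G)).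
Proof.
split=> [gT S abG|].
  split=> [S3 | s t sS tS]; first exact: abelian_girth4.
  by apply: commuting_square => //; apply: (centsP abG); rewrite inE.
split=> [A abelA S|].
  split=> [[girth6] | a rho aS aA rhoS rhoR | SR].
  - by rewrite ltnNge dihedral_chromatic.
  - exact: rotation_reflection_square.
  exact: reflections_bipartite.
split=> [gT oT _ _ S _ [girth6]|]; first by rewrite ltnNge chromatic54_63.
split=> [gT oT S [girth6 chi4] | G oG vtG [girth6]].
  by have := chromatic54_63 girth6 oT; rewrite chi4.
by rewrite ltnNge vertex_transitive_prime_chromatic //; case: oG => ->.
Qed.
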